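(* Let $\mathcal{H}$ be a toric hyperplane arrangement on the $n$-dimensional torus $T^n$ that subdivides the torus into a regular cell complex, with face poset $T_t$ and intersection poset $\mathcal{P}$. Then $$\Psi(T_t)=(\mathbf a-\mathbf b)^{n+1}+\frac12\cdot\omega\bigl(\mathbf a\cdot H'(\Psi(\mathcal{P}))\cdot\mathbf b\bigr)^*.$$
   Context: $T^n=\mathbb{R}^n/\mathbb{Z}^n$; a toric hyperplane is the image of $\{\vec x:\vec a\cdot\vec x=b\}$, $\vec a\in\mathbb{Q}^n\setminus\{0\}$, $b\in\mathbb R$; a toric arrangement is a finite set of them. $\mathcal{P}$: all connected components of all intersections of the hyperplanes (empty intersection $=T^n$) plus $\emptyset$, ordered by reverse inclusion, with ranks $\rho(x)=n-\dim x$ for nonempty $x$, $\rho(\emptyset)=n+1$. $T_t$: cells of the subdivision plus the empty face (rank 0) and the torus (rank $n+2$), ordered by closure containment, $i$-cells of rank $i+1$. For a poset $P$ with $\hat0,\hat1$ and rank function with $\rho(\hat1)=N+1$: $f_S$ ($S=\{s_1<\dots<s_{k-1}\}\subseteq\{1,\dots,N\}$) counts chains $\hat0<x_1<\dots<x_{k-1}<\hat1$ with $\rho(x_j)=s_j$; $h_S=\sum_{T\subseteq S}(-1)^{|S-T|}f_T$; $\Psi(P)=\sum_Sh_Su_S\in\mathbb{Z}\langle\mathbf a,\mathbf b\rangle$, $u_S=u_1\cdots u_N$ with $u_i=\mathbf b$ if $i\in S$, else $\mathbf a$. $H'$ is the linear map deleting the last letter of each monomial ($H'(w\mathbf a)=H'(w\mathbf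 b)=w$, $H'(1)=0$). $^*$ reverses each monomial, extended linearly. $\mathbf c=\mathbf a+\mathbf b$, $\mathbf d=\mathbf{ab}+\mathbf{ba}$; $\omega$ is the linear map that, on an $\mathbf{ab}$-monomial, replaces every occurrence of $\mathbf{ab}$ by $2\mathbf d$ and then every remaining letter by $\mathbf c$ (the result viewed in $\mathbb{Z}\langle\mathbf a,\mathbf b\rangle$). *)

(* Defs.v *)
From HB Require Import structures.
From mathcomp Require Import all_boot all_order all_algebra finmap.
From mathcomp Require Import all_classical all_reals topology normedtype.
(* The notations of monalg clash with those of MathComp-Analysis. *)
From mathcomp.multinomials Require Import -(notations) monalg.

Set Implicit Arguments.
Unset Strict Implicit.
Unset Printing Implicit Defensive.

Import Order.TTheory GRing.Theory Num.Theory.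
Import numFieldNormedType.Exports.

Local Open Scope classical_set_scope.
Local Open Scope ring_scope.
Local Open Scope quotient_scope.

(* Noncommutative polynomials in a and b: the algebra of the free monoid on
   bool, [false] standing for the letter a and [true] for b. The coefficients
   are taken in Q, which contains Z, so that 1/2 makes sense. *)
Notation abpoly := (malg (fmonom bool) rat).

Definition ab_word (w : seq bool) : abpoly := mkmalgU (FMonom w) 1.

Definition ab_a : abpoly := ab_word [:: false].
Definition ab_b : abpoly := ab_word [:: true].
Definition ab_c : abpoly := ab_a + ab_b.
Definition ab_d : abpoly := ab_a * ab_b + ab_b * ab_a.

Definition ab_lin (f : seq bool -> abpoly) (p : abpoly) : abpoly :=
  \sum_(w <- msupp p) mcoeff w p *: f w.

Definition ab_rev : abpoly -> abpoly := ab_lin (fun w => ab_word (rev w)).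

Definition Hprime : abpoly -> abpoly :=
  ab_lin (fun w => if w is x :: s then ab_word (belast x s) else 0).

(* Occurrences of ab in a word cannot overlap, so that they can be replaced
   from left to right. *)
Fixpoint omega_word (w : seq bool) : abpoly :=
  match w with
  | [::] => 1
  | false :: ((true :: s) as t) => (2 *: ab_d) * omega_word s
  | _ :: t => ab_c * omega_word t
  end.

Definition omega : abpoly -> abpoly := ab_lin omega_word.

(* The elements of the poset are those of [rp_elt]; order, rank and bounds are
   only meaningful there. *)
Record ranked_poset := RankedPoset {
  rp_type : Type;
  rp_elt : set rp_type;
  rp_le : rp_type -> rp_type -> Prop;
  rp_rank : rp_type -> nat;
  rp_bot : rp_type;
  rp_top : rp_type }.

Section ABIndex.
Variable P : ranked_poset.

Definition rp_lt (x y : rp_type P) : Prop := rp_le x y /\ x <> y.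

Definition rp_N : nat := (rp_rank (rp_top P)).-1.

(* The element i of 'I_N stands for the rank i + 1 in {1, ..., N}; [enum S] is
   in increasing order. *)
Definition flag_chains (S : {set 'I_rp_N}) : set (seq {classic rp_type P}) :=
  [set c : seq {classic rp_type P} |
   [/\ forall x, x \in c -> rp_elt x,
       path (fun x y => `[< rp_lt x y >]) (rp_bot P)
            (rcons c (rp_top P)) &
       [seq rp_rank x | x <- c] = [seq (val i).+1 | i <- enum S]]].

Definition flag_f (S : {set 'I_rp_N}) : nat := #|` fset_set (flag_chains S)|%fset.

Definition flag_h (S : {set 'I_rp_N}) : int :=
  \sum_(T : {set 'I_rp_N} | T \subset S) (-1) ^+ #|S :\: T| * (flag_f T)%:Z.

Definition ab_index : abpoly :=
  \sum_(S : {set 'I_rp_N})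
    (flag_h S)%:~R *: \prod_(i < rp_N) (if i \in S then ab_b else ab_a).

End ABIndex.

Section Torus.
Variables (R : realType) (n : nat).

Definition torus_rel (x y : 'rV[R]_n) : bool :=
  [forall i, (x 0 i - y 0 i) \is a Num.int].

Lemma torus_rel_refl : reflexive torus_rel.
Proof. by move=> x; apply/forallP => i; rewrite subrr rpred0. Qed.

Lemma torus_rel_sym : symmetric torus_rel.
Proof.
by move=> x y; apply/eq_forallb => i; rewrite -[LHS]rpredN opprB.
Qed.

Lemma torus_rel_trans : transitive torus_rel.
Proof.
move=> y x z /forallP xy /forallP yz; apply/forallP => i.
by rewrite -[x 0 i](subrK (y 0 i)) -addrA rpredD.
Qed.

Canonical torus_equiv :=
  EquivRel torus_rel torus_rel_refl torus_rel_sym torus_rel_trans.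

Definition torus : topologicalType :=
  quotient_topology {eq_quot torus_equiv}.

Definition torus_pi (x : 'rV[R]_n) : torus := \pi_{eq_quot torus_equiv} x.

Definition toric_hyperplane (a : 'rV[rat]_n) (b : R) : set torus :=
  torus_pi @` [set x : 'rV[R]_n | \sum_(i < n) ratr (a 0 i) * x 0 i = b].

Definition toric_arrangement (A : set (set torus)) : Prop :=
  finite_set A /\
  forall H, A H -> exists a b, a != 0 /\ H = toric_hyperplane a b.

(* The dimension of a subset of the torus that is the image of a relatively
   open subset of an affine subspace, as are the elements of the intersection
   poset and the cells: the maximal number of linearly independent directions
   of segments it contains. *)
Definition segment_direction (F : set torus) (v : 'rV[R]_n) : Prop :=
  exists p : 'rV[R]_n, forall t : R, 0 <= t <= 1 -> F (torus_pi (p + t *: v)).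

Definition toric_dim (F : set torus) : nat :=
  (\max_(d < n.+1 | `[< exists M : 'M[R]_(d, n),
       row_free M /\ forall i, segment_direction F (row i M) >]) d)%N.

Definition components (B : set torus) : set (set torus) :=
  connected_component B @` B.

Definition toric_flats (A : set (set torus)) : set (set torus) :=
  \bigcup_(S in [set S | S `<=` A]) components (\bigcap_(H in S) H).

Definition intersection_poset (A : set (set torus)) : ranked_poset :=
  RankedPoset (toric_flats A `|` [set set0])
    (fun x y => y `<=` x)
    (fun x => if `[< x = set0 >] then n.+1 else (n - toric_dim x)%N)
    setT set0.

(* The points of the torus lying on the hyperplanes of S and on no other
   hyperplane of A. *)
Definition stratum (A S : set (set torus)) : set torus :=
  [set p | forall H, A H -> (H p <-> S H)].

Definition toric_cells (A : set (set torus)) : set (set torus) :=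
  \bigcup_(S in [set S | S `<=` A]) components (stratum A S).

Inductive toric_face := EmptyFace | CellFace of set torus | TorusFace.

Definition face_poset (A : set (set torus)) : ranked_poset :=
  RankedPoset
    [set x | if x is CellFace e then toric_cells A e else True]
    (fun x y => match x, y with
       | EmptyFace, _ | _, TorusFace => True
       | CellFace e, CellFace f => closure e `<=` closure f
       | _, _ => False
       end)
    (fun x => match x with
       | EmptyFace => 0%N
       | CellFace e => (toric_dim e).+1
       | TorusFace => n.+2
       end)
    EmptyFace TorusFace.

End Torus.

Section RegularCellComplex.
Variables (R : realType) (X : topologicalType).

Definition closed_ball_rV (d : nat) : set 'rV[R]_d :=
  [set v | \sum_(i < d) v 0 i ^+ 2 <= 1].

Definition open_ball_rV (d : nat) : set 'rV[R]_d :=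
  [set v | \sum_(i < d) v 0 i ^+ 2 < 1].

Arguments closed_ball_rV : clear implicits.
Arguments open_ball_rV : clear implicits.

Definition homeomorphism_on (Y Z : topologicalType) (B : set Y) (C : set Z)
    (f : Y -> Z) : Prop :=
  exists g : Z -> Y,
    [/\ f @` B = C, forall y, B y -> g (f y) = y,
        {within B, continuous f} & {within C, continuous g}].

(* A finite regular cell complex structure on the whole of X, the cell e having
   dimension [dim e]. *)
Definition regular_cell_complex (cells : set (set X)) (dim : set X -> nat) :
    Prop :=
  [/\ finite_set cells,
      trivIset cells id,
      \bigcup_(e in cells) e = setT,
      forall e, cells e -> exists f : 'rV[R]_(dim e) -> X,
        homeomorphism_on (closed_ball_rV (dim e)) (closure e) f /\
        f @` open_ball_rV (dim e) = e &
      forall e, cells e -> exists2 D : set (set X),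
        D `<=` [set e' | cells e' /\ (dim e' < dim e)%N] &
        closure e `\` e = \bigcup_(e' in D) e'].

End RegularCellComplex.

Arguments regular_cell_complex R {X} cells dim.

(* Main.v *)
(** Both ab-indices are sums over chains in which an element of a rank present in
    the chain contributes the letter b and an absent rank contributes a - b.
    Summing first over the chains of cells above a cell F, downward induction on
    the dimension expresses the resulting polynomial through the chains of flats
    above the flat spanned by F, because of two Euler relations: for every flat
    containing F, the cells of that flat having F as a face have the alternating
    sum of a ball with F in its interior, and the cells of a flat of positive
    dimension have the alternating sum 0 of a torus.  The map omega enters
    through the recursion that it satisfies on words read from right to left.

    The local relation follows by cutting a cone by one hyperplane at a time.
    For the global one, a generic linear form l attains its maximum on each
    closed cell at one vertex; the cells with a given top vertex v form the part
    of the star of v on which l is negative, and their alternating sum is 0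
    unless the flat is a point.

    Regularity is used twice: a cell of minimal dimension is a point, so the
    normals span, and the projection from the universal cover is injective on
    closed cells, so that the star of a point of the torus can be computed
    upstairs. *)

Require Import Defs.
From HB Require Import structures.
From mathcomp Require Import all_boot all_order all_algebra finmap.
From mathcomp Require Import all_classical all_reals topology normedtype derive.
From mathcomp.multinomials Require Import -(notations) monalg.
From mathcomp Require Import ring lra zify.

Import Order.TTheory GRing.Theory Num.Theory.
Local Open Scope ring_scope.

(** * ab-polynomials and the map omega *)

(** The map omega is not multiplicative, and this shapes the algebra. Read backwards it becomes a
    reader with two states, [alpha] without and [beta] with a pending letter b. Since c^2 - 2d = (a
    - b)^2, [alpha] lets even powers of a - b pass and annihilates odd ones, which matches the signs
    in the Euler relations. The invariant of the induction is that the chain sum above a cell equals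
    [alpha] of the chain sum above its flat. The two sides are linked by 2b = (a + b) - (a - b), so
    the identities are proved doubled; this is the origin of the factor 1/2. In the last sum only
    the flats that are points survive, and H' likewise keeps only the chains through a point. On the
    geometric side, primitive normals turn each hyperplane into the set where one affine form, its
    [height], takes integer values. Faces, cells and closures upstairs are then comparisons of
    floors and ceilings, and convexity gives connectedness. The obstacle is the projection to the
    torus: a closed cell might be glued to itself, and excluding this is the delicate use of
    regularity. *)

Lemma ab_word_cat u v : ab_word (u ++ v) = ab_word u * ab_word v.
Proof.
rewrite /ab_word malgM_def fgmulUU mulr1; congr mkmalgU.
by apply/eqP; rewrite fmP fmM.
Qed.

Lemma ab_word_nil : ab_word [::] = 1.
Proof. by apply/malgP => k; rewrite /ab_word mcoeff1 mcoeffU1 eq_sym; congr (_ == _)%:R; apply/eqP; rewrite fmP fm1. Qed.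

Lemma abpolyE (p : abpoly) :
  p = \sum_(w <- msupp p) mcoeff w p *: ab_word w.
Proof.
rewrite [LHS]monalgE; apply: eq_bigr => k _.
apply/malgP => j; rewrite mcoeffZ mcoeffU /ab_word mcoeffU1 fmK.
by rewrite mulr_natr.
Qed.

Lemma abpoly_ind (P : abpoly -> Prop) :
  (forall w, P (ab_word w)) -> (forall p q, P p -> P q -> P (p + q)) ->
  (forall (c : rat) p, P p -> P (c *: p)) -> forall p, P p.
Proof.
move=> Pw PD PZ p; rewrite [p]abpolyE.
elim/big_rec: _ => [|i q _ Pq]; first by rewrite -(scale0r (ab_word [::])); exact: PZ.
by apply: PD => //; apply: PZ.
Qed.

Lemma ab_lin_ew f (p : abpoly) (d : {fset fmonom bool}) :
  (msupp p `<=` d)%fset -> ab_lin f p = \sum_(w <- d) mcoeff w p *: f w.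
Proof.
move=> sub; rewrite /ab_lin (big_fset_incl _ sub) // => k _ /mcoeff_outdom ->.
by rewrite scale0r.
Qed.

Lemma ab_lin_is_linear f : linear (ab_lin f).
Proof.
move=> c p q; pose d := (msupp p `|` msupp q `|` msupp (c *: p + q))%fset.
rewrite !(@ab_lin_ew f _ d); first last.
- by rewrite /d fsubsetUr.
- by apply/fsubsetP => x xp; rewrite /d !inE xp.
- by apply/fsubsetP => x xp; rewrite /d !inE xp ?orbT.
rewrite scaler_sumr -big_split /=; apply: eq_bigr => k _.
by rewrite mcoeffD mcoeffZ scalerDl scalerA.
Qed.

HB.instance Definition _ f :=
  GRing.isLinear.Build rat abpoly abpoly *:%R (ab_lin f) (ab_lin_is_linear f).

Lemma ab_lin_word f w : ab_lin f (ab_word w) = f w.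
Proof.
by rewrite /ab_lin /ab_word msuppU1 big_seq_fset1 mcoeffUU scale1r.
Qed.

Lemma ab_linD f p q : ab_lin f (p + q) = ab_lin f p + ab_lin f q.
Proof. exact: linearD. Qed.

Lemma ab_linZ f (c : rat) p : ab_lin f (c *: p) = c *: ab_lin f p.
Proof. exact: linearZ. Qed.

Lemma ab_scalerAr (c : rat) (p q : abpoly) : p * (c *: q) = c *: (p * q).
Proof.
move: q c; apply: abpoly_ind => [v|q q' Hq Hq'|k q Hq] c; last first.
- by rewrite scalerA !Hq scalerA.
- by rewrite scalerDr !mulrDr Hq Hq' scalerDr.
move: p; apply: abpoly_ind => [w|p p' Hp Hp'|k p Hp]; last first.
- by rewrite -!scalerAl Hp !scalerA mulrC.
- by rewrite !mulrDl Hp Hp' scalerDr.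
rewrite -ab_word_cat /ab_word malgM_def.
have scU (u : fmonom bool) : c *: mkmalgU u 1 = mkmalgU u c.
  by apply/malgP => j; rewrite mcoeffZ !mcoeffU mulr_natr.
rewrite !scU fgmulUU mul1r; congr mkmalgU.
by apply/eqP; rewrite fmP fmM.
Qed.

Set Implicit Arguments.
Unset Strict Implicit.
Unset Printing Implicit Defensive.

(* Unifying two distinct polynomials by unfolding the monoid algebra does not
   terminate in reasonable time. *)
Local Opaque ab_lin fgmul fgadd fgscale mkmalgU.

Lemma addr_congr (V : nmodType) (x x' y y' : V) :
  x = x' -> y = y' -> x + y = x' + y'.
Proof. by move=> -> ->. Qed.

Lemma scaler_congr (K : pzRingType) (V : lmodType K) (c : K) (x y : V) :
  x = y -> c *: x = c *: y.
Proof. by move=> ->. Qed.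

Lemma ab_lin_mull (f g : seq bool -> abpoly) (u q : abpoly) :
  (forall w, ab_lin f (u * ab_word w) = q * g w) ->
  forall p, ab_lin f (u * p) = q * ab_lin g p.
Proof.
move=> H; apply: abpoly_ind => [w|p p' Hp Hp'|c p Hp].
- by rewrite H ab_lin_word.
- by rewrite mulrDr !ab_linD mulrDr; exact: addr_congr Hp Hp'.
- by rewrite ab_scalerAr !ab_linZ ab_scalerAr; exact: scaler_congr Hp.
Qed.

Lemma ab_rev_word w : ab_rev (ab_word w) = ab_word (rev w).
Proof. exact: ab_lin_word. Qed.

Lemma ab_revM p q : ab_rev (p * q) = ab_rev q * ab_rev p.
Proof.
rewrite /ab_rev; move: q p; apply: abpoly_ind => [v|q q' Hq Hq'|c q Hq] p.
- move: p; apply: abpoly_ind => [w|p p' Hp Hp'|c p Hp].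
  + by rewrite -ab_word_cat !ab_lin_word rev_cat ab_word_cat.
  + by rewrite mulrDl !ab_linD mulrDr; exact: addr_congr Hp Hp'.
  + by rewrite -scalerAl !ab_linZ ab_scalerAr; exact: scaler_congr Hp.
- by rewrite mulrDr !ab_linD mulrDl; exact: addr_congr (Hq _) (Hq' _).
- by rewrite ab_scalerAr !ab_linZ -scalerAl; exact: scaler_congr (Hq _).
Qed.

Lemma ab_revK : involutive ab_rev.
Proof.
rewrite /ab_rev; apply: abpoly_ind => [w|p q Hp Hq|c p Hp].
- by rewrite !ab_lin_word revK.
- by rewrite !ab_linD; exact: addr_congr Hp Hq.
- by rewrite !ab_linZ; exact: scaler_congr Hp.
Qed.

Lemma ab_revD p q : ab_rev (p + q) = ab_rev p + ab_rev q.
Proof. exact: linearD. Qed.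

(* The mirror image of omega: it reads words from left to right, [st] recording
   whether a letter b is pending, so that every ba is replaced by 2d. *)
Fixpoint omega_rev_word (st : bool) (w : seq bool) : abpoly :=
  match w, st with
  | [::], false => 1
  | [::], true => ab_c
  | false :: s, false => ab_c * omega_rev_word false s
  | false :: s, true => ab_d *+ 2 * omega_rev_word false s
  | true :: s, false => omega_rev_word true s
  | true :: s, true => ab_c * omega_rev_word true s
  end.

Lemma omega_rev_word_ba st w :
  omega_rev_word st (w ++ [:: true; false]) = omega_rev_word st w * (ab_d *+ 2).
Proof.
elim: w st => [|x w IH] [] /=; rewrite ?mulr1 ?mul1r //.
  by case: x; rewrite IH mulrA.
by case: x; rewrite IH ?mulrA.
Qed.

Lemma omega_rev_word_b st w :
  omega_rev_word st (w ++ [:: true]) = omega_rev_word st w * ab_c.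
Proof.
elim: w st => [|x w IH] [] /=; rewrite ?mulr1 ?mul1r //.
  by case: x; rewrite IH mulrA.
by case: x; rewrite IH ?mulrA.
Qed.

Lemma omega_rev_word_aa st w :
  omega_rev_word st (w ++ [:: false; false]) =
  omega_rev_word st (w ++ [:: false]) * ab_c.
Proof.
elim: w st => [|x w IH] [] /=; rewrite ?mulr1 ?mul1r //.
  by case: x; rewrite IH mulrA.
by case: x; rewrite IH ?mulrA.
Qed.

Lemma rev_ab_a : ab_rev ab_a = ab_a.
Proof. exact: ab_rev_word. Qed.

Lemma rev_ab_b : ab_rev ab_b = ab_b.
Proof. exact: ab_rev_word. Qed.

Lemma rev_ab_c : ab_rev ab_c = ab_c.
Proof. by rewrite /ab_c ab_revD rev_ab_a rev_ab_b. Qed.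

Lemma rev_ab_d : ab_rev ab_d = ab_d.
Proof. by rewrite /ab_d ab_revD addrC; apply: addr_congr; rewrite ab_revM rev_ab_a rev_ab_b. Qed.

(** [omega_word] may consume two letters at once, hence the induction on the length. After reversal
    these letters stand at the right end, where [omega_rev_word_ba], [omega_rev_word_b] and
    [omega_rev_word_aa] apply. *)
Lemma rev_omega_word w : ab_rev (omega_word w) = omega_rev_word false (rev w).
Proof.
have [k] := ubnP (size w); elim: k w => // k IH [|x w] szw.
  by rewrite /= -ab_word_nil ab_rev_word.
have szw' : (size w < k)%N by [].
have Hc : ab_rev (ab_c * omega_word w) = omega_rev_word false (rev w) * ab_c.
  by rewrite ab_revM rev_ab_c IH.
rewrite rev_cons -cats1; case: x szw => szw.
  by rewrite omega_rev_word_b -Hc.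
case: w szw' Hc {szw} => [|[] w] szw' Hc.
- by rewrite [LHS]Hc mul1r; apply: esym (mulr1 _).
- rewrite [omega_word _]/= rev_cons -cats1 -catA omega_rev_word_ba.
  rewrite ab_revM IH; last by rewrite /= in szw'; lia.
  congr (_ * _); rewrite /ab_rev ab_linZ.
  by rewrite -/(ab_rev ab_d) rev_ab_d scaler_nat.
- by rewrite rev_cons -cats1 -catA omega_rev_word_aa cats1 -rev_cons -Hc.
Qed.

Definition omega_rev (st : bool) : abpoly -> abpoly := ab_lin (omega_rev_word st).

HB.instance Definition _ st := GRing.Linear.copy (omega_rev st) (ab_lin (omega_rev_word st)).

Lemma rev_omega p : ab_rev (omega p) = omega_rev false (ab_rev p).
Proof.
rewrite /ab_rev /omega /omega_rev; move: p.
apply: abpoly_ind => [w|p q Hp Hq|c p Hp].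
- by rewrite !ab_lin_word -rev_omega_word.
- by rewrite !ab_linD; exact: addr_congr Hp Hq.
- by rewrite !ab_linZ; exact: scaler_congr Hp.
Qed.

Lemma omega_rev_aF p : omega_rev false (ab_a * p) = ab_c * omega_rev false p.
Proof.
by apply: ab_lin_mull => w; rewrite -ab_word_cat ab_lin_word.
Qed.

Lemma omega_rev_bF p : omega_rev false (ab_b * p) = omega_rev true p.
Proof.
rewrite -[RHS]mul1r; apply: ab_lin_mull => w.
by rewrite -ab_word_cat ab_lin_word mul1r.
Qed.

Lemma omega_rev_aT p : omega_rev true (ab_a * p) = ab_d *+ 2 * omega_rev false p.
Proof.
by apply: ab_lin_mull => w; rewrite -ab_word_cat ab_lin_word.
Qed.

Lemma omega_rev_bT p : omega_rev true (ab_b * p) = ab_c * omega_rev true p.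
Proof.
by apply: ab_lin_mull => w; rewrite -ab_word_cat ab_lin_word.
Qed.

Lemma omega_rev1 st : omega_rev st 1 = if st then ab_c else 1.
Proof. by rewrite -[X in omega_rev st X]ab_word_nil /omega_rev ab_lin_word; case: st. Qed.

Lemma Hprime_word_rcons w x : Hprime (ab_word (rcons w x)) = ab_word w.
Proof.
by rewrite /Hprime ab_lin_word; case: w => [|y w] //=; rewrite belast_rcons.
Qed.

Lemma Hprime_letter p x : Hprime (p * ab_word [:: x]) = p.
Proof.
rewrite /Hprime; move: p; apply: abpoly_ind => [w|p q Hp Hq|c p Hp].
- by rewrite -ab_word_cat cats1; exact: Hprime_word_rcons.
- by rewrite mulrDl ab_linD; exact: addr_congr Hp Hq.
- by rewrite -scalerAl ab_linZ; exact: scaler_congr Hp.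
Qed.

Lemma abpoly_torsion2 (p q : abpoly) : p *+ 2 = q *+ 2 -> p = q.
Proof.
move=> /(congr1 (fun r : abpoly => (1 / 2%:R : rat) *: r)).
have half (r : abpoly) : (1 / 2%:R : rat) *: (r *+ 2) = r.
  by rewrite -scaler_nat scalerA mul1r mulVf // scale1r.
by rewrite !half.
Qed.

Local Transparent ab_lin fgmul fgadd fgscale mkmalgU.

(** * The recursion satisfied by omega *)

Section OmegaRecursion.
Variables (R : pzRingType) (a b : R) (alpha beta : {additive R -> R}).
Let e := a - b.
Let c := a + b.
Hypothesis alphaA : forall p, alpha (a * p) = c * alpha p.
Hypothesis alphaB : forall p, alpha (b * p) = beta p.
Hypothesis betaA : forall p, beta (a * p) = (a * b + b * a) *+ 2 * alpha p.
Hypothesis betaB : forall p, beta (b * p) = c * beta p.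
Hypothesis alpha1 : alpha 1 = 1.
Hypothesis beta1 : beta 1 = c.

(** Applying the letter rules twice to [e * (e * p)] makes the [beta] terms cancel and leaves the
    left side here as the coefficient of [alpha p]. *)
Lemma sqr_c_minus_2d : c * c - (a * b + b * a) *+ 2 = e * e.
Proof.
rewrite /c /e mulr2n !(mulrDl, mulrDr, mulNr, mulrN) opprK.
have zmod (x y z w : R) :
    x + z + (y + w) - (y + z + (y + z)) = x - z + (- y + w).
  rewrite opprD addrACA {1}[y + z]addrC addrKA [y + w]addrC addrKA.
  by rewrite [w - z]addrC addrACA.
by rewrite [a * b + b * a]addrC; exact: zmod.
Qed.

Lemma alpha_e p : alpha (e * p) = c * alpha p - beta p.
Proof. by rewrite /e mulrBl raddfB /= alphaA alphaB. Qed.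

Lemma alpha_ee p : alpha (e * (e * p)) = e * e * alpha p.
Proof.
rewrite !alpha_e mulrBr.
have -> : beta (e * p) = (a * b + b * a) *+ 2 * alpha p - c * beta p.
  by rewrite /e mulrBl raddfB /= betaA betaB.
by rewrite opprB subrKA mulrA -mulrBl sqr_c_minus_2d.
Qed.

Lemma alpha_expeD m p : alpha (e ^+ m.*2 * p) = e ^+ m.*2 * alpha p.
Proof.
elim: m p => [|m IH] p; first by rewrite !mul1r.
by rewrite doubleS !exprS -!mulrA alpha_ee IH !mulrA.
Qed.

Lemma alpha_exp k : alpha (e ^+ k) = e ^+ k *+ ~~ odd k.
Proof.
rewrite -[in LHS](odd_double_half k) addnC exprD alpha_expeD.
have [ok|ok] := boolP (odd k).
  have alpha_e1 : alpha e = 0.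
    by rewrite -[X in alpha X]mulr1 alpha_e alpha1 beta1 mulr1 subrr.
  by rewrite expr1 alpha_e1 mulr0.
by rewrite alpha1 mulr1 even_halfK.
Qed.

(** A factor [e] left over in front of [b] contributes [c * beta p - beta (b * p)], which is 0. *)
Lemma alpha_exp_b k p : alpha (e ^+ k * b * p) = e ^+ k * beta p *+ ~~ odd k.
Proof.
rewrite -mulrA -[in LHS](odd_double_half k) addnC exprD -mulrA alpha_expeD.
have [ok|ok] := boolP (odd k).
  by rewrite expr1 alpha_e alphaB betaB subrr mulr0.
by rewrite mul1r alphaB even_halfK.
Qed.

Hypothesis torsion2 : forall x y : R, x *+ 2 = y *+ 2 -> x = y.

(** [X] stands for the flats, [d] for the dimension and [Theta x] for the weighted sum of the chains
    of flats above [x]; [ThetaE] splits such a chain at its lowest flat. *)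
Variables (X : eqType) (fl : seq X) (leX : rel X) (d : X -> nat) (n : nat).
Variable Theta : X -> R.
Hypothesis d_le : forall x, x \in fl -> (d x <= n)%N.
Hypothesis fl_uniq : uniq fl.
Hypothesis leXx : forall x, x \in fl -> leX x x.
Hypothesis d_lt : forall x y, x \in fl -> y \in fl -> leX x y -> x != y ->
  (d x < d y)%N.
Hypothesis ThetaE : forall x, x \in fl -> Theta x = e ^+ (n - d x) +
  \sum_(y <- fl | leX x y && (x != y)) e ^+ (d y - d x).-1 * b * Theta y.

Let A x := alpha (Theta x).
Let B x := beta (Theta x).

Lemma alpha_Theta x : x \in fl -> A x = e ^+ (n - d x) *+ ~~ odd (n - d x) +
  \sum_(y <- fl | leX x y && (x != y))
    e ^+ (d y - d x).-1 * B y *+ ~~ odd (d y - d x).-1.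
Proof.
move=> xfl; rewrite /A ThetaE // raddfD raddf_sum /= alpha_exp; congr (_ + _).
by apply: eq_bigr => y _; rewrite alpha_exp_b.
Qed.

Lemma alpha_e_Theta x : x \in fl ->
  alpha (e * Theta x) = e ^+ (n - d x).+1 *+ odd (n - d x) +
  \sum_(y <- fl | leX x y && (x != y))
    e ^+ (d y - d x) * B y *+ odd (d y - d x).-1.
Proof.
move=> xfl; rewrite ThetaE // mulrDr raddfD -exprS alpha_exp /= negbK.
rewrite mulr_sumr raddf_sum /=; congr (_ + _).
rewrite big_seq_cond [RHS]big_seq_cond; apply: eq_bigr => y /and3P[yfl xy nxy].
have dxy := d_lt xfl yfl xy nxy.
rewrite !mulrA -exprS prednK ?subn_gt0 // alpha_exp_b.
by rewrite -[in LHS](prednK (_ : 0 < d y - d x)%N) ?subn_gt0 //= negbK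
  prednK // subn_gt0.
Qed.

Lemma signed_pow m : (- e) ^+ m.+1 = - (e ^+ m.+1 *+ ~~ odd m) + e ^+ m.+1 *+ odd m.
Proof.
rewrite exprNn -signr_odd /=.
by case: (odd m); rewrite ?expr0 ?expr1 ?mul1r ?mulN1r ?oppr0 ?add0r ?addr0.
Qed.

(** Write 2b = c - e and replace [c * A x] by [alpha (e * Theta x) + B x]. The term [e * A x]
    supplies exponents of one parity with a minus sign and [alpha (e * Theta x)] those of the other
    parity, so that together they form powers of [- e]; [B x] is the term [w = x]. *)
Lemma two_b_alpha x : x \in fl -> b * A x *+ 2 =
  \sum_(w <- fl | leX x w) (- e) ^+ (d w - d x) * B w + (- e) ^+ (n - d x).+1.
Proof.
move=> xfl.
have -> : b * A x *+ 2 = B x - e * A x + alpha (e * Theta x).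
  rewrite alpha_e -/(A x) -/(B x) [RHS]addrC subrKA -mulrBl /c /e opprB.
  by rewrite [a + b]addrC addrACA subrr addr0 mulrDl mulr2n.
rewrite big_mkcond (bigD1_seq x) //= leXx // subnn expr0 mul1r -!addrA; congr (_ + _).
rewrite -big_mkcondr /=.
rewrite alpha_e_Theta // alpha_Theta // mulrDr opprD addrACA addrC mulrnAr.
rewrite -exprS -signed_pow mulr_sumr -sumrN -big_split /=; congr (_ + _).
rewrite big_seq_cond [RHS]big_seq_cond.
apply: eq_big => [w|w /and3P[wfl xw nxw]]; first by rewrite [w == x]eq_sym [(x != w) && _]andbC.
have dxw := d_lt xfl wfl xw nxw.
rewrite mulrnAr mulrA -exprS prednK ?subn_gt0 //.
have -> : (d w - d x = (d w - d x).-1.+1)%N by rewrite prednK ?subn_gt0.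
by rewrite signed_pow mulrDl mulNr !mulrnAl.
Qed.

Lemma two_alpha x : x \in fl -> A x *+ 2 = e ^+ (n - d x) + (- e) ^+ (n - d x) +
  \sum_(w <- fl | leX x w && (x != w))
    (e ^+ (d w - d x).-1 + (- e) ^+ (d w - d x).-1) * B w.
Proof.
have H m : e ^+ m + (- e) ^+ m = e ^+ m *+ ~~ odd m *+ 2.
  rewrite exprNn -signr_odd; case: (odd m); rewrite /= ?mul1r ?mulr2n //.
  by rewrite mulN1r subrr addr0.
move=> xfl; rewrite alpha_Theta // mulrnDl -H -sumrMnl; congr (_ + _).
apply: eq_bigr => w _; rewrite H -!mulrnAl //.
Qed.

(** [C] stands for the cells, [z F] for the flat spanned by [F] and [Phi F] for the weighted sum of
    the chains of cells above [F]. *)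
Variables (C : eqType) (ce : seq C) (leC : rel C) (z : C -> X) (Phi : C -> R).
Hypothesis ce_uniq : uniq ce.
Hypothesis z_fl : forall F, F \in ce -> z F \in fl.
Hypothesis leCC : forall F, F \in ce -> leC F F.
Hypothesis leC_dim : forall F G, F \in ce -> G \in ce -> leC F G -> F != G ->
  (d (z F) < d (z G))%N.
Hypothesis leC_supp : forall F G w, F \in ce -> G \in ce -> w \in fl ->
  leC F G -> leX (z G) w -> leX (z F) w.
Hypothesis star_euler : forall F y, F \in ce -> y \in fl -> leX (z F) y ->
  \sum_(G <- ce | leC F G && leX (z G) y) (- 1) ^+ d (z G) = (- 1) ^+ d y :> R.
Hypothesis PhiE : forall F, F \in ce -> Phi F = e ^+ (n - d (z F)) +
  \sum_(G <- ce | leC F G && (F != G))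
    e ^+ (d (z G) - d (z F)).-1 * b * Phi G.
Variable t : X.
Hypothesis t_fl : t \in fl.
Hypothesis leXt : forall x, x \in fl -> leX x t.
Hypothesis d_t : d t = n.

Lemma sign_sum_above F y : F \in ce -> y \in fl -> leX (z F) y ->
  \sum_(G <- ce | (leC F G && (F != G)) && leX (z G) y)
     (- 1) ^+ (d (z G) - d (z F)).-1 = 1 - (- 1) ^+ (d y - d (z F)) :> R.
Proof.
move=> Fce yfl Fy.
have dFy : (d (z F) <= d y)%N.
  by have [<-//|ne] := eqVneq (z F) y; exact: ltnW (d_lt (z_fl Fce) yfl Fy ne).
have E := star_euler Fce yfl Fy.
rewrite big_mkcond (bigD1_seq F) //= leCC // Fy -big_mkcondr /= in E.
have -> : \sum_(G <- ce | (leC F G && (F != G)) && leX (z G) y)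
     (- 1) ^+ (d (z G) - d (z F)).-1 = - (-1) ^+ d (z F) *
  (\sum_(i <- ce | (i != F) && (leC F i && leX (z i) y)) (-1) ^+ d (z i)) :> R.
  rewrite mulr_sumr [LHS]big_seq_cond [RHS]big_seq_cond.
  apply: eq_big => [G|G /andP[Gce /andP[/andP[FG nFG] Gy]]].
    by rewrite [G == F]eq_sym; case: (leC F G); case: (F == G); rewrite /= ?andbF.
  have dFG := leC_dim Fce Gce FG nFG.
  rewrite mulNr -exprD -[RHS]mulN1r -exprS -signr_odd -[RHS]signr_odd; congr (_ ^+ _).
  by congr nat_of_bool; lia.
have -> : \sum_(i <- ce | (i != F) && (leC F i && leX (z i) y)) (-1) ^+ d (z i)
   = (-1) ^+ d y - (-1) ^+ d (z F) :> R by rewrite -E addrAC subrr add0r.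
rewrite mulrBr !mulNr opprK -!exprD addrC; congr (_ - _).
  by rewrite addnn -signr_odd odd_double.
rewrite -[LHS]signr_odd -[RHS]signr_odd; congr (_ ^+ _).
by congr nat_of_bool; lia.
Qed.

Lemma sign_pow (m : nat) : (-1) ^+ m * (- e) ^+ m = e ^+ m.
Proof. by rewrite -exprMn_comm ?mulrNN ?mul1r //; exact: commrN1 || apply/commr_sym/commrN1. Qed.

Lemma leX_dim x y : x \in fl -> y \in fl -> leX x y -> (d x <= d y)%N.
Proof.
by move=> xfl yfl xy; have [<-//|ne] := eqVneq x y; exact: ltnW (d_lt xfl yfl xy ne).
Qed.

(** After [two_b_alpha] the sums over cells and flats are exchanged. The coefficient of each [B w]
    is then an alternating sum over the cells between [F] and [w], evaluated by [sign_sum_above]. *)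
Lemma two_sum_above F : F \in ce ->
  \sum_(G <- ce | leC F G && (F != G))
     e ^+ (d (z G) - d (z F)).-1 * b * A (z G) *+ 2 =
  (- e) ^+ (n - d (z F)) - e ^+ (n - d (z F)) +
  \sum_(w <- fl | leX (z F) w && (z F != w))
    (e ^+ (d w - d (z F)).-1 + (- e) ^+ (d w - d (z F)).-1) * B w.
Proof.
move=> Fce; have zF := z_fl Fce.
pose j G := (d (z G) - d (z F)).-1.
transitivity (\sum_(G <- ce | leC F G && (F != G))
   ((-1) ^+ j G * (- e) ^+ (n - d (z F)) + \sum_(w <- fl | leX (z G) w)
     (-1) ^+ j G * ((- e) ^+ (d w - d (z F)).-1 * B w))).
  rewrite big_seq_cond [RHS]big_seq_cond.
  apply: eq_bigr => G /and3P[Gce FG nFG].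
  have zG := z_fl Gce; have dFG := leC_dim Fce Gce FG nFG.
  rewrite -mulrA -mulrnAr two_b_alpha // -sign_pow mulrDr addrC.
  rewrite mulr_sumr -mulrA -exprD; congr (_ * _ ^+ _ + _).
    by have := d_le zG; lia.
  rewrite big_seq_cond [RHS]big_seq_cond; apply: eq_bigr => w /andP[wfl Gw].
  rewrite -!mulrA; congr (_ * _); rewrite mulrA -exprD; congr (_ ^+ _ * _).
  by have := leX_dim zG wfl Gw; rewrite /j; lia.
rewrite big_split /= -mulr_suml.
have -> : \sum_(G <- ce | leC F G && (F != G)) (-1) ^+ j G =
    1 - (-1) ^+ (n - d (z F)) :> R.
  rewrite -d_t -sign_sum_above ?leXt // [LHS]big_seq_cond [RHS]big_seq_cond.
  apply: eq_bigl => G; rewrite -!andbA; case: (boolP (G \in ce)) => //= Gce.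
  by rewrite leXt ?z_fl // andbT.
rewrite mulrBl mul1r sign_pow; congr (_ + _).
rewrite (exchange_big_dep predT) //= [RHS]big_mkcond /= big_seq [RHS]big_seq.
apply: eq_bigr => w wfl; rewrite -mulr_suml.
have [Fw|nFw] /= := boolP (leX (z F) w); last first.
  rewrite big_seq_cond big_pred0 ?mul0r // => G.
  apply/negP => /andP[Gce /andP[/andP[FG _] Gw]].
  by move/negP: nFw; apply; exact: leC_supp FG Gw.
(* For [w = z F] the coefficient is 1 - 1, so only strictly larger flats remain. *)
rewrite sign_sum_above //; have [<-|ne] /= := eqVneq (z F) w.
  by rewrite subnn subrr mul0r.
have dFw := d_lt zF wfl Fw ne.
have -> : (d w - d (z F) = (d w - d (z F)).-1.+1)%N by rewrite prednK ?subn_gt0.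
by rewrite exprS mulN1r opprK mulrA mulrDl mul1r sign_pow addrC.
Qed.

(** Descending induction on the dimension, with both sides doubled because [two_b_alpha] only
    evaluates 2b. The leading terms match since 2e^k + ((-e)^k - e^k) = e^k + (-e)^k. *)
Lemma Phi_alpha F : F \in ce -> Phi F = A (z F).
Proof.
move: {2}(n - d (z F)).+1 (leqnn (n - d (z F)).+1) => k.
elim: k F => // k IH F lek Fce; apply: torsion2.
rewrite PhiE // mulrnDl two_alpha ?z_fl // -sumrMnl.
have -> : \sum_(G <- ce | leC F G && (F != G))
     e ^+ (d (z G) - d (z F)).-1 * b * Phi G *+ 2 = \sum_(G <- ce | leC F G && (F != G))
     e ^+ (d (z G) - d (z F)).-1 * b * A (z G) *+ 2.
  rewrite big_seq_cond [RHS]big_seq_cond.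
  apply: eq_bigr => G /and3P[Gce FG nFG]; rewrite IH //.
  have := leC_dim Fce Gce FG nFG; have := d_le (z_fl Gce); lia.
by rewrite two_sum_above // mulr2n addrA [_ - _]addrC -[X in X + _]addrA addNKr.
Qed.

Hypothesis global_euler : forall x, x \in fl ->
  \sum_(G <- ce | leX (z G) x) (- 1) ^+ d (z G) = (d x == 0%N)%:R :> R.
Hypothesis n_gt0 : (0 < n)%N.

(** The exchange of sums of [two_sum_above], now over all cells. The global relation kills the
    coefficient of every flat of positive dimension, and also the free term, because the torus
    itself is such a flat. *)
Lemma two_sum_cells :
  (\sum_(F <- ce) e ^+ d (z F) * b * Phi F) *+ 2 =
  \sum_(w <- fl | d w == 0%N) beta (Theta w).
Proof.
rewrite -sumrMnl.
transitivity (\sum_(G <- ce) ((-1) ^+ d (z G) * (- e) ^+ n.+1 +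
   \sum_(w <- fl | leX (z G) w) (-1) ^+ d (z G) * ((- e) ^+ d w * B w))).
  rewrite big_seq [RHS]big_seq; apply: eq_bigr => G Gce; have zG := z_fl Gce.
  rewrite Phi_alpha // -mulrA -mulrnAr two_b_alpha // -sign_pow mulrDr addrC.
  rewrite mulr_sumr -mulrA -exprD; congr (_ * _ ^+ _ + _).
    by have := d_le zG; lia.
  rewrite big_seq_cond [RHS]big_seq_cond; apply: eq_bigr => w /andP[wfl Gw].
  rewrite -!mulrA; congr (_ * _); rewrite mulrA -exprD; congr (_ ^+ _ * _).
  by rewrite subnKC // leX_dim.
rewrite big_split /= -mulr_suml.
have -> : \sum_(G <- ce) (-1) ^+ d (z G) = 0 :> R.
  transitivity (\sum_(G <- ce | leX (z G) t) (- 1) ^+ d (z G) : R); last first.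
    by rewrite global_euler // d_t eqn0Ngt n_gt0.
  rewrite [LHS]big_seq_cond [RHS]big_seq_cond; apply: eq_bigl => G.
  by case: (boolP (G \in ce)) => //= Gce; rewrite leXt // z_fl.
rewrite mul0r add0r (exchange_big_dep predT) //= [RHS]big_mkcond /=.
rewrite big_seq [RHS]big_seq; apply: eq_bigr => w wfl.
rewrite -mulr_suml global_euler //.
by case: eqP => [->|_]; rewrite ?mul1r ?mul0r.
Qed.

End OmegaRecursion.

(** * The ab-index as a sum over chains *)

Section FlagProducts.
Variables (R : pzRingType) (a b : R).

Lemma prod_eq0 (I : eqType) (r : seq I) (F : I -> R) i :
  i \in r -> F i = 0 -> \prod_(j <- r) F j = 0.
Proof.
elim: r => // j r IH; rewrite inE big_cons => /predU1P[<- ->|ir Fi].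
  by rewrite mul0r.
by rewrite IH // mulr0.
Qed.

Lemma prod_sign (I : Type) (r : seq I) (k : I -> bool) (F : I -> R) :
  \prod_(j <- r) ((-1) ^+ k j * F j) =
  (-1) ^+ (\sum_(j <- r) k j)%N * \prod_(j <- r) F j.
Proof.
elim: r => [|j r IH]; first by rewrite !big_nil mulr1.
rewrite !big_cons IH exprD -!mulrA; congr (_ * _).
by rewrite !mulrA; congr (_ * _); rewrite (commr_sign (F j)).
Qed.

(** Expand the product on the right: each factor outside [T] offers the choices [- b] and [a], while
    on [T] the second choice is 0, which removes the sets that do not contain [T]. *)
Lemma sum_superset_sign N (T : {set 'I_N}) :
  \sum_(S : {set 'I_N} | T \subset S)
     (-1) ^+ #|S :\: T| * \prod_(i < N) (if i \in S then b else a) =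
  \prod_(i < N) (if i \in T then b else a - b).
Proof.
pose F (i : 'I_N) := if i \in T then b else - b.
pose G (i : 'I_N) := if i \in T then 0 else a.
have -> : \prod_(i < N) (if i \in T then b else a - b) = \prod_(i < N) (F i + G i).
  by apply: eq_bigr => i _; rewrite /F /G; case: ifP => _; rewrite ?addr0 // addrC.
rewrite bigA_distr [RHS](bigID (fun S : {set 'I_N} => T \subset S)) /=.
rewrite [X in _ = _ + X]big1 ?addr0; last first.
  move=> S /fintype.subsetPn[i iT iS]; apply: (@prod_eq0 _ _ _ i).
    by rewrite mem_index_enum.
  by rewrite (negbTE iS) /G iT.
apply: eq_bigr => S TS.
rewrite [RHS](_ : _ = \prod_(i < N)
   ((-1) ^+ (i \in S :\: T) * (if i \in S then b else a))).
  rewrite prod_sign; congr ((-1) ^+ _ * _).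
  by rewrite -sum1_card big_mkcond; apply: eq_bigr => i _; case: (_ \in _).
apply: eq_bigr => i _; rewrite inE /F /G.
case: (boolP (i \in S)) => iS; rewrite ?andbT ?andbF; last first.
  by rewrite mul1r ifN //; apply: contra iS => /(fintype.subsetP TS).
by case: (i \in T); rewrite ?mul1r ?mulN1r.
Qed.

Lemma sum_set_mask (V : nmodType) N (g : seq bool -> V) :
  \sum_(S : {set 'I_N}) g [seq i \in S | i <- enum 'I_N] =
  \sum_(m : N.-tuple bool) g m.
Proof.
pose h (m : N.-tuple bool) : {set 'I_N} := [set i | tnth m i]%SET.
have hK m : [seq i \in h m | i <- enum 'I_N] = m.
  rewrite -[RHS]map_tnth_enum; apply: eq_map => i.
  by rewrite inE.
rewrite (reindex h) /=; first by apply: eq_bigr => m _; rewrite hK.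
exists (fun S : {set 'I_N} => [tuple (i \in S) | i < N]) => [m _|S _].
  by apply: eq_from_tnth => i; rewrite tnth_mktuple inE.
by apply/finset.setP => i; rewrite finset.inE tnth_mktuple.
Qed.

Lemma sum_tuple_cons (V : nmodType) N (g : seq bool -> V) :
  \sum_(m : N.+1.-tuple bool) g m =
  \sum_(m : N.-tuple bool) g (false :: m) + \sum_(m : N.-tuple bool) g (true :: m).
Proof.
rewrite (reindex (fun p : bool * N.-tuple bool => [tuple of p.1 :: p.2])) /=.
  rewrite -(pair_big predT predT (fun x (m : N.-tuple bool) => g (x :: m))) /=.
  by rewrite big_bool addrC.
exists (fun m : N.+1.-tuple bool => (thead m, behead_tuple m)) => [[x m] _|m _].
  by congr pair; apply/val_inj.
by case/tupleP: m => x m; apply/val_inj.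
Qed.

End FlagProducts.

Lemma eq_sum_seq (V : nmodType) (I : eqType) (r : seq I) (P Q : pred I)
    (F G : I -> V) : {in r, P =1 Q} -> (forall i, i \in r -> Q i -> F i = G i) ->
  \sum_(i <- r | P i) F i = \sum_(i <- r | Q i) G i.
Proof.
move=> PQ FG; rewrite big_seq_cond [RHS]big_seq_cond.
apply: eq_big => [i|i /andP[ir Pi]]; last by apply: FG; rewrite -?PQ.
by case: (boolP (i \in r)) => //= /PQ.
Qed.

Section ChainSums.
Variables (R : pzRingType) (a b : R).
Variables (U : eqType) (els : seq U) (rk : U -> nat) (lt : rel U).
Let e := a - b.

Fixpoint chains (ks : seq nat) (x : U) : seq (seq U) :=
  if ks is k :: ks' then
    [seq y :: c | y <- [seq y <- els | (rk y == k) && lt x y], c <- chains ks' y]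
  else [:: [::]].

Lemma mem_chains ks x c : (c \in chains ks x) =
  [&& all (mem els) c, path lt x c & [seq rk y | y <- c] == ks].
Proof.
elim: ks x c => [|k ks IH] x [|y c] //=; rewrite ?andbF //.
  by apply/allpairsPdep => -[? [? []]].
apply/allpairsPdep/idP => [[y' [c' []]]|].
  rewrite mem_filter IH => /andP[/andP[/eqP <- xy] ye] /and3P[ce pc /eqP <-] [-> ->].
  by rewrite ye ce xy pc eqxx.
rewrite eqseq_cons => /and3P[/andP[ye ce] /andP[xy pc] /andP[yk /eqP rc]].
by exists y, c; rewrite mem_filter yk xy ye IH ce pc rc eqxx.
Qed.

Lemma chains_uniq ks x : uniq els -> uniq (chains ks x).
Proof.
move=> uels; elim: ks x => //= k ks IH x.
apply: allpairs_uniq_dep; rewrite ?filter_uniq //.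
by move=> [y c] [y' c'] _ _ /= [<- <-].
Qed.

Lemma size_chains_cons k ks x : size (chains (k :: ks) x) =
  (\sum_(y <- els | (rk y == k) && lt x y) size (chains ks y))%N.
Proof.
rewrite /= size_allpairs_dep sumnE big_map big_filter //.
Qed.

(* The sum of the weights of the chains above x: each rank of ks contributes
   the letter b if the chain has an element of that rank and a - b otherwise. *)
Fixpoint chain_sum (ks : seq nat) (x : U) : R :=
  if ks is k :: ks' then
    e * chain_sum ks' x + \sum_(y <- els | (rk y == k) && lt x y) b * chain_sum ks' y
  else 1.

Lemma chain_sumE ks x :
  \sum_(m : (size ks).-tuple bool)
     (\prod_(l <- m) (if l then b else e)) *+ size (chains (mask m ks) x) =
  chain_sum ks x.
Proof.
elim: ks x => [|k ks IH] x.
  rewrite (big_pred1 [tuple]) => [|m]; first by rewrite big_nil.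
  by apply/esym/eqP; rewrite [m]tuple0.
rewrite (@sum_tuple_cons _ _ (fun m => (\prod_(l <- m) (if l then b else e)) *+
  size (chains (mask m (k :: ks)) x))) /=; congr (_ + _).
  by rewrite -IH mulr_sumr; apply: eq_bigr => m _; rewrite big_cons mulrnAr.
under eq_bigr => m _ do rewrite -/(chains (k :: mask m ks) x) size_chains_cons big_cons -sumrMnr.
rewrite exchange_big /=; apply: eq_bigr => y _.
by rewrite -IH mulr_sumr; apply: eq_bigr => m _; rewrite mulrnAr.
Qed.

(** Splits off the lowest element [y] of the chain: the ranks below it contribute [e] each, and the
    ranks above it form a chain sum starting at [y]. *)
Lemma chain_sum_iota k m x :
  chain_sum (iota k m) x = e ^+ m +
  \sum_(y <- els | lt x y && (k <= rk y < k + m)%N)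
    e ^+ (rk y - k) * b * chain_sum (iota (rk y).+1 (k + m - (rk y).+1)) y.
Proof.
elim: m k => [|m IH] k /=.
  by rewrite big_pred0 ?addr0 // => y; rewrite addn0 ltnNge andbN andbF.
rewrite IH mulrDr -exprS -addrA; congr (_ + _).
rewrite mulr_sumr [RHS](bigID (fun y => rk y == k)) /= addrC; congr (_ + _).
  apply: eq_big => [y|y /andP[/eqP -> _]].
    by case: eqP => [->|]; rewrite ?andbF // leqnn addnS ltnS leq_addr !andbT.
  by rewrite subnn mul1r; congr (_ * chain_sum (iota _ _) _); lia.
apply: eq_big => [y|y /and3P[_ ky ym]]; first by case: (lt x y) => //=; lia.
rewrite !mulrA -exprS; congr (_ ^+ _ * _ * chain_sum (iota _ _) _); lia.
Qed.

Lemma chain_sum_above n x : (rk x <= n)%N ->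
  (forall y, y \in els -> lt x y -> (rk x < rk y <= n)%N) ->
  chain_sum (iota (rk x).+1 (n - rk x)) x = e ^+ (n - rk x) +
  \sum_(y <- els | lt x y) e ^+ (rk y - rk x).-1 * b *
    chain_sum (iota (rk y).+1 (n - rk y)) y.
Proof.
move=> xn lt_rk; rewrite chain_sum_iota; congr (_ + _).
rewrite big_seq_cond [RHS]big_seq_cond.
apply: eq_big => [y|y /and3P[ye xy dyn]].
  case: (boolP (y \in els)) => //= ye; case: (boolP (lt x y)) => //= xy.
  by have := lt_rk y ye xy; lia.
by congr (_ ^+ _ * _ * chain_sum (iota _ _) _); lia.
Qed.

(** The last rank is occupied by [t] alone, and every chain of smaller ranks extends to [t], so the
    last letter is always (a - b) + b = a. *)
Lemma chain_sum_rcons (t : U) N ks x : (0 < N)%N ->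
  (forall y, y \in els -> rk y = N -> y = t) -> t \in els -> uniq els -> rk t = N ->
  (forall y, y \in els -> (rk y < N)%N -> lt y t) -> all (fun k => (k < N)%N) ks ->
  lt x t -> chain_sum (rcons ks N) x = chain_sum ks x * a.
Proof.
move=> N0 top te uels rkt ltt; elim: ks x => [|k ks IH] x /=.
  move=> _ xt; rewrite mulr1 mul1r.
  rewrite big_mkcond (bigD1_seq t) //= rkt eqxx xt big_seq_cond big1 ?addr0.
    by rewrite mulr1 /e subrK.
  move=> y /andP[ye /eqP nyt]; case: ifP => // /andP[/eqP ry _].
  by case: nyt; exact: top.
case/andP=> kN aks xt; rewrite IH // [RHS]mulrDl mulr_suml mulrA; congr (_ + _).
rewrite big_seq_cond [RHS]big_seq_cond; apply: eq_bigr => y /and3P[ye /eqP rk_y _].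
by rewrite IH ?mulrA // ltt // rk_y.
Qed.

End ChainSums.

(** Exchanging the Moebius sum that defines the h-numbers with the sum over [S] lets each f-number
    meet the expansion of [sum_superset_sign]. *)
Lemma flag_transform (R : lalgType rat) (a b : R) N (f : {set 'I_N} -> nat) :
  \sum_(S : {set 'I_N})
    ((\sum_(T : {set 'I_N} | T \subset S) (-1) ^+ #|S :\: T| * (f T)%:Z)%:~R : rat)
      *: \prod_(i < N) (if i \in S then b else a) =
  \sum_(S : {set 'I_N}) (\prod_(i < N) (if i \in S then b else a - b)) *+ f S.
Proof.
have term (S T : {set 'I_N}) (u : R) :
    (((-1) ^+ #|S :\: T| * (f T)%:Z)%:~R : rat) *: u =
    ((-1) ^+ #|S :\: T| * u) *+ f T.
  rewrite intrM -pmulrn mulrC -scalerA scaler_nat; congr (_ *+ _).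
  rewrite rmorphXn rmorphN1 -[in LHS]signr_odd -[in RHS]signr_odd.
  by case: (odd _); rewrite ?scaleN1r ?mulN1r ?scale1r ?mul1r.
under eq_bigr => S _ do
  [rewrite rmorph_sum scaler_suml; under eq_bigr => T _ do rewrite term].
rewrite (exchange_big_dep predT) //=; apply: eq_bigr => T _.
by rewrite sumrMnl sum_superset_sign.
Qed.

Lemma ab_index_masks (P : ranked_poset) (F : seq bool -> nat) :
  (forall S, flag_f S = F [seq i \in S | i <- enum 'I_(rp_N P)]) ->
  ab_index P = \sum_(m : (rp_N P).-tuple bool)
    (\prod_(l <- m) (if l then ab_b else ab_a - ab_b)) *+ F m.
Proof.
move=> fF; rewrite /ab_index flag_transform.
rewrite -(sum_set_mask _ (fun m => (\prod_(l <- m) (if l then ab_b else ab_a - ab_b)) *+ F m)).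
apply: eq_bigr => S _; rewrite fF big_map /=.
by rewrite [index_enum _]unlock -enumT.
Qed.

Lemma flag_f_size (P : ranked_poset) S (s : seq (seq {classic rp_type P})) :
  uniq s -> (forall c, flag_chains S c <-> c \in s) -> flag_f S = size s.
Proof.
move=> us cs; rewrite /flag_f.
have -> : flag_chains S = [set` [fset c in s]%fset]%classic.
  by apply/seteqP; split => c /=; rewrite inE => /cs.
by rewrite set_fsetK card_fseq undup_id.
Qed.

Lemma rank_mask N (S : {set 'I_N}) :
  [seq (val i).+1 | i <- enum S] =
  mask [seq i \in S | i <- enum 'I_N] (iota 1 N).
Proof.
rewrite -[1%N]/(1 + 0)%N iotaDl -val_enum_ord -map_comp -map_mask.
by rewrite -filter_mask [in RHS]enumT.
Qed.

(** * Chains of cells in the face poset *)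

Section Faces.
Variables (R : realType) (n : nat) (A : set (set (torus R n))).
Variable ce : seq {classic set (torus R n)}.
Hypothesis ce_uniq : uniq ce.
Hypothesis ceP : forall e, e \in ce <-> toric_cells A e.

Definition face_dim (x : {classic toric_face R n}) : nat :=
  if x is CellFace e then toric_dim e else 0.

Definition face_lt : rel {classic toric_face R n} :=
  fun x y => `[< @rp_lt (face_poset A) x y >].

Definition cell_faces : seq {classic toric_face R n} :=
  [seq (CellFace e : {classic toric_face R n}) | e <- ce].

Lemma cell_faces_uniq : uniq cell_faces.
Proof. by rewrite map_inj_uniq // => x y []. Qed.

(** The prescribed ranks lie strictly between 0 and n + 2, which forces the members of a flag to be
    cells. A cell of dimension k has rank k + 1, hence the list of dimensions [iota 0 n.+1]. *)
Lemma face_flags (S : {set 'I_(rp_N (face_poset A))}) :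
  flag_f S = size (chains cell_faces face_dim face_lt
    (mask [seq i \in S | i <- enum 'I_(rp_N (face_poset A))] (iota 0 n.+1))
    (EmptyFace R n)).
Proof.
apply: flag_f_size; first by rewrite chains_uniq // cell_faces_uniq.
move=> c; rewrite mem_chains /flag_chains /= rank_mask.
set m := [seq i \in S | i <- enum 'I_(rp_N (face_poset A))].
rewrite -[iota 1 _]/(iota (1 + 0) n.+1) iotaDl -map_mask.
have lt_top (e : set (torus R n)) : face_lt (CellFace e) (TorusFace R n).
  by apply/asboolP; split.
split=> [[elc pc rc]|/and3P[allc pc /eqP rc]].
  have rk x : x \in c -> (0 < rp_rank (r := face_poset A) x < n.+2)%N.
    move=> xc; have : rp_rank (r := face_poset A) x \in
       [seq rp_rank (r := face_poset A) x | x <- c] by exact: map_f.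
    rewrite rc => /mapP[k /mem_mask]; rewrite mem_iota /= => kn ->.
    by rewrite add1n /=; lia.
  have cells x : x \in c -> exists2 e, x = CellFace e & e \in ce.
    move=> xc; have := elc x xc; have := rk x xc.
    case: x xc => [|e|] xc //=; last by rewrite ltnn.
    by move=> _ /ceP; exists e.
  apply/and3P; split.
  - by apply/allP => x /cells[e -> ece]; apply/mapP; exists e.
  - by move: pc; rewrite rcons_path => /andP[].
  - apply/eqP/(inj_map succn_inj); rewrite -map_comp.
    by apply: etrans rc; apply/eq_in_map => x /cells[e -> _].
have cells x : x \in c -> exists2 e, x = CellFace e & e \in ce.
  by move=> xc; move/allP: allc => /(_ x xc) /mapP[e ece ->]; exists e.
split.
- by move=> x /cells[e -> /ceP].
- rewrite rcons_path pc /=; case: c cells {allc pc rc} => [|x c] cells /=.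
    by apply/asboolP; split.
  by have [|e -> _] := cells (last x c); rewrite ?mem_last //; exact: lt_top.
- transitivity [seq (face_dim x).+1 | x <- c].
    by apply/(@eq_in_map {classic toric_face R n}) => x /cells[e -> _].
  by rewrite (map_comp succn face_dim) rc.
Qed.

Lemma ab_index_face_poset : ab_index (face_poset A) =
  chain_sum ab_a ab_b cell_faces face_dim face_lt (iota 0 n.+1) (EmptyFace R n).
Proof.
rewrite (ab_index_masks (F := fun m => size (chains cell_faces face_dim face_lt
    (mask m (iota 0 n.+1)) (EmptyFace R n)))); last exact: face_flags.
have := chain_sumE ab_a ab_b cell_faces face_dim face_lt (iota 0 n.+1) (EmptyFace R n).
by rewrite size_iota.
Qed.

End Faces.

Lemma ab_rev_prod (f : bool -> abpoly) m : (forall l, ab_rev (f l) = f l) ->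
  ab_rev (\prod_(l <- m) f l) = \prod_(l <- rev m) f l.
Proof.
move=> fr; elim: m => [|l m IH]; first by rewrite !big_nil -ab_word_nil ab_rev_word.
by rewrite big_cons ab_revM IH rev_cons -cats1 big_cat big_seq1 fr.
Qed.

Lemma ab_rev_sum (I : Type) (r : seq I) (P : pred I) (F : I -> abpoly) :
  ab_rev (\sum_(i <- r | P i) F i) = \sum_(i <- r | P i) ab_rev (F i).
Proof. exact: linear_sum. Qed.

Lemma ab_revMn p k : ab_rev (p *+ k) = ab_rev p *+ k.
Proof. exact: linearMn. Qed.

(** * Chains of flats in the intersection poset *)

Section Flats.
Variables (R : realType) (n : nat) (A : set (set (torus R n))).
Variable fl : seq {classic set (torus R n)}.
Hypothesis fl_uniq : uniq fl.
Hypothesis flP : forall x, x \in fl <-> toric_flats A x.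
Hypothesis dimT : toric_dim (@setT (torus R n)) = n.
Local Open Scope classical_set_scope.

Definition flat_lt : rel {classic set (torus R n)} :=
  fun x y => `[< x `<=` y /\ x <> y >].

Lemma flat_neq0 x : toric_flats A x -> x <> set0.
Proof.
move=> [S _ [p Sp <-]] e0.
by have := connected_component_refl Sp; rewrite e0.
Qed.

(** Reverse inclusion and the rank n - dim both turn the poset upside down: a flag read backwards is
    a chain for inclusion starting at [set0], and its mask is reversed with it. *)
Lemma flat_flags (S : {set 'I_(rp_N (intersection_poset A))}) :
  flag_f S = size (chains fl (@toric_dim R n) flat_lt
    (mask (rev [seq i \in S | i <- enum 'I_(rp_N (intersection_poset A))]) (iota 0 n))
    set0).
Proof.
rewrite -(size_map rev); apply: flag_f_size.
  by rewrite (map_inj_uniq (can_inj revK)) chains_uniq.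
have rkN : rp_N (intersection_poset A) = n.
  by rewrite /rp_N /=; case: asboolP => // /(_ erefl).
move=> c; rewrite /flag_chains rank_mask.
set m := [seq i \in S | i <- enum 'I_(rp_N (intersection_poset A))].
have szm : size m = n by rewrite size_map size_enum_ord.
have rev_dims : mask (rev m) (iota 0 n) =
    rev [seq (n - k)%N | k <- mask m (iota 1 n)].
  rewrite map_mask rev_mask; last by rewrite szm size_map size_iota.
  congr mask.
  apply: (@eq_from_nth _ 0%N); first by rewrite size_rev size_map !size_iota.
  move=> i; rewrite size_iota => ilt.
  rewrite nth_iota // nth_rev ?size_map ?size_iota //.
  by rewrite (nth_map 0%N) ?size_iota ?nth_iota; lia.
rewrite rkN.
have pathE (s : seq {classic set (torus R n)}) :
   path (fun x y => `[< @rp_lt (intersection_poset A) x y >]) setT (rcons s set0) =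
   path flat_lt set0 (rcons (rev s) setT).
  rewrite -rev_path last_rcons belast_rcons rev_cons; apply: eq_path => x y.
  by apply/asboolP/asboolP => -[le ne]; split => //; exact: nesym.
split=> [[elc pc rc]|/mapP[c' + ->]].
  have rk x : x \in c -> (0 < rp_rank (r := intersection_poset A) x < n.+1)%N.
    move=> xc; have : rp_rank (r := intersection_poset A) x \in
       [seq rp_rank (r := intersection_poset A) x | x <- c] by exact: map_f.
    by rewrite rc => /mem_mask; rewrite mem_iota; lia.
  have flats x : x \in c -> x \in fl /\
      rp_rank (r := intersection_poset A) x = (n - toric_dim x)%N.
    move=> xc; have := elc x xc; have := rk x xc => /=.
    case: asboolP => [->|x0]; first by rewrite ltnn andbF.
    by move=> _ [/flP|].
  apply/mapP; exists (rev c); last by rewrite revK.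
  rewrite mem_chains rev_dims -rc; apply/and3P; split.
  - by apply/allP => x; rewrite mem_rev => /flats[].
  - by move: pc; rewrite (pathE c) rcons_path => /andP[].
  - rewrite map_rev -map_comp; apply/eqP; congr rev; apply/eq_in_map => x xc /=.
    have [_ e] := flats x xc; have := rk x xc.
    by rewrite e; move: e => /= ->; lia.
rewrite mem_chains rev_dims => /and3P[allc pc /eqP rc].
have flats x : x \in c' -> toric_flats A x /\ (toric_dim x < n)%N.
  move=> xc; split; first by apply/flP; move/allP: allc; exact.
  have : toric_dim x \in [seq toric_dim x | x <- c'] by exact: map_f.
  rewrite rc mem_rev => /mapP[k /mem_mask]; rewrite mem_iota => kn ->.
  by rewrite ltn_subrL; lia.
split.
- by move=> x; rewrite mem_rev => /flats[xf _]; left.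
- rewrite [rp_bot _]/= [rp_top _]/= (pathE (rev c')) revK rcons_path pc /=.
  case: c' flats {allc pc rc} => [_|x c' flats] /=.
    apply/asboolP; split => //; move/seteqP => [_ /(_ (torus_pi 0))]; exact.
  have [_ dl] := flats _ (mem_last x c').
  by apply/asboolP; split => // e; rewrite e dimT ltnn in dl.
- rewrite map_rev; apply: (can_inj revK); rewrite revK.
  have : [seq (n - toric_dim x)%N | x <- c'] = rev (mask m (iota 1 n)).
    have -> : [seq (n - toric_dim x)%N | x <- c'] =
       [seq (n - k)%N | k <- [seq toric_dim x | x <- c']] by rewrite -map_comp.
    rewrite rc map_rev -map_comp; congr rev.
    rewrite -[RHS]map_id; apply/eq_in_map => k /mem_mask.
    by rewrite mem_iota /= => kn; lia.
  move=> <-; apply/eq_in_map => x xc /=; have [xf _] := flats x xc.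
  by case: asboolP => // /(flat_neq0 xf).
Qed.

(** Reversing the words undoes the reversal of the masks, as the letters b and a - b are fixed by
    [ab_rev]. *)
Lemma rev_ab_index_intersection_poset : ab_rev (ab_index (intersection_poset A)) =
  chain_sum ab_a ab_b fl (@toric_dim R n) flat_lt (iota 0 n) set0.
Proof.
have rkN : rp_N (intersection_poset A) = n.
  by rewrite /rp_N /=; case: asboolP => // /(_ erefl).
rewrite (@ab_index_masks _ (fun m => size (chains fl (@toric_dim R n) flat_lt
  (mask (rev m) (iota 0 n)) set0)) flat_flags) rkN ab_rev_sum.
rewrite -chain_sumE size_iota.
have revtK : involutive (fun m : n.-tuple bool => [tuple of rev m]).
  by move=> m; apply/val_inj; rewrite /= revK.
rewrite [RHS](reindex_inj (inv_inj revtK)).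
apply: eq_bigr => m _; rewrite ab_revMn ab_rev_prod //.
case; first exact: rev_ab_b.
rewrite /ab_rev linearB /=; apply: addr_congr; first exact: rev_ab_a.
by rewrite -[RHS](congr1 -%R rev_ab_b).
Qed.

End Flats.

(** * Deletion of a letter and assembly of the formula *)

Lemma half_double (p : abpoly) : (1 / 2%:R : rat) *: (p *+ 2) = p.
Proof. by rewrite -scaler_nat scalerA mul1r mulVf // scale1r. Qed.

Lemma HprimeD p q : Hprime (p + q) = Hprime p + Hprime q.
Proof. exact: linearD. Qed.

Lemma HprimeB p q : Hprime (p - q) = Hprime p - Hprime q.
Proof. exact: linearB. Qed.

Lemma Hprime_sum (I : Type) (r : seq I) (P : pred I) (F : I -> abpoly) :
  Hprime (\sum_(i <- r | P i) F i) = \sum_(i <- r | P i) Hprime (F i).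
Proof. exact: linear_sum. Qed.

Lemma rev_ab_aBb : ab_rev (ab_a - ab_b) = ab_a - ab_b.
Proof.
rewrite /ab_rev linearB; apply: addr_congr; first exact: rev_ab_a.
exact: (congr1 -%R rev_ab_b).
Qed.

Lemma Hprime_aBb p : Hprime (p * (ab_a - ab_b)) = 0.
Proof.
rewrite mulrBr HprimeB; apply: etrans (subrr p).
exact: addr_congr (Hprime_letter p false) (congr1 -%R (Hprime_letter p true)).
Qed.

(** After reversal the lowest rank is the last letter. Deleting it from a - b gives 1 - 1 = 0 and
    from b gives 1, so only the chains with an element of rank [k] remain. *)
Lemma Hprime_chain_sum (U : eqType) (els : seq U) rk lt k ks x :
  ab_rev (Hprime (ab_rev (chain_sum ab_a ab_b els rk lt (k :: ks) x))) =
  \sum_(y <- els | (rk y == k) && lt x y) chain_sum ab_a ab_b els rk lt ks y.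
Proof.
have -> : Hprime (ab_rev (chain_sum ab_a ab_b els rk lt (k :: ks) x)) =
    \sum_(y <- els | (rk y == k) && lt x y)
      ab_rev (chain_sum ab_a ab_b els rk lt ks y).
  rewrite [chain_sum _ _ _ _ _ (k :: ks) x]/= ab_revD ab_revM rev_ab_aBb.
  rewrite HprimeD Hprime_aBb add0r ab_rev_sum Hprime_sum.
  by apply: eq_bigr => y _; rewrite ab_revM rev_ab_b Hprime_letter.
by rewrite ab_rev_sum; apply: eq_bigr => y _; rewrite ab_revK.
Qed.

Lemma dim_le (R : realType) n (F : set (torus R n)) : (toric_dim F <= n)%N.
Proof. by apply/bigmax_leqP => i _; rewrite -ltnS. Qed.

Section Assembly.
Variables (R : realType) (n : nat) (A : set (set (torus R n))).
Hypothesis n_gt0 : (0 < n)%N.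
Variables (ce fl : seq {classic set (torus R n)}).
Variable z : {classic set (torus R n)} -> {classic set (torus R n)}.
Local Open Scope classical_set_scope.
Hypothesis ce_uniq : uniq ce.
Hypothesis ceP : forall e, e \in ce <-> toric_cells A e.
Hypothesis fl_uniq : uniq fl.
Hypothesis flP : forall x, x \in fl <-> toric_flats A x.
Hypothesis dimT : toric_dim (@setT (torus R n)) = n.
Hypothesis T_fl : (setT : {classic set (torus R n)}) \in fl.
Hypothesis flat_dim_lt : forall x y : {classic set (torus R n)},
  x \in fl -> y \in fl -> x `<=` y -> x <> y -> (toric_dim x < toric_dim y)%N.
Hypothesis z_fl : forall F, F \in ce -> z F \in fl.
Hypothesis dim_z : forall F, F \in ce -> toric_dim (z F) = toric_dim F.
Hypothesis cell_dim_lt : forall F G : {classic set (torus R n)},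
  F \in ce -> G \in ce -> closure F `<=` closure G -> F <> G ->
  (toric_dim F < toric_dim G)%N.
Hypothesis cell_supp : forall F G w : {classic set (torus R n)},
  F \in ce -> G \in ce -> w \in fl -> closure F `<=` closure G ->
  z G `<=` w -> z F `<=` w.
Let leX : rel {classic set (torus R n)} := fun x y => `[< x `<=` y >].
Let leC : rel {classic set (torus R n)} := fun F G => `[< closure F `<=` closure G >].
Hypothesis star_euler : forall F y, F \in ce -> y \in fl -> leX (z F) y ->
  \sum_(G <- ce | leC F G && leX (z G) y) (- 1) ^+ toric_dim (z G) =
  (- 1) ^+ toric_dim y :> abpoly.
Hypothesis global_euler : forall x, x \in fl ->
  \sum_(G <- ce | leX (z G) x) (- 1) ^+ toric_dim (z G) =
  (toric_dim x == 0%N)%:R :> abpoly.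

Let flat_sum := chain_sum ab_a ab_b fl (@toric_dim R n) (@flat_lt R n).
Let face_sum := chain_sum ab_a ab_b (cell_faces ce) (@face_dim R n) (face_lt A).
Let Theta x := flat_sum (iota (toric_dim x).+1 (n - toric_dim x)) x.
Let Phi (F : {classic set (torus R n)}) :=
  face_sum (iota (toric_dim F).+1 (n - toric_dim F)) (CellFace F).

Lemma face_lt_cell F G : face_lt A (CellFace F) (CellFace G) =
  leC F G && ((F : {classic set (torus R n)}) != G).
Proof.
apply/asboolP/andP => [[le ne]|[/asboolP le /eqP ne]].
  by split; [exact/asboolP|apply/eqP => e; apply: ne; rewrite e].
by split => // -[].
Qed.

Lemma flat_ltE x y : flat_lt x y = leX x y && (x != y).
Proof.
by apply/asboolP/andP => [[le /eqP ne]|[/asboolP le /eqP ne]]; split => //; exact/asboolP.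
Qed.

Lemma ThetaE x : x \in fl -> Theta x = (ab_a - ab_b) ^+ (n - toric_dim x) +
  \sum_(y <- fl | leX x y && (x != y))
    (ab_a - ab_b) ^+ (toric_dim y - toric_dim x).-1 * ab_b * Theta y.
Proof.
move=> xfl; rewrite [LHS]chain_sum_above ?dim_le //.
  apply: addr_congr; first by [].
  by apply: eq_bigl => y; exact: flat_ltE.
by move=> y yfl /asboolP[xy ne]; rewrite dim_le andbT; exact: flat_dim_lt.
Qed.

Lemma PhiE F : F \in ce -> Phi F = (ab_a - ab_b) ^+ (n - toric_dim (z F)) +
  \sum_(G <- ce | leC F G && (F != G))
    (ab_a - ab_b) ^+ (toric_dim (z G) - toric_dim (z F)).-1 * ab_b * Phi G.
Proof.
move=> Fce; rewrite dim_z //.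
rewrite [LHS](@chain_sum_above _ _ _ _ _ _ _ n (CellFace F : {classic toric_face R n})) /= ?dim_le //.
  apply: addr_congr; first by [].
  rewrite big_map; apply: eq_sum_seq => [G _|G Gce _]; first exact: face_lt_cell.
  by rewrite /= (dim_z Gce).
move=> _ /mapP[G Gce ->] /=; rewrite face_lt_cell => /andP[/asboolP FG /eqP ne].
by rewrite dim_le andbT; exact: cell_dim_lt.
Qed.

Lemma two_sum_cell_chains :
  (\sum_(F <- ce) (ab_a - ab_b) ^+ toric_dim F * ab_b * Phi F) *+ 2 =
  \sum_(w <- fl | toric_dim w == 0%N) omega_rev true (Theta w).
Proof.
have leXx x : x \in fl -> leX x x by move=> _; exact: asboolT.
have leCC F : F \in ce -> leC F F by move=> _; exact: asboolT.
have leXT x : x \in fl -> leX x setT by move=> _; exact: asboolT.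
have dlt x y : x \in fl -> y \in fl -> leX x y -> x != y -> (toric_dim x < toric_dim y)%N.
  by move=> xf yf /asboolP xy /eqP ne; exact: flat_dim_lt.
have clt F G : F \in ce -> G \in ce -> leC F G -> F != G ->
    (toric_dim (z F) < toric_dim (z G))%N.
  by move=> Fc Gc /asboolP FG /eqP ne; rewrite !dim_z //; exact: cell_dim_lt.
have supp F G w : F \in ce -> G \in ce -> w \in fl -> leC F G -> leX (z G) w -> leX (z F) w.
  by move=> Fc Gc wf /asboolP FG /asboolP Gw; apply/asboolP; exact: (cell_supp Fc Gc wf FG Gw).
have <- := @two_sum_cells abpoly ab_a ab_b (omega_rev false) (omega_rev true)
  omega_rev_aF omega_rev_bF omega_rev_aT omega_rev_bT (omega_rev1 false)
  (omega_rev1 true) abpoly_torsion2 _ fl leX (@toric_dim R n) n Theta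
  (fun x _ => dim_le x) fl_uniq leXx dlt ThetaE _ ce leC z Phi ce_uniq z_fl
  leCC clt supp star_euler PhiE _ T_fl leXT dimT global_euler n_gt0.
apply: (congr1 (fun p : abpoly => p *+ 2)); apply: eq_sum_seq => [//|F Fce _].
by rewrite (dim_z Fce).
Qed.

Lemma toric_assembly :
  ab_index (face_poset A) =
    (ab_a - ab_b) ^+ n.+1 +
    (1 / 2%:R) *:
      ab_rev (omega (ab_a * Hprime (ab_index (intersection_poset A)) * ab_b)).
Proof.
rewrite (ab_index_face_poset ce_uniq ceP) chain_sum_iota.
apply: addr_congr; first by [].
transitivity (\sum_(F <- ce) (ab_a - ab_b) ^+ toric_dim F * ab_b * Phi F).
  rewrite /cell_faces big_map; apply: eq_big => [F|F _].
    rewrite /= ltnS dim_le andbT.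
    by apply/asboolP; split.
  by rewrite /= subn0 /Phi.
rewrite -[LHS]half_double two_sum_cell_chains; apply: scaler_congr.
(* Reversal puts b in front and a behind: the leading b switches the reader to its pending state,
   and the trailing a will be the letter of the torus. *)
rewrite rev_omega ab_revM ab_revM rev_ab_a rev_ab_b omega_rev_bF.
rewrite -[ab_index (intersection_poset A)]ab_revK.
rewrite (rev_ab_index_intersection_poset fl_uniq flP dimT).
have [n' En] : exists n', n = n'.+1 by exists n.-1; rewrite prednK.
have -> : iota 0 n = 0%N :: iota 1 n' by rewrite En.
rewrite Hprime_chain_sum mulr_suml linear_sum.
apply: eq_sum_seq => [y /flP yfl|y yfl /andP[/eqP dy _]].
  case: eqP => //= _; apply/esym/asboolP.
  by split => //; apply/nesym; exact: flat_neq0 yfl.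
apply: (congr1 (omega_rev true)); rewrite /Theta /flat_sum dy subn0.
have -> : iota 1 n = rcons (iota 1 n') n.
  by have := iotaD 1 n' 1; rewrite addn1 add1n cats1 En.
(* The torus is the only flat of dimension n, because the dimension is strictly monotone on
   flats. *)
apply: (@chain_sum_rcons _ _ _ _ _ _ _ setT) => //.
- move=> x xfl dx; apply: contrapT => ne.
  by have := flat_dim_lt xfl T_fl (@subsetT _ x) ne; rewrite dimT dx ltnn.
- move=> x xfl dx; apply/asboolP; split => // e.
  by rewrite e dimT ltnn in dx.
- by apply/allP => k; rewrite mem_iota; lia.
- by apply/asboolP; split => // e; rewrite e dimT in dy; move: n_gt0; rewrite dy.
Qed.

End Assembly.

(** * Sign vectors and the Euler characteristic of cones *)

Section Dot.
Variables (R : realFieldType) (n : nat).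
Implicit Types a v w : 'rV[R]_n.

Definition dot a v : R := (a *m v^T) 0 0.

Lemma dotE a v : dot a v = \sum_(i < n) a 0 i * v 0 i.
Proof. by rewrite /dot mxE; apply: eq_bigr => i _; rewrite mxE. Qed.

Lemma dotDr a v w : dot a (v + w) = dot a v + dot a w.
Proof. by rewrite /dot linearD mulmxDr mxE. Qed.

Lemma dotZr a t v : dot a (t *: v) = t * dot a v.
Proof. by rewrite /dot linearZ -scalemxAr mxE. Qed.

Lemma dotNr a v : dot a (- v) = - dot a v.
Proof. by rewrite -scaleN1r dotZr mulN1r. Qed.

Lemma dotBr a v w : dot a (v - w) = dot a v - dot a w.
Proof. by rewrite dotDr dotNr. Qed.

Lemma dot0r a : dot a 0 = 0.
Proof. by rewrite -(scale0r 0) dotZr mul0r. Qed.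

Lemma mulmx_tr_eq0 m (M : 'M[R]_(m, n)) v :
  M *m v^T = 0 <-> forall i, dot (row i M) v = 0.
Proof.
split=> [M0 i|H]; first by rewrite /dot -row_mul M0 mxE mxE.
by apply/matrixP => i j; rewrite ord1 [RHS]mxE -(H i) /dot -row_mul [RHS]mxE.
Qed.

End Dot.

Section Signs.
Variables (R : realFieldType) (n : nat).
Implicit Types (a v w : 'rV[R]_n) (cs : seq ('rV[R]_n * option bool)).

(* [None] stands for the sign 0. *)
Definition sgn (x : R) : option bool := if x == 0 then None else Some (0 < x).

Lemma sgn_None x : (sgn x == None) = (x == 0).
Proof. by rewrite /sgn; case: (x == 0). Qed.

Lemma sgn_pos x : (sgn x == Some true) = (0 < x).
Proof. by rewrite /sgn; case: ltgtP. Qed.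

Lemma sgn_neg x : (sgn x == Some false) = (x < 0).
Proof. by rewrite /sgn; case: ltgtP. Qed.

Lemma sgn_scale t x : 0 < t -> sgn (t * x) = sgn x.
Proof.
by move=> t0; rewrite /sgn mulf_eq0 gt_eqF //= pmulr_rgt0.
Qed.

Lemma sgn_add x y : sgn x = sgn y -> sgn (x + y) = sgn x.
Proof.
rewrite /sgn; case: (ltgtP x 0) => [x0|x0|->]; case: (ltgtP y 0) => [y0|y0|->] // _.
- by rewrite lt_eqF ?ltW //; [congr Some; apply/negbTE; lra|lra].
- by rewrite gt_eqF; [congr Some; lra|lra].
- by rewrite addr0 eqxx.
Qed.

Definition sat v cs := all (fun c => sgn (dot c.1 v) == c.2) cs.

(** The row space is spanned by the normals with sign 0. The cone of [cs] is open in its orthogonal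
    complement, so a nonempty cone has dimension [n - \rank (zero_span cs)]. *)
Fixpoint zero_span cs : 'M[R]_n :=
  match cs with
  | [::] => 0
  | (a, None) :: cs' => (a + zero_span cs')%MS
  | _ :: cs' => zero_span cs'
  end.

Lemma sat_combine v w s t cs : 0 < s -> 0 < t -> sat v cs -> sat w cs ->
  sat (s *: v + t *: w) cs.
Proof.
move=> s0 t0 /allP sv /allP sw; apply/allP => c cc.
have /eqP ev := sv c cc; have /eqP ew := sw c cc.
by rewrite dotDr !dotZr sgn_add !sgn_scale // ev ?ew.
Qed.

Lemma sat_scale v t cs : 0 < t -> sat (t *: v) cs = sat v cs.
Proof. by move=> t0; apply: eq_all => c /=; rewrite dotZr sgn_scale. Qed.

Lemma mem_zero_span a cs : (a, None) \in cs -> (a <= zero_span cs)%MS.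
Proof.
elim: cs => // -[b s] cs IH; rewrite inE => /predU1P[[-> <-]|/IH acs] /=.
  exact: addsmxSl.
by case: s => // ; exact: submx_trans acs (addsmxSr _ _).
Qed.

Lemma zero_span_sub cs m (M : 'M[R]_(m, n)) :
  (zero_span cs <= M)%MS <-> forall a, (a, None) \in cs -> (a <= M)%MS.
Proof.
split=> [H a /mem_zero_span aH|]; first exact: submx_trans aH H.
elim: cs => [|[b s] cs IH] H; first exact: sub0mx.
have {}IH : (zero_span cs <= M)%MS by apply: IH => a acs; apply: H; rewrite inE acs orbT.
by case: s H => [//|] H /=; rewrite addsmx_sub IH andbT H // inE eqxx.
Qed.

Lemma submx_dot m (M : 'M[R]_(m, n)) a v :
  (a <= M)%MS -> M *m v^T = 0 -> dot a v = 0.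
Proof. by move=> /submxP[D ->] M0; rewrite /dot -mulmxA M0 mulmx0 mxE. Qed.

Lemma sat_zero_span v cs : sat v cs -> zero_span cs *m v^T = 0.
Proof.
move=> /allP sv; suff : (zero_span cs <= kermx v^T)%MS.
  by move/sub_kermxP.
apply/zero_span_sub => a /sv /=; rewrite sgn_None => /eqP a0.
by apply/sub_kermxP/matrixP => i j; rewrite !ord1 [RHS]mxE.
Qed.

Lemma dual_vector m (M : 'M[R]_(m, n)) a : ~~ (a <= M)%MS ->
  exists w, M *m w^T = 0 /\ dot a w != 0.
Proof.
rewrite submxE => /eqP/matrixP H.
have [/existsP[j Hj]|/existsPn nex] := boolP [exists j, (a *m cokermx M) 0 j != 0];
  last first.
  case: H => i j; rewrite ord1 [RHS]mxE.
  by apply/eqP; rewrite -[_ == _]negbK; exact: nex.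
exists (col j (cokermx M))^T; rewrite trmxK; split.
  by rewrite colE mulmxA mulmx_coker mul0mx.
by rewrite /dot trmxK colE mulmxA -colE mxE.
Qed.

(** Strict inequalities survive small moves, and moves orthogonal to [zero_span cs] preserve the
    equalities. *)
Lemma sat_perturb v w cs : sat v cs -> zero_span cs *m w^T = 0 ->
  exists2 e : R, 0 < e & forall t, `|t| <= e -> sat (v + t *: w) cs.
Proof.
elim: cs => [|[a s] cs IH]; first by exists 1.
rewrite /= => /andP[/eqP sv /IH{}IH] w0.
have [e e0 He] : exists2 e : R, 0 < e & forall t, `|t| <= e -> sat (v + t *: w) cs.
  apply: IH; case: s w0 {sv} => // w0.
  by case/submxP: (addsmxSr a (zero_span cs)) => D ->; rewrite -mulmxA w0 mulmx0.
have [av|av] := eqVneq (dot a v) 0.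
  exists e => // t te; rewrite He // andbT.
  move: sv; rewrite /sgn av eqxx => sE; rewrite -{}sE in w0 *.
  have aw : dot a w = 0 by apply: submx_dot w0; exact: addsmxSl.
  by rewrite dotDr dotZr av aw mulr0 addr0 eqxx.
(* With this bound the change [|t * dot a w|] stays below [|dot a v|]; adding 1 avoids a zero
   denominator. *)
pose e' := Num.min e (`|dot a v| / (2 * (`|dot a w| + 1))).
exists e'; first by rewrite lt_min e0 divr_gt0 ?normr_gt0 // mulr_gt0 // ltr_wpDl.
move=> t; rewrite le_min => /andP[te tb]; rewrite He // andbT -sv.
have small : `|t * dot a w| < `|dot a v|.
  have aw0 := normr_ge0 (dot a w); have p0 : 0 < `|dot a v| by rewrite normr_gt0.
  rewrite normrM; move: tb; rewrite ler_pdivlMr; last by lra.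
  have := normr_ge0 t; set x := `|t|; set y := `|dot a w| in aw0 *; nra.
rewrite dotDr dotZr; move: small; set x := dot a v; set y := t * _.
move: av; rewrite -/x /sgn => x0; rewrite (negbTE x0).
rewrite ltr_norml; case: (ltgtP x 0) x0 => // xs _.
  rewrite ltr0_norm // => /andP[h1 h2]; rewrite lt_eqF; last by lra.
  by apply/eqP; congr Some; apply/negbTE; rewrite -leNgt; lra.
rewrite gtr0_norm // => /andP[h1 h2]; rewrite gt_eqF; last by lra.
by apply/eqP; congr Some; lra.
Qed.

End Signs.

Section Euler.
Variables (R : realFieldType) (n : nat) (K : pzRingType).
Implicit Types (a v w : 'rV[R]_n) (cs : seq ('rV[R]_n * option bool)).

(** The compactly supported Euler characteristic of a relatively open convex cone, 0 for the empty
    one. *)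
Definition chi cs : K :=
  if `[< exists v, sat v cs >] then (-1) ^+ (n - \rank (zero_span cs)) else 0.

(* Cutting an open convex cone by a hyperplane either leaves it whole or splits
   it into two cones of the same dimension and one of dimension one less. *)
Lemma chi_cut cs a :
  chi cs = chi ((a, None) :: cs) + (chi ((a, Some true) :: cs) +
           chi ((a, Some false) :: cs)).
Proof.
have [[v0 sv0]|nex] := pselect (exists v, sat v cs); last first.
  have chi0 s : chi ((a, s) :: cs) = 0.
    by rewrite /chi asboolF // => -[v /andP[_ sv]]; apply: nex; exists v.
  by rewrite !chi0 !addr0 /chi asboolF.
rewrite {1}/chi asboolT; last by exists v0.
have chi_none s : ~ (exists2 v, sat v cs & sgn (dot a v) = s) ->
    chi ((a, s) :: cs) = 0.
  move=> nv; rewrite /chi asboolF // => -[v /andP[/eqP sv vs]].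
  by apply: nv; exists v.
have chi_some s v : sat v cs -> sgn (dot a v) = s ->
    chi ((a, s) :: cs) = (-1) ^+ (n - \rank (zero_span ((a, s) :: cs))).
  by move=> vs sv; rewrite /chi asboolT //; exists v; rewrite /= sv eqxx.
have [acs|nacs] := boolP (a <= zero_span cs)%MS.
  have a0 v : sat v cs -> sgn (dot a v) = None.
    move=> /sat_zero_span /(submx_dot acs) av; apply/eqP.
    by rewrite sgn_None av.
  rewrite (chi_some _ _ sv0 (a0 _ sv0)) [chi (_ :: _)]chi_none ?[X in _ + (_ + X)]chi_none.
  - by rewrite !addr0 /= (addsmx_idPr acs).
  - by move=> [v /a0 ->].
  - by move=> [v /a0 ->].
have [w [w0 aw]] := dual_vector nacs.
have rk : \rank (a + zero_span cs)%MS = (\rank (zero_span cs)).+1.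
  apply/eqP; rewrite eqn_leq; apply/andP; split.
    apply: leq_trans (mxrank_adds_leqif _ _) _.
    exact: leq_add (rank_leq_row a) (leqnn _).
  apply: rank_ltmx; rewrite ltmxE addsmxSr /=.
  by apply: contra nacs => /(submx_trans (addsmxSl _ _)).
have rkn := rank_leq_col (a + zero_span cs)%MS; rewrite rk in rkn.
(* If the hyperplane meets the cone, moving along [w] in both directions reaches both sides; two
   pieces of the old dimension and one of dimension one less have the same alternating sum as the
   whole. *)
have [[v sv av]|nz] := pselect (exists2 v, sat v cs & dot a v = 0).
  have [e e0 He] := sat_perturb sv w0.
  have sat_s (b : bool) : exists2 v', sat v' cs & sgn (dot a v') = Some b.
    pose s := (if b == (0 < dot a w) then e else - e).
    exists (v + s *: w).
      by apply: He; rewrite /s; case: ifP => _; rewrite ?normrN gtr0_norm.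
    rewrite dotDr dotZr av add0r /s; apply/eqP.
    case: b @s => s; rewrite ?sgn_pos ?sgn_neg /s; case: (ltgtP (dot a w) 0) aw => // h _ /=;
      nra.
  have [v1 sv1 av1] := sat_s true; have [v2 sv2 av2] := sat_s false.
  have a0 : sgn (dot a v) = None by apply/eqP; rewrite sgn_None av.
  rewrite (chi_some _ _ sv a0) (chi_some _ _ sv1 av1) (chi_some _ _ sv2 av2).
  rewrite /= rk; have -> : (n - \rank (zero_span cs) =
     (n - (\rank (zero_span cs)).+1).+1)%N by lia.
  by rewrite exprS mulN1r addrA subrr add0r.
have chi0 : chi ((a, None) :: cs) = 0.
  apply: chi_none => -[v vs /eqP]; rewrite sgn_None => /eqP av.
  by apply: nz; exists v.
(* Points on both sides would combine to a point of the cone on the hyperplane: the coefficients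
   make the two values of [a] cancel. *)
have opp v v' : sat v cs -> sat v' cs -> 0 < dot a v -> dot a v' < 0 -> False.
  move=> vs vs' p q; apply: nz.
  exists ((- dot a v') *: v + dot a v *: v').
    by apply: sat_combine; rewrite ?oppr_gt0.
  by rewrite dotDr !dotZr; ring.
rewrite chi0 add0r; case: (ltgtP (dot a v0) 0) => h.
- rewrite chi_none ?add0r; last first.
    by move=> [v vs /eqP]; rewrite sgn_pos => p; exact: (opp v v0).
  by rewrite (chi_some _ _ sv0) //; apply/eqP; rewrite sgn_neg.
- rewrite [X in _ = _ + X]chi_none ?addr0; last first.
    by move=> [v vs /eqP]; rewrite sgn_neg => p; exact: (opp v0 v).
  by rewrite (chi_some _ _ sv0) //; apply/eqP; rewrite sgn_pos.
- by case: nz; exists v0.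
Qed.

End Euler.

Import numFieldNormedType.Exports.
Local Open Scope classical_set_scope.
Local Open Scope ring_scope.

(** * Topology of the torus *)

Section UnitIntervals.
Variable R : realType.
Implicit Types x y z t : R.

Definition fl x : int := Num.floor x.
Definition cl x : int := Num.ceil x.

Lemma fl_ge x k : (k <= fl x) = (k%:~R <= x). Proof. exact: floor_ge_int. Qed.
Lemma fl_lt x k : (fl x < k) = (x < k%:~R). Proof. exact: floor_lt_int. Qed.
Lemma cl_le x k : (cl x <= k) = (x <= k%:~R). Proof. exact: ceil_le_int. Qed.
Lemma cl_gt x k : (k < cl x) = (k%:~R < x). Proof. exact: ceil_gt_int. Qed.
Lemma fl_itv x : (fl x)%:~R <= x < (fl x + 1)%:~R. Proof. exact: floor_itv. Qed.
Lemma cl_itv x : (cl x - 1)%:~R < x <= (cl x)%:~R. Proof. exact: ceil_itv. Qed.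
Lemma flD x k : k \is a Num.int -> fl (x + k) = fl x + fl k.
Proof. exact: floorDrz. Qed.
Lemma clD x k : k \is a Num.int -> cl (x + k) = cl x + cl k.
Proof. exact: ceilDrz. Qed.
Lemma cl_fl x : cl x = fl x + (x \isn't a Num.int). Proof. exact: ceil_floor. Qed.
Lemma int_fl x : (x \is a Num.int) = ((fl x)%:~R == x). Proof. exact: intrEfloor. Qed.

(* x lies in the closure of the cell of y, for the subdivision of the line into
   the integers and the open intervals between consecutive integers *)
Definition face_of x y : Prop :=
  (fl y <= fl x) /\ (cl x <= cl y).

Lemma floor_ceil x : (fl x <= cl x) /\ (cl x <= fl x + 1).
Proof. by rewrite cl_fl; case: (x \is a Num.int) => /=; rewrite ?addr0 ?addr1; split; lia. Qed.

Lemma int_ceil x : (x \is a Num.int) = (cl x == fl x).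
Proof. by rewrite cl_fl; case: (x \is a Num.int) => /=; lia. Qed.

Lemma face_ofE x y :
  face_of x y <-> (fl y)%:~R <= x /\ x <= (cl y)%:~R.
Proof. by rewrite /face_of fl_ge cl_le. Qed.

Lemma face_of_refl x : face_of x x.
Proof. by split. Qed.

Lemma face_of_trans y x z : face_of x y -> face_of y z -> face_of x z.
Proof. by move=> [h1 h2] [h3 h4]; split; lia. Qed.

Lemma face_of_int x y : face_of x y -> y \is a Num.int -> x = y.
Proof.
move=> /face_ofE[h1 h2]; rewrite int_ceil => /eqP yE; rewrite yE in h2.
have := fl_itv y; have := cl_itv y; rewrite yE; lra.
Qed.

Lemma face_of_nint x y : face_of x y -> x \isn't a Num.int -> face_of y x.
Proof.
move=> [h1 h2]; rewrite int_ceil => /eqP h.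
by have := floor_ceil x; have := floor_ceil y; split; lia.
Qed.

Lemma face_ofDint x y k : k \is a Num.int -> face_of (x + k) (y + k) <-> face_of x y.
Proof.
by move=> kint; rewrite /face_of !flD // !clD //; split => -[]; split; lia.
Qed.

Lemma face_of_near x : \forall y \near x, face_of x y.
Proof.
have h1 : x < (fl x + 1)%:~R by have := fl_itv x; lra.
have h2 : (cl x - 1)%:~R < x by have := cl_itv x; lra.
apply: filterS2 (lt_nbhsl h1) (lt_nbhsr h2) => y; rewrite -fl_lt -cl_gt.
by split; lia.
Qed.

Lemma face_of_convex x x' y t : 0 <= t -> t <= 1 -> face_of x y -> face_of x' y ->
  face_of (x + t * (x' - x)) y.
Proof. by move=> t0 t1 /face_ofE[h1 h2] /face_ofE[h3 h4]; apply/face_ofE; split; nra. Qed.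

Lemma face_of_open x y t : 0 < t -> t <= 1 -> face_of x y ->
  face_of y (x + t * (y - x)).
Proof.
move=> t0 t1 [h1 h2].
have h3 : y < (fl y + 1)%:~R by have := fl_itv y; lra.
have h4 : (cl y - 1)%:~R < y by have := cl_itv y; lra.
have h5 : x <= (fl y + 1)%:~R by rewrite -cl_le; have := floor_ceil y; lia.
have h6 : (cl y - 1)%:~R <= x by rewrite -fl_ge; have := floor_ceil y; lia.
split.
  suff : x + t * (y - x) < (fl y + 1)%:~R by rewrite -fl_lt; lia.
  by nra.
suff : (cl y - 1)%:~R < x + t * (y - x) by rewrite -cl_gt; lia.
by nra.
Qed.

Lemma face_of_sgn x y y' : x \is a Num.int -> face_of x y -> face_of x y' ->
  sgn (y - x) = sgn (y' - x) -> face_of y y'.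
Proof.
rewrite int_ceil => /eqP xE [h1 h2] [h3 h4].
have Fx : (fl x)%:~R = x.
  by apply/eqP; rewrite -int_fl int_ceil xE.
rewrite /sgn !subr_eq0 !subr_gt0.
case: (ltgtP y x) => h; case: (ltgtP y' x) => h' //; last by rewrite h h'.
  have k1 : fl y < fl x by rewrite fl_lt Fx.
  have k2 : fl y' < fl x by rewrite fl_lt Fx.
  by have := floor_ceil y; have := floor_ceil y'; split; lia.
have k1 : fl x < cl y by rewrite cl_gt Fx.
have k2 : fl x < cl y' by rewrite cl_gt Fx.
by have := floor_ceil y; have := floor_ceil y'; split; lia.
Qed.

Lemma face_of_dist x x' y : face_of x y -> face_of x' y -> `|x - x'| <= 1.
Proof.
move=> /face_ofE[h1 h2] /face_ofE[h3 h4]; have [_ h] := floor_ceil y.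
have : (cl y)%:~R <= (fl y + 1)%:~R :> R by rewrite ler_int.
by rewrite intrD ler_norml; lra.
Qed.

(** A nonzero [x] has a multiple of modulus strictly between 0 and 1. This discreteness forces a
    segment with integral heights to run parallel to the hyperplanes. *)
Lemma int_multiples_eq0 x : (forall t, 0 <= t <= 1 -> t * x \is a Num.int) -> x = 0.
Proof.
move=> H; apply/eqP/negPn/negP => x0.
have p : 0 < `|x| by rewrite normr_gt0.
pose t := 1 / (2 * (`|x| + 1)).
have t0 : 0 < t by rewrite divr_gt0 //; lra.
have tx : t * (2 * (`|x| + 1)) = 1 by rewrite mulfVK // gt_eqF; lra.
have /H tint : 0 <= t <= 1 by nra.
have : `|t * x| < 1 by rewrite normrM gtr0_norm //; nra.
by rewrite ltNge norm_intr_ge1 // mulf_neq0 // gt_eqF.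
Qed.

End UnitIntervals.

Lemma near_forall (T : topologicalType) (k : nat) (P : 'I_k -> T -> Prop) (x : T) :
  (forall i, \forall y \near x, P i y) -> \forall y \near x, forall i, P i y.
Proof. by move=> H; exact (@filter_forall T 'I_k P (nbhs x) _ H). Qed.

Section TorusTopology.
Variables (R : realType) (n : nat).
Local Notation pi := (@torus_pi R n).
Implicit Types (u v w k : 'rV[R]_n) (X Y : set (torus R n)).

Definition lattice k : Prop := forall i, k 0 i \is a Num.int.

Lemma torus_piP u v : pi u = pi v <-> lattice (u - v).
Proof.
rewrite /torus_pi; split.
  by move=> /eqquotP /forallP H i; rewrite !mxE; exact: H.
move=> H; apply/eqquotP; apply/forallP => i.
by have := H i; rewrite !mxE.
Qed.

Lemma torus_pi_add u k : lattice k -> pi (u + k) = pi u.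
Proof. by move=> kl; apply/torus_piP; rewrite addrC addKr. Qed.

Lemma torus_pi_surj p : exists u, pi u = p.
Proof. by exists (repr p); rewrite /torus_pi reprK. Qed.

Lemma latticeN k : lattice k -> lattice (- k).
Proof. by move=> kl i; rewrite mxE rpredN. Qed.

Lemma continuous_torus_pi : continuous pi.
Proof. exact: pi_continuous. Qed.

Lemma continuous_add_const k : continuous (fun u : 'rV[R]_n => u + k).
Proof. by move=> u; exact: (cvgD cvg_id (cvg_cst k)). Qed.

Lemma continuous_line u v : continuous (fun t : R => u + t *: v).
Proof.
move=> t; apply: cvgD; first exact: cvg_cst.
by apply: cvgZr_tmp; exact: cvg_id.
Qed.

Lemma open_torus_pi (U : set 'rV[R]_n) : open U -> open (pi @` U).
Proof.
move=> oU.
have -> : open (pi @` U) = open (pi @^-1` (pi @` U)) by [].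
have -> : pi @^-1` (pi @` U) =
    \bigcup_(k in [set k | lattice k]) ((fun u => u + k) @^-1` U).
  apply/seteqP; split => [u [v Uv /torus_piP vu]|u [k kl Uk]].
    by exists (v - u) => //=; rewrite addrC subrK.
  by exists (u + k) => //; exact: torus_pi_add.
apply: bigcup_open => k _; apply: open_comp => // u _.
exact: continuous_add_const.
Qed.

Lemma nbhs_torus_pi u X : nbhs (pi u) X <-> \forall u' \near u, X (pi u').
Proof.
split; first by move=> H; exact: continuous_torus_pi.
move=> nX; have : nbhs u (pi @^-1` X) by [].
rewrite !nbhsE => -[U [oU Uu] UX].
exists (pi @` U); first by split; [exact: open_torus_pi|exists u].
by move=> _ [v /UX Xv <-].
Qed.

Lemma closure_torus_pi u X :
  closure X (pi u) <-> (forall B : set 'rV[R]_n, nbhs u B ->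
    exists2 v, B v & X (pi v)).
Proof.
split=> [clX B|H B /nbhs_torus_pi /H[v Bv Xv]]; last by exists (pi v).
rewrite nbhsE => -[U [oU Uu] UB].
have /clX[q [Xq [v Uv e]]] : nbhs (pi u) (pi @` U).
  by apply: open_nbhs_nbhs; split; [exact: open_torus_pi|exists u].
by exists v; [exact: UB|rewrite e].
Qed.

(** As [Y] is only locally constant along [X], the open set that cuts out [Y] on [W] is the interior
    of the union of [Y] with the complement of [X]. The same construction for the complement of [Y]
    makes the trace on [W] closed as well. *)
Lemma connected_locally_constant X Y (W : set (torus R n)) p :
  connected W -> W `<=` X -> W p -> Y p ->
  (forall u, X (pi u) ->
     \forall u' \near u, X (pi u') -> (Y (pi u) <-> Y (pi u'))) ->
  W `<=` Y.
Proof.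
move=> cW WX Wp Yp loc.
have inter (P : set (torus R n)) : (forall u, X (pi u) -> P (pi u) ->
     \forall u' \near u, X (pi u') -> P (pi u')) ->
   forall q, X q -> P q -> interior (~` X `|` P) q.
  move=> H q Xq Pq; have [u e] := torus_pi_surj q; rewrite -e in Xq Pq *.
  apply/nbhs_torus_pi; apply: filterS (H u Xq Pq) => u' Hu'.
  by have [/Hu'|] := pselect (X (pi u')); [right|left].
have YO := inter Y; have NO := inter (~` Y).
have {}YO : forall q, X q -> Y q -> interior (~` X `|` Y) q.
  by apply: YO => u Xu Yu; apply: filterS (loc u Xu) => u' Hu' /Hu'[] h _; exact: h.
have {}NO : forall q, X q -> ~ Y q -> interior (~` X `|` ~` Y) q.
  by apply: NO => u Xu Yu; apply: filterS (loc u Xu) => u' Hu' /Hu'[_ h] /h.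
have <- : W `&` Y = W; last by move=> q [].
apply: cW.
- by exists p; split.
- exists (interior (~` X `|` Y)); first exact: open_interior.
  apply/seteqP; split => q [Wq Hq]; split => //; first exact: YO (WX _ Wq) Hq.
  by have [/(_ (WX _ Wq))|] := interior_subset Hq.
- exists (~` interior (~` X `|` ~` Y)); first by apply: open_closedC; exact: open_interior.
  apply/seteqP; split => q [Wq Hq]; split => //.
    by move=> /interior_subset[/(_ (WX _ Wq))|].
  by apply: contrapT => nY; apply: Hq; exact: NO (WX _ Wq) nY.
Qed.

Lemma component_torus_pi X Y p : Y p -> Y `<=` X -> connected Y ->
  (forall u, X (pi u) ->
     \forall u' \near u, X (pi u') -> (Y (pi u) <-> Y (pi u'))) ->
  connected_component X p = Y.
Proof.
move=> Yp YX cY loc; apply/seteqP; split; last exact: connected_component_max.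
apply: (connected_locally_constant _ _ _ Yp loc).
- exact: component_connected.
- exact: connected_component_sub.
- exact: connected_component_refl (YX _ Yp).
Qed.

Lemma lattice_small k : lattice k -> `|k| < 1 -> k = 0.
Proof.
move=> kl k1; apply/matrixP => x i; rewrite ord1 [RHS]mxE.
apply/eqP/negPn/negP => ki.
have := norm_intr_ge1 (kl i) ki; rewrite leNgt => /negP; apply.
by apply: le_lt_trans k1; rewrite /Num.norm /= mx_normrE (le_bigmax _ _ (0, i)).
Qed.

Lemma connected_torus_pi (Q : set 'rV[R]_n) u0 : Q u0 ->
  (forall u t, Q u -> 0 <= t -> t <= 1 -> Q (u0 + t *: (u - u0))) ->
  connected (pi @` Q).
Proof.
move=> Q0 star.
have -> : pi @` Q = \bigcup_(u in Q)
    ((fun t : R => pi (u0 + t *: (u - u0))) @` `[0, 1]).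
  apply/seteqP; split => [_ [u Qu <-]|_ [u Qu [t /= + <-]]].
    exists u => //; exists 1; first by rewrite /= in_itv /= ler01 lexx.
    by rewrite scale1r subrKC.
  rewrite in_itv /= => /andP[t0 t1].
  by exists (u0 + t *: (u - u0)) => //; exact: star.
apply: bigcup_connected.
  exists (pi u0) => u _; exists 0; first by rewrite /= in_itv /= lexx ler01.
  by rewrite scale0r addr0.
move=> u _; apply: connected_continuous_connected; first exact: segment_connected.
apply: continuous_subspaceT => t.
apply: (@continuous_comp _ _ _ (fun t : R => u0 + t *: (u - u0)) pi); last exact: continuous_torus_pi.
exact: continuous_line.
Qed.

Lemma continuous_dot (a : 'rV[R]_n) : continuous (dot a).
Proof.
have sum_cont (r : seq 'I_n) :
    continuous (fun v : 'rV[R]_n => \sum_(i <- r) a 0 i * v 0 i).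
  elim: r => [|i r IH] u.
    have -> : (fun v : 'rV[R]_n => \sum_(i <- [::]) a 0 i * v 0 i) = cst 0.
      by apply/funext => v; rewrite big_nil.
    exact: cst_continuous.
  have -> : (fun v : 'rV[R]_n => \sum_(i <- i :: r) a 0 i * v 0 i) =
    (fun v : 'rV[R]_n => a 0 i * v 0 i + \sum_(i <- r) a 0 i * v 0 i).
    by apply/funext => v; rewrite big_cons.
  have mul_coord : continuous (fun v : 'rV[R]_n => a 0 i * v 0 i).
    move=> v; apply: (@continuousM R 'rV[R]_n); first exact: cst_continuous.
    exact: coord_continuous.
  exact (cvgD (mul_coord u) (IH u)).
move=> u; rewrite (_ : dot a = fun v => \sum_(i < n) a 0 i * v 0 i).
  exact: sum_cont.
by apply/funext => v; rewrite dotE.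
Qed.

End TorusTopology.

Section ConvexSets.
Variables (R : realType) (d : nat).

Lemma convex_connected (C : set 'rV[R]_d) :
  (forall x y (t : R), C x -> C y -> 0 <= t -> t <= 1 -> C (x + t *: (y - x))) ->
  connected C.
Proof.
move=> conv; have [[x0 C0]|nC] := pselect (exists x, C x); last first.
  rewrite (_ : C = set0); first exact: connected0.
  by apply/seteqP; split => // x Cx; apply: nC; exists x.
have -> : C = \bigcup_(u in C) ((fun t : R => x0 + t *: (u - x0)) @` `[0, 1]).
  apply/seteqP; split => [u Cu|_ [u Cu [t /= + <-]]].
    exists u => //; exists 1; first by rewrite /= in_itv /= ler01 lexx.
    by rewrite scale1r subrKC.
  by rewrite in_itv /= => /andP[t0 t1]; exact: conv.
apply: bigcup_connected.
  exists x0 => u _; exists 0; first by rewrite /= in_itv /= lexx ler01.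
  by rewrite scale0r addr0.
move=> u _; apply: connected_continuous_connected; first exact: segment_connected.
by apply: continuous_subspaceT; exact: continuous_line.
Qed.

Lemma sqr_convex (a b t : R) : 0 <= t -> t <= 1 ->
  (a + t * (b - a)) ^+ 2 <= (1 - t) * a ^+ 2 + t * b ^+ 2.
Proof.
move=> t0 t1; rewrite -subr_ge0.
rewrite (_ : _ - _ = t * (1 - t) * (a - b) ^+ 2); last by ring.
by rewrite mulr_ge0 ?sqr_ge0 // mulr_ge0 // subr_ge0.
Qed.

Lemma open_ball_rV_convex (x y : 'rV[R]_d) (t : R) :
  open_ball_rV x -> open_ball_rV y -> 0 <= t -> t <= 1 ->
  open_ball_rV (x + t *: (y - x)).
Proof.
rewrite /open_ball_rV /= => Bx By t0 t1.
apply: (@le_lt_trans _ _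
  ((1 - t) * (\sum_(i < d) x 0 i ^+ 2) + t * (\sum_(i < d) y 0 i ^+ 2))); last first.
  move: Bx By; set X := \sum_(i < d) x 0 i ^+ 2; set Y := \sum_(i < d) y 0 i ^+ 2.
  move=> X1 Y1; have [t1'|t1'] := ltP t 1; last first.
    by rewrite (_ : t = 1); lra.
  have h1 : 0 < (1 - t) * (1 - X) by rewrite mulr_gt0 ?subr_gt0.
  have h2 : 0 <= t * (1 - Y) by rewrite mulr_ge0 // subr_ge0 ltW.
  by lra.
rewrite !mulr_sumr -big_split /=; apply: ler_sum => i _.
by rewrite !mxE; exact: sqr_convex.
Qed.

Lemma open_ball_rV_closed : @open_ball_rV R d `<=` @closed_ball_rV R d.
Proof. by move=> x; exact: ltW. Qed.

Lemma closed_ball_rV_boundary : (0 < d)%N ->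
  exists2 x, @closed_ball_rV R d x & ~ @open_ball_rV R d x.
Proof.
move=> d0; pose i0 := Ordinal d0; exists (delta_mx 0 i0).
  rewrite /closed_ball_rV /= (bigD1 i0) //= mxE !eqxx expr1n big1 ?addr0 // => i ne.
  by rewrite mxE (negbTE ne) andbF expr0n.
rewrite /open_ball_rV /= (bigD1 i0) //= mxE !eqxx expr1n big1 ?addr0 ?ltxx // => i ne.
by rewrite mxE (negbTE ne) andbF expr0n.
Qed.

End ConvexSets.

(** * Cells and flats of a toric arrangement *)

Section Arrangement.
Variables (R : realType) (n m : nat).
Variables (al : 'I_m -> 'rV[R]_n) (be : 'I_m -> R).
Hypothesis al_int : forall i k, lattice k -> dot (al i) k \is a Num.int.
Local Notation pi := (@torus_pi R n).
Implicit Types (u v w k q : 'rV[R]_n) (J : {set 'I_m}).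

Definition height i u : R := dot (al i) u - be i.

(** [u] lies in the closed cell of [q] in the universal cover. The preimages of the hyperplanes are
    the integer levels of the heights, so this reduces to the line cut at the integers. *)
Definition faceV u q : Prop := forall i, face_of (height i u) (height i q).

Definition cellV q : set 'rV[R]_n := [set u | faceV u q /\ faceV q u].

Definition cell q : set (torus R n) := pi @` cellV q.

Definition walls u : {set 'I_m} := [set i | height i u \is a Num.int].

Definition orth J v : Prop := forall i, i \in J -> dot (al i) v = 0.

Definition flat u J : set (torus R n) := pi @` [set w | orth J (w - u)].

Lemma heightD i u v : height i (u + v) = height i u + dot (al i) v.
Proof. by rewrite /height dotDr addrAC. Qed.

Lemma heightB i u v : height i u - height i v = dot (al i) (u - v).
Proof. by rewrite /height dotBr; ring. Qed.

Lemma height_segment i u v t :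
  height i (u + t *: (v - u)) = height i u + t * (height i v - height i u).
Proof. by rewrite heightD dotZr heightB. Qed.

Lemma continuous_height i : continuous (height i).
Proof. by move=> u; exact (cvgB (@continuous_dot R n (al i) u) (cvg_cst (be i))). Qed.

Lemma near_faceV u : \forall v \near u, faceV u v.
Proof.
apply: near_forall => i.
exact (@continuous_height i u _ (face_of_near (height i u))).
Qed.

Lemma faceV_refl u : faceV u u.
Proof. by move=> i; exact: face_of_refl. Qed.

Lemma faceV_trans v u w : faceV u v -> faceV v w -> faceV u w.
Proof. by move=> uv vw i; exact: face_of_trans (uv i) (vw i). Qed.

Lemma faceV_shift u v k : lattice k -> faceV (u + k) (v + k) <-> faceV u v.
Proof.
move=> kl; split=> H i; have := H i; rewrite !heightD.
  by move/face_ofDint; apply; exact: al_int.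
by move=> ?; apply/face_ofDint => //; exact: al_int.
Qed.

Lemma cellV_refl q : cellV q q.
Proof. by split; exact: faceV_refl. Qed.

Lemma cellV_sym u q : cellV q u -> cellV u q.
Proof. by case. Qed.

Lemma cellV_trans v u w : cellV w v -> cellV v u -> cellV w u.
Proof. by move=> [h1 h2] [h3 h4]; split; [exact: faceV_trans h3 h1|exact: faceV_trans h2 h4]. Qed.

Lemma cellV_shift u q k : lattice k -> cellV (q + k) (u + k) <-> cellV q u.
Proof.
move=> kl; have fs v w := faceV_shift v w kl.
by split=> -[h1 h2]; split; apply/fs.
Qed.

Lemma cell_pi q u : cell q (pi u) <-> exists2 k, lattice k & cellV q (u + k).
Proof.
split=> [[w qw /torus_piP wu]|[k kl qk]]; first by exists (w - u) => //; rewrite subrKC.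
by exists (u + k) => //; exact: torus_pi_add.
Qed.

Lemma cell_refl q : cell q (pi q).
Proof. by exists q => //; exact: cellV_refl. Qed.

Lemma cellV_cell q q' : cellV q q' -> cell q = cell q'.
Proof.
move=> qq'; apply/seteqP; split => _ [u qu <-]; exists u => //.
  exact: cellV_trans (cellV_sym qq') qu.
exact: cellV_trans qq' qu.
Qed.

Lemma cell_shift q k : lattice k -> cell (q + k) = cell q.
Proof.
move=> kl; apply/seteqP; split => _ [u qu <-].
  apply/cell_pi; exists (- k); first exact: latticeN.
  by apply/(cellV_shift _ _ kl); rewrite subrK.
by apply/cell_pi; exists k => //; apply/cellV_shift.
Qed.

Lemma cell_eq q u : cell q (pi u) -> cell u = cell q.
Proof.
by move=> /cell_pi[k kl qk]; rewrite -(cell_shift u kl) (cellV_cell qk).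
Qed.

Lemma cell_inj q q' : cell q = cell q' -> exists2 k, lattice k & cellV q (q' + k).
Proof. by move=> e; apply/cell_pi; rewrite e; exact: cell_refl. Qed.

Lemma wallsE i u : (i \in walls u) = (height i u \is a Num.int).
Proof. by rewrite inE. Qed.

Lemma faceV_walls u q i : faceV u q -> i \in walls q -> height i u = height i q.
Proof. by move=> uq; rewrite wallsE; exact: face_of_int (uq i). Qed.

Lemma faceV_walls_sub u q : faceV u q -> walls q \subset walls u.
Proof.
move=> uq; apply/fintype.subsetP => i iq; have := iq.
by rewrite !wallsE (faceV_walls uq iq).
Qed.

Lemma faceV_cellV u q : faceV u q ->
  (forall i, i \in walls u -> height i q = height i u) -> cellV q u.
Proof.
move=> uq H; split => // i; have [iu|nu] := boolP (i \in walls u).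
  by rewrite H //; exact: face_of_refl.
by apply: face_of_nint => //; rewrite -wallsE.
Qed.

Lemma cellV_walls q u : cellV q u -> walls u = walls q.
Proof.
by move=> [h1 h2]; apply/eqP; rewrite finset.eqEsubset !faceV_walls_sub.
Qed.

Lemma cellV_segment u q t : 0 < t -> t <= 1 -> faceV u q -> cellV q (u + t *: (q - u)).
Proof.
move=> t0 t1 uq; split => i; rewrite height_segment.
  exact: face_of_convex (ltW t0) t1 (uq i) (face_of_refl _).
exact: face_of_open.
Qed.

Lemma cellV_star q u t : cellV q u -> 0 <= t -> t <= 1 -> cellV q (q + t *: (u - q)).
Proof.
move=> qu t0 t1; have [->|t1'] := eqVneq t 1; first by rewrite scale1r subrKC.
have -> : q + t *: (u - q) = u + (1 - t) *: (q - u).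
  by apply/matrixP => x y; rewrite !mxE; ring.
by apply: cellV_segment; case: qu => //; rewrite ?subr_gt0 ?lt_neqAle ?t1' // gerBl.
Qed.

Lemma connected_cell q : connected (cell q).
Proof.
by apply: (connected_torus_pi (cellV_refl q)) => u t; exact: cellV_star.
Qed.

(** Every point near [u] has [u] in its closed cell, which gives one direction; for the other, the
    segment from [u + k] to [q] lies in the cell except possibly at its starting point. *)
Lemma closure_cell q u :
  closure (cell q) (pi u) <-> exists2 k, lattice k & faceV (u + k) q.
Proof.
rewrite closure_torus_pi; split=> [H|[k kl uq] B Bu].
  have [v uv /cell_pi[k kl [vq _]]] := H _ (near_faceV u).
  by exists k => //; apply: faceV_trans vq; apply/faceV_shift.
have : \forall t \near (0 : R), B (u + t *: (q - (u + k))).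
  by apply: (@continuous_line _ _ u _ 0); rewrite /= scale0r addr0.
move=> /nbhs_ballP[e /= e0 He].
pose t : R := Num.min (e / 2) 1.
have t0 : 0 < t by rewrite lt_min divr_gt0 // ltr01.
have t1 : t <= 1 by rewrite ge_min lexx orbT.
exists (u + t *: (q - (u + k))).
  apply: He; rewrite /ball /= sub0r normrN gtr0_norm //.
  by rewrite gt_min ltr_pdivrMr // ltr_pMr // ltr1n.
apply/cell_pi; exists k => //; rewrite addrAC; exact: cellV_segment.
Qed.

Lemma closure_cell_sub q q' : closure (cell q) `<=` closure (cell q') <->
  exists2 k, lattice k & faceV (q + k) q'.
Proof.
split=> [H|[k kl qq'] p].
  by apply/closure_cell/H/subset_closure; exact: cell_refl.
have [u <-] := torus_pi_surj p; move=> /closure_cell[l ll ul]; apply/closure_cell.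
exists (l + k); first by move=> i; rewrite mxE; apply: rpredD; [exact: ll|exact: kl].
by rewrite addrA; apply: faceV_trans qq'; apply/faceV_shift.
Qed.

Lemma flat_pi u J w : flat u J (pi w) <-> exists2 k, lattice k & orth J (w + k - u).
Proof.
split=> [[v uv /torus_piP vw]|[k kl H]]; first by exists (v - w) => //; rewrite subrKC.
by exists (w + k) => //; exact: torus_pi_add.
Qed.

Lemma orth0 J : orth J 0.
Proof. by move=> i _; rewrite dot0r. Qed.

Lemma orthZ J t v : orth J v -> orth J (t *: v).
Proof. by move=> H i iJ; rewrite dotZr H // mulr0. Qed.

Lemma orthD J v w : orth J v -> orth J w -> orth J (v + w).
Proof. by move=> Hv Hw i iJ; rewrite dotDr Hv // Hw // addr0. Qed.

Lemma orthN J v : orth J v -> orth J (- v).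
Proof. by move=> Hv i iJ; rewrite dotNr Hv // oppr0. Qed.

Lemma orth_sub J J' v : J \subset J' -> orth J' v -> orth J v.
Proof. by move=> /fintype.subsetP JJ' H i /JJ'; exact: H. Qed.

Lemma flat_refl u J : flat u J (pi u).
Proof. by exists u => //=; rewrite subrr; exact: orth0. Qed.

Lemma flat_rebase u J w : flat u J (pi w) -> flat w J = flat u J.
Proof.
move=> /flat_pi[k kl wk]; apply/seteqP; split => _ [v H <-]; apply/flat_pi.
  exists k => //; rewrite (_ : v + k - u = (v - w) + (w + k - u)); first exact: orthD.
  by apply/matrixP => x y; rewrite !mxE; ring.
exists (- k); first exact: latticeN.
rewrite (_ : v - k - w = (v - u) - (w + k - u)); first exact: orthD (orthN wk).
by apply/matrixP => x y; rewrite !mxE; ring.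
Qed.

Lemma flat_walls u J w : J \subset walls u -> flat u J (pi w) -> J \subset walls w.
Proof.
move=> /fintype.subsetP Ju /flat_pi[k kl H]; apply/fintype.subsetP => i iJ; rewrite wallsE.
have := H i iJ; rewrite -heightB heightD => e.
have -> : height i w = height i u - dot (al i) k by lra.
by rewrite rpredB //; [rewrite -wallsE Ju|exact: al_int].
Qed.

Lemma connected_flat u J : connected (flat u J).
Proof.
apply: (@connected_torus_pi _ _ _ u) => /=; first by rewrite subrr; exact: orth0.
by move=> w t H _ _; rewrite addrC addKr; exact: orthZ.
Qed.

Lemma cell_flat q u J : J \subset walls u -> flat u J (pi q) -> cell q `<=` flat u J.
Proof.
move=> Ju Fq; rewrite -(flat_rebase Fq); have Jq := flat_walls Ju Fq.
move=> _ [w [wq _] <-]; exists w => // i iJ; rewrite -heightB.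
by rewrite (faceV_walls wq) ?subrr // (fintype.subsetP Jq).
Qed.

Lemma supp_flat q u J : J \subset walls u -> flat u J (pi q) ->
  flat q (walls q) `<=` flat u J.
Proof.
move=> Ju Fq; rewrite -(flat_rebase Fq); have Jq := flat_walls Ju Fq.
by move=> _ [w wq <-]; exists w => //; exact: orth_sub Jq wq.
Qed.

(** Rows outside [J] are set to 0 so that these matrices have the same size for all [J]. *)
Definition wall_mx J : 'M[R]_(m, n) := \matrix_(i < m) (if i \in J then al i else 0).

Lemma orth_wall_mx J v : orth J v <-> wall_mx J *m v^T = 0.
Proof.
rewrite mulmx_tr_eq0; split=> H i; have := H i; rewrite rowK.
  move=> h; case: (boolP (i \in J)) => [/h//|_].
  by rewrite dotE big1 // => j _; rewrite mxE mul0r.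
by move=> h iJ; move: h; rewrite iJ.
Qed.

Lemma orth_sub_wall_mx J J' : (forall v, orth J v -> orth J' v) <->
  (wall_mx J' <= wall_mx J)%MS.
Proof.
split=> [H|sub v /orth_wall_mx v0].
  apply/row_subP => i; apply/negPn/negP => /dual_vector[w [w0 /eqP]]; apply.
  have /H/orth_wall_mx/mulmx_tr_eq0 := (orth_wall_mx J w).2 w0; exact.
by apply/orth_wall_mx/mulmx_tr_eq0 => i; apply: submx_dot v0; apply: submx_trans sub; exact: row_sub.
Qed.

(** Heights that are integers along a segment are constant, so the directions of segments in [F] are
    orthogonal to the normals in [J]. Conversely a basis of that orthogonal space, scaled down,
    gives segments starting at [q]. *)
Lemma toric_dimE (F : set (torus R n)) J q :
  (forall u i, F (pi u) -> i \in J -> height i u \is a Num.int) ->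
  (forall v, orth J v -> \forall t \near (0 : R), F (pi (q + t *: v))) ->
  toric_dim F = (n - \rank (wall_mx J))%N.
Proof.
move=> FJ Fq; apply/eqP; rewrite eqn_leq; apply/andP; split.
  apply/bigmax_leqP => d /asboolP[M [Mfree Mdir]].
  have : (M <= kermx (wall_mx J)^T)%MS.
    apply/sub_kermxP; apply: (can_inj trmxK); rewrite trmx_mul trmxK linear0.
    apply/row_matrixP => i; rewrite row_mul row0.
    apply: (can_inj trmxK); rewrite trmx_mul linear0; apply/row_matrixP => j.
    rewrite row0 row_mul trmxK rowK.
    have [p Hp] := Mdir j.
    case: ifP => iJ; last by rewrite linear0 mulmx0.
    suff : dot (al i) (row j M) = 0.
      move=> h; apply/matrixP => x y; rewrite !ord1 [RHS]mxE -h /dot.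
      by rewrite -[in RHS](trmxK (al i)) -trmx_mul [RHS]mxE.
    apply: int_multiples_eq0 => t t01.
    have h1 := FJ _ i (Hp t t01) iJ.
    have h2 := FJ _ i (Hp 0 _) iJ; rewrite scale0r addr0 lexx ler01 in h2.
    have := rpredB h1 (h2 isT); rewrite heightB addrC addKr dotZr; exact.
  by move/mxrankS; rewrite mxrank_ker mxrank_tr (eqP Mfree).
set K := kermx (wall_mx J)^T.
have rkK : \rank K = (n - \rank (wall_mx J))%N by rewrite /K mxrank_ker mxrank_tr.
have rowK i : orth J (row i (row_base K)).
  apply/orth_wall_mx; have : (row i (row_base K) <= K)%MS.
    by apply: submx_trans (row_sub _ _) _; rewrite eq_row_base.
  by move/sub_kermxP/(congr1 trmx); rewrite trmx_mul trmxK linear0.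
have : \forall t \near (0 : R), forall i, F (pi (q + t *: row i (row_base K))).
  by apply: near_forall => i; exact: Fq.
move=> /nbhs_ballP[e /= e0 He].
have Kn : (\rank K < n.+1)%N by rewrite ltnS rank_leq_col.
rewrite -rkK.
apply: (@leq_bigmax_cond _ _ (fun d : 'I_n.+1 => d : nat) (Ordinal Kn)).
apply/asboolP; exists ((e / 2) *: row_base K); split.
  have nz : e / 2 != 0 by rewrite gt_eqF // divr_gt0.
  rewrite /row_free; have -> := mxrank_scale_nz (row_base K) nz.
  exact: row_base_free.
move=> i; exists q => t /andP[t0 t1].
rewrite linearZ scalerA; apply: He; rewrite /ball /= sub0r normrN.
by rewrite ger0_norm ?mulr_ge0 // ?divr_ge0 ?ltW //; nra.
Qed.

Lemma dim_cell q : toric_dim (cell q) = (n - \rank (wall_mx (walls q)))%N.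
Proof.
apply: (toric_dimE (q := q)) => [u i|v vq].
  move=> /cell_pi[k kl [uq _]] iq; have := iq; rewrite wallsE -(faceV_walls uq iq).
  by rewrite heightD => h; rewrite -[height i u](addrK (dot (al i) k)) rpredB // al_int.
have : \forall t \near (0 : R), faceV q (q + t *: v).
  by apply: (@continuous_line _ _ q v 0); rewrite scale0r addr0; exact: near_faceV.
apply: filterS => t qt; exists (q + t *: v) => //; apply: cellV_sym.
apply: faceV_cellV => // i iq.
by rewrite heightD dotZr vq // mulr0 addr0.
Qed.

Lemma dim_flat u J : J \subset walls u ->
  toric_dim (flat u J) = (n - \rank (wall_mx J))%N.
Proof.
move=> Ju; apply: (toric_dimE (q := u)) => [w i /(flat_walls Ju)/fintype.subsetP Jw /Jw|v vJ].
  by rewrite wallsE.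
by apply: filterE => t; exists (u + t *: v) => //=; rewrite addrC addKr; exact: orthZ.
Qed.

Lemma dim_supp q : toric_dim (flat q (walls q)) = toric_dim (cell q).
Proof. by rewrite dim_flat // dim_cell. Qed.

(** Along [t *: v] the values of the normals in [J'] are integers for every [t], hence vanish. *)
Lemma flat_sub_orth u J J' : flat u J `<=` flat u J' ->
  forall v, orth J v -> orth J' v.
Proof.
move=> sub v vJ i iJ'; apply: int_multiples_eq0 => t _.
have /sub/flat_pi[k kl H] : flat u J (pi (u + t *: v)).
  by exists (u + t *: v) => //=; rewrite addrC addKr; exact: orthZ.
have := H i iJ'; rewrite -heightB !heightD dotZr => e.
have -> : t * dot (al i) v = - dot (al i) k by lra.
by rewrite rpredN al_int.
Qed.

Lemma flat_dim_lt u J u' J' : J \subset walls u -> J' \subset walls u' ->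
  flat u J `<=` flat u' J' -> flat u J <> flat u' J' ->
  (toric_dim (flat u J) < toric_dim (flat u' J'))%N.
Proof.
move=> Ju Ju' sub; have Fu := sub _ (flat_refl u J).
have J'u := flat_walls Ju' Fu; rewrite -(flat_rebase Fu) in sub *.
have /orth_sub_wall_mx mxsub := flat_sub_orth sub.
rewrite !dim_flat // ltnNge => ne; apply/negP => le; apply: ne.
have rk := rank_leq_col (wall_mx J); have rk' := rank_leq_col (wall_mx J').
have : (wall_mx J <= wall_mx J')%MS.
  by rewrite -(geq_leqif (mxrank_leqif_sup mxsub)); lia.
move=> /orth_sub_wall_mx H; apply/seteqP; split => // _ [w wJ <-].
by exists w => //; exact: H.
Qed.

(** With equal dimensions the walls of [q] and [q'] would have the same span. Then [q' - q], being
    orthogonal to the walls of [q'], would preserve the heights at all walls of [q]. *)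
Lemma cell_dim_lt q q' : closure (cell q) `<=` closure (cell q') ->
  cell q <> cell q' -> (toric_dim (cell q) < toric_dim (cell q'))%N.
Proof.
move=> /closure_cell_sub[k kl]; rewrite -(cell_shift q kl); move: (q + k) => {kl k q} q qq'.
have wsub := faceV_walls_sub qq'.
have vq' : orth (walls q') (q' - q).
  by move=> i iq'; rewrite -heightB (faceV_walls qq' iq') subrr.
rewrite !dim_cell ltnNge => ne; apply/negP => le; apply: ne; apply/esym/cellV_cell.
apply: faceV_cellV => // i iq; apply/eqP; rewrite -subr_eq0 heightB.
have mxsub : (wall_mx (walls q') <= wall_mx (walls q))%MS.
  by apply/orth_sub_wall_mx => v; exact: orth_sub.
have rk := rank_leq_col (wall_mx (walls q)); have rk' := rank_leq_col (wall_mx (walls q')).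
have : (wall_mx (walls q) <= wall_mx (walls q'))%MS.
  by rewrite -(geq_leqif (mxrank_leqif_sup mxsub)); lia.
by move=> /orth_sub_wall_mx /(_ _ vq') /(_ i iq) ->.
Qed.

Variables (A : set (set (torus R n))) (H : 'I_m -> set (torus R n)).
Hypothesis AH : forall X, A X <-> exists i, X = H i.
Hypothesis H_inj : injective H.
Hypothesis HE : forall i u, H i (pi u) <-> height i u \is a Num.int.

Lemma component_stratum (S : set (set (torus R n))) q : stratum A S (pi q) ->
  connected_component (stratum A S) (pi q) = cell q.
Proof.
move=> Sq; apply: component_torus_pi.
- exact: cell_refl.
- move=> _ [u /cellV_walls uq <-] X AX; rewrite -(Sq X AX).
  by move/AH: AX => [i ->]; rewrite !HE -!wallsE uq.
- exact: connected_cell.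
move=> u Su; apply: filterS (near_faceV u) => u' uu' Su'.
have : cellV u u'.
  apply: cellV_sym; apply: faceV_cellV => // i iu; apply/esym.
  have AHi : A (H i) by apply/AH; exists i.
  apply: face_of_int (uu' i) _; apply/HE/(Su' _ AHi)/(Su _ AHi)/HE.
  by rewrite -wallsE.
move=> cuu'; split=> /cell_eq <-; rewrite -?(cellV_cell cuu'); first by rewrite (cellV_cell cuu'); exact: cell_refl.
exact: cell_refl.
Qed.

Lemma toric_cellsP e : toric_cells A e <-> exists q, e = cell q.
Proof.
split=> [[S SA [p Sp <-]]|[q ->]].
  have [q e'] := torus_pi_surj p; rewrite -e' in Sp *.
  by exists q; exact: component_stratum.
exists [set X | A X /\ X (pi q)]; first by move=> X [].
have Sq : stratum A [set X | A X /\ X (pi q)] (pi q).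
  by move=> X AX; split => // -[].
by exists (pi q) => //; exact: component_stratum.
Qed.

(** Two nearby points at which the heights in [J] are integers differ by a vector orthogonal to [J],
    so membership in a flat is locally constant on the intersection. *)
Lemma component_flat (S : set (set (torus R n))) u : S `<=` A ->
  (\bigcap_(X in S) X) (pi u) ->
  let J := [set i | `[< S (H i) >]]%SET in
  J \subset walls u /\ connected_component (\bigcap_(X in S) X) (pi u) = flat u J.
Proof.
move=> SA Su J.
have capE w : (\bigcap_(X in S) X) (pi w) <-> J \subset walls w.
  split=> [Sw|/fintype.subsetP Jw X SX].
    by apply/fintype.subsetP => i; rewrite inE wallsE => /asboolP /Sw /HE.
  have /AH[i e] := SA _ SX; rewrite e; apply/HE; rewrite -wallsE Jw // inE.
  by apply/asboolP; rewrite -e.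
have Ju : J \subset walls u by apply/capE.
split=> //; apply: component_torus_pi.
- exact: flat_refl.
- move=> p; have [w <-] := torus_pi_surj p; move=> /(flat_walls Ju) Jw.
  exact/capE.
- exact: connected_flat.
move=> w /capE Jw; apply: filterS (near_faceV w) => w' ww' /capE Jw'.
have ow : orth J (w' - w).
  move=> i iJ; rewrite -heightB (face_of_int (ww' i)) ?subrr //.
  by rewrite -wallsE (fintype.subsetP Jw').
split=> /flat_pi[k kl Hk]; apply/flat_pi; exists k => //.
  rewrite (_ : w' + k - u = (w' - w) + (w + k - u)); first exact: orthD.
  by apply/matrixP => x y; rewrite !mxE; ring.
rewrite (_ : w + k - u = (w' + k - u) - (w' - w)); first exact: orthD (orthN ow).
by rewrite opprB; apply/matrixP => x y; rewrite !mxE; ring.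
Qed.

Lemma toric_flatsP x : toric_flats A x <->
  exists u J, J \subset walls u /\ x = flat u J.
Proof.
split=> [[S SA [p Sp <-]]|[u [J [Ju ->]]]].
  have [u e] := torus_pi_surj p; rewrite -e in Sp *.
  by have [Ju ->] := component_flat SA Sp; exists u; eexists; split; first exact: Ju.
pose S : set (set (torus R n)) := [set X | exists2 i, i \in J & X = H i].
have SA : S `<=` A by move=> X [i _ ->]; apply/AH; exists i.
have Su : (\bigcap_(X in S) X) (pi u).
  by move=> X [i iJ ->]; apply/HE; rewrite -wallsE (fintype.subsetP Ju).
exists S => //; exists (pi u) => //.
have [J'u ->] := component_flat SA Su.
congr flat; apply/finset.setP => i; rewrite inE; apply/asboolP/idP => [[j jJ /H_inj ->]//|iJ].
by exists i.
Qed.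

End Arrangement.

(** * Consequences of regularity *)

Section Regular.
Variables (R : realType) (n m : nat).
Variables (al : 'I_m -> 'rV[R]_n) (be : 'I_m -> R).
Hypothesis al_int : forall i k, lattice k -> dot (al i) k \is a Num.int.
Local Notation pi := (@torus_pi R n).
Local Notation cell := (cell al be).
Local Notation cellV := (cellV al be).
Local Notation faceV := (faceV al be).
Local Notation walls := (walls al be).
Implicit Types (u v w k q : 'rV[R]_n).
Variables (A : set (set (torus R n))) (H : 'I_m -> set (torus R n)).
Hypothesis AH : forall X, A X <-> exists i, X = H i.
Hypothesis HE : forall i u, H i (pi u) <-> height al be i u \is a Num.int.
Hypothesis regA : regular_cell_complex R (toric_cells A) (@toric_dim R n).

Lemma toric_cell q : toric_cells A (cell q).
Proof. by apply/(toric_cellsP al_int AH HE); exists q. Qed.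

(* A cell of minimal dimension is closed, whereas an open ball of positive
   dimension is not a closed ball. *)
Lemma exists_vertex : exists q, toric_dim (cell q) = 0%N.
Proof.
pose P d := `[< exists q, toric_dim (cell q) = d >].
have exP : exists d, P d by exists (toric_dim (cell 0)); apply/asboolP; exists 0.
case: (ex_minnP exP) => d /asboolP[q dq] dmin; exists q.
have [_ _ _ homeo bound] := regA.
have clq : closure (cell q) = cell q.
  apply/seteqP; split; last exact: subset_closure.
  move=> p clp; apply: contrapT => np.
  have [D DD] := bound _ (toric_cell q) => e.
  have : (closure (cell q) `\` cell q) p by split.
  rewrite e => -[e' /DD[/(toric_cellsP al_int AH HE)[q' ->] lt] _].
  have : (d <= toric_dim (cell q'))%N by apply: dmin; apply/asboolP; exists q'.
  by rewrite -dq leqNgt lt.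
have [f [[g [fB gf _ _]] fO]] := homeo _ (toric_cell q).
apply/eqP; rewrite -leqn0 leqNgt; apply/negP => d0.
have [y By nOy] := closed_ball_rV_boundary R d0.
have : cell q (f y) by rewrite -clq -fB; exists y.
rewrite -{1}fO => -[y' Oy' e]; apply: nOy.
by rewrite -(gf y By) -e gf //; exact: open_ball_rV_closed.
Qed.

Lemma essential v : (forall i, dot (al i) v = 0) -> v = 0.
Proof.
move=> v0; have [q dq] := exists_vertex.
have rk : \rank (wall_mx al (walls q)) = n.
  have := rank_leq_col (wall_mx al (walls q)).
  by have := dim_cell be al_int q; rewrite dq; lia.
have : wall_mx al (walls q) *m v^T = 0 by apply/orth_wall_mx => i _.
have /row_fullP[B BM] : row_full (wall_mx al (walls q)) by rewrite /row_full rk.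
move=> /(congr1 (mulmx B)); rewrite mulmxA BM mul1mx mulmx0 => /(congr1 trmx).
by rewrite trmxK linear0.
Qed.

(** Both points have the same floors and ceilings of heights, so every normal takes the integer
    value 0 on [k]; the normals span. *)
Lemma cellV_lattice q u k : lattice k -> cellV q u -> cellV q (u + k) -> k = 0.
Proof.
move=> kl [h1 h2] [h3 h4]; apply: essential => i.
have kint := al_int i kl.
have uk : face_of (height al be i u) (height al be i (u + k)).
  exact: face_of_trans (h1 i) (h4 i).
have ku : face_of (height al be i (u + k)) (height al be i u).
  exact: face_of_trans (h3 i) (h2 i).
apply/eqP/negPn/negP => k0; have := norm_intr_ge1 kint k0.
move: uk ku; rewrite heightD; move: kint k0; move: (dot _ k) (height _ _ _ _) => c x.
move=> cint c0 [+ +] [+ +]; rewrite flD // clD // => a1 a2 a3 a4.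
have fc : (fl c)%:~R = c by apply/eqP; rewrite -int_fl.
have : fl c = 0 by lia.
by move=> e; move: c0; rewrite -fc e eqxx.
Qed.

(** Otherwise the cell would approach [pi u] along two sheets, one near [u] and one near [u + k].
    The part of the open ball near the preimage of [pi u] is convex, so its image is connected and
    must stay in one sheet. *)
Lemma torus_pi_inj_closed_cell q u k :
  lattice k -> faceV u q -> faceV (u + k) q -> k = 0.
Proof.
move=> kl uq ukq.
have [_ _ _ /(_ _ (toric_cell q))[f [[g [fB gf cf cg]] fO]] _] := regA.
have clu : closure (cell q) (pi u).
  by apply/(closure_cell be al_int); exists 0; [move=> i; rewrite mxE rpred0|rewrite addr0].
(* The radius only has to be so small that two points of [Bu] never differ by a nonzero lattice
   vector. *)
have e8 : (0 : R) < 1 / 8 by rewrite divr_gt0.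
pose Bu := [set w : 'rV[R]_n | `|w - u| < 1 / 8].
have oB : open Bu.
  have -> : Bu = ball u (1 / 8).
    by apply/seteqP; split => w; rewrite -ball_normE /= /Bu /= distrC.
  exact: ball_open.
have Buu : Bu u by rewrite /Bu /= subrr normr0.
have close w w' l : lattice l -> w = w' + l -> Bu w -> Bu w' -> w = w'.
  move=> ll -> h1 h2; rewrite (lattice_small ll) ?addr0 //.
  have -> : l = (w' + l - u) - (w' - u) by apply/matrixP => x y; rewrite !mxE; ring.
  apply: le_lt_trans (ler_normB _ _) _; rewrite /Bu /= in h1 h2; lra.
pose V := pi @` Bu.
have oV : open V by exact: open_torus_pi.
(* [Y] is the sheet of the cell near [u]; it is shown to be locally constant inside [X]. *)
pose X := cell q `&` V; pose Y := pi @` (Bu `&` cellV q).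
have near_same w : X (pi w) -> \forall w' \near w, X (pi w') -> cellV w w'.
  move=> [/cell_pi[l ll wq] _]; apply: filterS (near_faceV al be w) => w' ww'.
  move=> [/cell_pi[l' ll' wq'] _]; apply: cellV_sym.
  apply: faceV_cellV => // i iw; apply/esym; apply: face_of_int (ww' i) _.
  have shiftw z j : lattice j -> cellV q (z + j) -> (i \in walls z) = (i \in walls q).
    move=> jl /cellV_walls <-; rewrite !wallsE heightD.
    by rewrite [RHS]rpredDr //; exact: al_int.
  by rewrite -wallsE (shiftw _ _ ll' wq') -(shiftw _ _ ll wq).
have loc w : X (pi w) ->
    \forall w' \near w, X (pi w') -> (Y (pi w) <-> Y (pi w')).
  move=> Xw; have [_ [b Bb /torus_piP bw]] := Xw.
  pose l := b - w; have Bl : Bu (w + l) by rewrite /l subrKC.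
  have nB : \forall w' \near w, Bu (w' + l).
    by apply: (@continuous_add_const _ _ l w Bu); apply: open_nbhs_nbhs.
  apply: filterS2 (near_same w Xw) nB => w' same Bw' Xw'.
  have cww' := same Xw'.
  have YE z : Bu (z + l) -> Y (pi z) <-> cellV q (z + l).
    move=> Bz; split=> [[c [Bc qc] /torus_piP cz]|qz]; last first.
      by exists (z + l); [split|exact: torus_pi_add].
    suff <- : c = z + l by [].
    apply: (close _ _ (c - (z + l))) => //; last by rewrite subrKC.
    have -> : c - (z + l) = (c - z) - l by rewrite opprD addrA.
    by move=> i; rewrite mxE rpredD ?rpredN //; rewrite mxE rpredN; exact: bw.
  rewrite !YE //; have cl := (cellV_shift be al_int w' w bw).2 cww'.
  by split=> h; [exact: cellV_trans h cl|exact: cellV_trans h (cellV_sym cl)].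
pose y0 := g (pi u).
have [y0' By0' fy0'] : (f @` closed_ball_rV (R := R) (d := toric_dim (cell q))) (pi u).
  by rewrite fB.
have y0E : y0 = y0' by rewrite /y0 -fy0' gf.
have nV : nbhs (f y0) V by rewrite y0E fy0'; apply: open_nbhs_nbhs; split => //; exists u.
have By0 : closed_ball_rV y0 by rewrite y0E.
have [dl dl0 Hdl] : exists2 dl : R, 0 < dl &
    forall y, closed_ball_rV y -> `|y - y0| < dl -> V (f y).
  have /nbhs_ballP[dl /= dl0 Hdl] : nbhs y0 [set y | closed_ball_rV y -> V (f y)].
    exact ((subspace_continuousP _ _).1 cf y0 By0 V nV).
  exists dl => // y By yd; apply: (Hdl y _ By).
  by rewrite -ball_normE /= distrC.
pose C := [set y : 'rV[R]_(toric_dim (cell q)) | open_ball_rV y /\ `|y - y0| < dl].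
have cC : connected C.
  apply: convex_connected => x y t [Ox xd] [Oy yd] t0 t1; split.
    exact: open_ball_rV_convex.
  have -> : x + t *: (y - x) - y0 = (1 - t) *: (x - y0) + t *: (y - y0).
    by apply/matrixP => a b; rewrite !mxE; ring.
  apply: le_lt_trans (ler_normD _ _) _; rewrite !normrZ !ger0_norm ?subr_ge0 //.
  have [t1'|t1'] := ltP t 1; last first.
    by rewrite (_ : t = 1); lra.
  have h1 : 0 < (1 - t) * (dl - `|x - y0|) by rewrite mulr_gt0 ?subr_gt0.
  have h2 : 0 <= t * (dl - `|y - y0|) by rewrite mulr_ge0 // subr_ge0 ltW.
  by lra.
have CB : C `<=` closed_ball_rV (R := R) (d := toric_dim (cell q)).
  by move=> y [/open_ball_rV_closed].
have cW : connected (f @` C).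
  by apply: connected_continuous_connected => //; exact: continuous_subspaceW cf.
have WX : f @` C `<=` X.
  move=> _ [y [Oy yd] <-]; split; first by rewrite -fO; exists y.
  by apply: Hdl => //; exact: open_ball_rV_closed.
(* Used for [j = 0] and [j = k]: points close to [u + j] on the segment towards [q] lie in the cell
   and project into the image of [C]. *)
have approach j : lattice j -> faceV (u + j) q ->
    exists2 z, cellV q z & Bu (z - j) /\ (f @` C) (pi z).
  move=> jl ujq; have piuj := torus_pi_add u jl.
  have ndl : nbhs y0 [set y : 'rV[R]_(toric_dim (cell q)) | `|y - y0| < dl].
    apply/nbhs_ballP; exists dl => // y; by rewrite -ball_normE /= distrC.
  have npi : \forall w \near u + j, closure (cell q) (pi w) -> `|g (pi w) - y0| < dl.
    apply: (nbhs_torus_pi (u + j)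
      [set p | closure (cell q) p -> `|g p - y0| < dl]).1; rewrite piuj.
    exact ((subspace_continuousP _ _).1 cg (pi u) clu _ ndl).
  have nBu : \forall w \near u + j, Bu (w - j).
    by apply: (@continuous_add_const _ _ (- j) (u + j) Bu); rewrite addrK; apply: open_nbhs_nbhs.
  pose P := [set w | (closure (cell q) (pi w) -> `|g (pi w) - y0| < dl) /\ Bu (w - j)].
  have nP : nbhs (u + j) P by apply: filterI; [exact: npi|exact: nBu].
  have nP0 : nbhs (u + j + 0 *: (q - (u + j))) P by rewrite scale0r addr0.
  have line : \forall t \near (0 : R), P (u + j + t *: (q - (u + j))).
    exact (@continuous_line R n (u + j) (q - (u + j)) 0 P nP0).
  move/nbhs_ballP: line => [e /= e0 He].
  pose t : R := Num.min (e / 2) 1.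
  have t0 : 0 < t by rewrite lt_min divr_gt0 // ltr01.
  have t1 : t <= 1 by rewrite ge_min lexx orbT.
  have [gz Bz] : (closure (cell q) (pi (u + j + t *: (q - (u + j)))) ->
      `|g (pi (u + j + t *: (q - (u + j)))) - y0| < dl) /\
      Bu (u + j + t *: (q - (u + j)) - j).
    apply: He; rewrite /ball /= sub0r normrN gtr0_norm //.
    by rewrite gt_min ltr_pdivrMr // ltr_pMr // ltr1n.
  have qz := cellV_segment t0 t1 ujq.
  exists (u + j + t *: (q - (u + j))) => //; split => //.
  have cz : cell q (pi (u + j + t *: (q - (u + j)))) by eexists; first exact: qz.
  have : (f @` open_ball_rV (R := R) (d := toric_dim (cell q)))
     (pi (u + j + t *: (q - (u + j)))) by rewrite fO.
  move=> [y Oy fy]; exists y => //; split => //.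
  have <- : g (pi (u + j + t *: (q - (u + j)))) = y.
    by rewrite -fy gf //; exact: open_ball_rV_closed.
  by apply: gz; exact: subset_closure.
have l0 : lattice (0 : 'rV[R]_n) by move=> i; rewrite mxE rpred0.
have u0 : faceV (u + 0) q by rewrite addr0.
have [z qz [Bz Wz]] := approach 0 l0 u0.
have Yz : Y (pi z) by exists z => //; split => //; rewrite subr0 in Bz.
have WY := connected_locally_constant cW WX Wz Yz loc.
(* The point found near [u + k] projects into the sheet of [u], so the cell upstairs contains both
   [c] and [c + k]. *)
have [z' qz' [Bz' Wz']] := approach k kl ukq.
have [c [Bc qc] /torus_piP cz] := WY _ Wz'.
have e : c = z' - k.
  apply: (close _ _ (c - (z' - k))) => //; last by rewrite subrKC.
  have -> : c - (z' - k) = (c - z') + k by rewrite opprB addrA addrAC.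
  by move=> i; rewrite mxE rpredD //; exact: kl.
apply: (cellV_lattice kl qc); rewrite e subrK //.
Qed.

End Regular.

(** * Local and global Euler relations *)

Section GenericForm.
Variables (R : realFieldType) (n : nat).

Lemma dotC (v w : 'rV[R]_n) : dot v w = dot w v.
Proof. by rewrite !dotE; apply: eq_bigr => i _; rewrite mulrC. Qed.

Lemma dot_eq0 (v : 'rV[R]_n) : dot v v = 0 -> v = 0.
Proof.
rewrite dotE => /eqP; rewrite psumr_eq0 => [/allP H|i _]; last by rewrite -expr2 sqr_ge0.
apply/matrixP => x i; rewrite ord1 [RHS]mxE; apply/eqP.
by have := H i (mem_index_enum _); rewrite /= mulf_eq0 orbb.
Qed.

(** A form that vanishes on the new vector [v] is moved slightly along [v]; the other conditions are
    strict and survive. *)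
Lemma generic_form (vs : seq 'rV[R]_n) : (forall v, v \in vs -> v != 0) ->
  exists l, forall v, v \in vs -> dot v l != 0.
Proof.
elim: vs => [|v vs IH] nz; first by exists 0.
have [l Hl] : exists l, forall v, v \in vs -> dot v l != 0.
  by apply: IH => w wvs; apply: nz; rewrite inE wvs orbT.
have [vl|vl] := eqVneq (dot v l) 0; last first.
  by exists l => w; rewrite inE => /predU1P[->//|]; exact: Hl.
pose cs := [seq (w, sgn (dot w l)) | w <- vs].
have sl : sat l cs by apply/allP => _ /mapP[w _ ->] /=.
have cs0 : zero_span cs *m v^T = 0.
  have /submx0null -> : (zero_span cs <= (0 : 'M[R]_n))%MS; last by rewrite mul0mx.
  apply/zero_span_sub => a /mapP[w wvs [_ /esym/eqP]].
  by rewrite sgn_None (negbTE (Hl w wvs)).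
have [e e0 He] := sat_perturb sl cs0.
exists (l + e *: v) => w; rewrite inE => /predU1P[->|wvs].
  rewrite dotDr dotZr vl add0r; apply: mulf_neq0; first by rewrite gt_eqF.
  by apply/eqP => /dot_eq0 v0; have := nz v (mem_head _ _); rewrite v0 eqxx.
have se : sat (l + e *: v) cs by apply: He; rewrite gtr0_norm.
have := allP se (w, sgn (dot w l)) (map_f _ wvs).
by move=> /= /eqP h; rewrite -sgn_None h sgn_None; exact: Hl.
Qed.

End GenericForm.

Section UnitIntervalsMore.
Variable R : realType.

Lemma sgn_cell (x y y' : R) : x \is a Num.int -> face_of y y' -> face_of y' y ->
  sgn (y - x) = sgn (y' - x).
Proof.
move=> xint [h1 h2] [h3 h4].
have Fx : (fl x)%:~R = x by apply/eqP; rewrite -int_fl.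
have E1 : (x < y) = (x < y').
  by rewrite -[in LHS]Fx -[in RHS]Fx -!cl_gt; have -> : cl y = cl y' by lia.
have E2 : (y < x) = (y' < x).
  by rewrite -[in LHS]Fx -[in RHS]Fx -!fl_lt; have -> : fl y = fl y' by lia.
rewrite /sgn !subr_eq0 !subr_gt0 E1.
by case: (ltgtP y x) E1 E2; case: (ltgtP y' x).
Qed.

(** An integer in a closed interval of the subdivision is one of its end points, and a midpoint can
    be an end point only if both points coincide with it. *)
Lemma face_of_midpoint (x1 x2 y : R) : face_of x1 y -> face_of x2 y ->
  x1 + 2^-1 * (x2 - x1) \is a Num.int -> x1 = x2.
Proof.
move=> f1 f2; set z := _ + _ => zint.
have Fz : (fl z)%:~R = z by apply/eqP; rewrite -int_fl.
have fz : face_of z y by apply: face_of_convex; rewrite ?invr_ge0 ?invf_le1 ?ler1n.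
move: f1 f2 fz => /face_ofE[a1 a2] /face_ofE[b1 b2] [c1 c2].
have zE : z = x1 + 2^-1 * (x2 - x1) by [].
have zc : cl z = fl z by apply/eqP; rewrite -int_ceil.
have [_ yc] := floor_ceil y.
have [e|e] : fl z = fl y \/ fl z = cl y by lia.
  by rewrite e in Fz; lra.
by rewrite e in Fz; lra.
Qed.

End UnitIntervalsMore.

Section Star.
Variables (R : realType) (n m : nat).
Variables (al : 'I_m -> 'rV[R]_n) (be : 'I_m -> R).
Hypothesis al_int : forall i k, lattice k -> dot (al i) k \is a Num.int.
Local Notation pi := (@torus_pi R n).
Local Notation cell := (cell al be).
Local Notation cellV := (cellV al be).
Local Notation faceV := (faceV al be).
Local Notation walls := (walls al be).
Local Notation height := (height al be).
Local Notation flat := (flat al).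
Local Notation orth := (orth al).
Local Notation wall_mx := (wall_mx al).
Implicit Types (u v w k q : 'rV[R]_n) (J : {set 'I_m}).
Hypothesis ess : forall v, (forall i, dot (al i) v = 0) -> v = 0.
Hypothesis injc : forall q u k, lattice k -> faceV u q -> faceV (u + k) q -> k = 0.
Variables (ce : seq {classic set (torus R n)}) (K : pzRingType).
Hypothesis ce_uniq : uniq ce.
Hypothesis ceP : forall e, e \in ce <-> exists q, e = cell q.

(** One point of the cell in the cone suffices: a condition of [cs] that is not a wall, such as a
    generic form, may change sign along a cell. *)
Definition star_of u cs (G : set (torus R n)) : Prop :=
  exists q, [/\ G = cell q, faceV u q & sat (q - u) cs].

(** Injectivity on closed cells enters here: it identifies the star of a point of the torus with the
    star upstairs. *)
Lemma star_cellV u q q' : faceV u q -> faceV u q' -> cell q = cell q' -> cellV q q'.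
Proof.
move=> uq uq' /cell_inj[k kl qk].
have uk : faceV (u + k) q.
  by apply: faceV_trans qk.1; apply/(faceV_shift be al_int).
by have k0 := injc kl uq uk; move: qk; rewrite k0 addr0.
Qed.

Lemma small_step u v : exists2 t : R, 0 < t & faceV u (u + t *: v).
Proof.
have nP0 : nbhs (u + 0 *: v) (faceV u) by rewrite scale0r addr0; exact: near_faceV.
have line : \forall t \near (0 : R), faceV u (u + t *: v).
  exact (@continuous_line R n u v 0 (faceV u) nP0).
move/nbhs_ballP: line => [e /= e0 He].
exists (e / 2); first by rewrite divr_gt0.
apply: He; rewrite /ball /= sub0r normrN gtr0_norm ?divr_gt0 //.
by rewrite ltr_pdivrMr // ltr_pMr // ltr1n.
Qed.

Lemma wall_mx_row J i : i \in J -> (al i <= wall_mx J)%MS.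
Proof.
by move=> iJ; have := row_sub i (wall_mx J); rewrite rowK iJ.
Qed.

Lemma wall_mx_sub J p (M : 'M[R]_(p, n)) :
  (forall i, i \in J -> (al i <= M)%MS) -> (wall_mx J <= M)%MS.
Proof.
by move=> HJ; apply/row_subP => i; rewrite rowK; case: ifP => [/HJ//|_]; exact: sub0mx.
Qed.

(** Induction over the walls whose sign is not yet prescribed; prescribing one cuts the cone as in
    [chi_cut]. Once all walls have signs, at most one cell is left, and it has the dimension of the
    cone because extra strict inequalities do not lower it. *)
Lemma star_sum_rec u (is_ : seq 'I_m) cs :
  (forall a, (a, None) \in cs -> exists2 i, i \in walls u & a = al i) ->
  {subset is_ <= walls u} ->
  (forall i, i \in walls u -> i \in is_ \/ exists s, (al i, s) \in cs) ->
  \sum_(G <- ce | `[< star_of u cs G >]) (-1) ^+ toric_dim G = chi K cs.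
Proof.
elim: is_ cs => [|i is_ IH] cs cs0 sub all_cs.
  have [[v sv]|nex] := pselect (exists v, sat v cs); last first.
    rewrite /chi asboolF // big_pred0 // => G; apply/asboolP => -[q [_ _ sq]].
    by apply: nex; exists (q - u).
  have [t t0 ut] := small_step u v; pose q := u + t *: v.
  have sq : sat (q - u) cs by rewrite /q addrC addKr sat_scale.
  have star1 G : star_of u cs G -> G = cell q.
    move=> [q' [-> uq' sq']]; apply: cellV_cell.
    have same p p' : faceV u p -> faceV u p' -> sat (p - u) cs -> sat (p' - u) cs ->
        faceV p p'.
      move=> up up' /allP sp /allP sp' i; have [iu|niu] := boolP (i \in walls u).
        have [//|[s /[dup] /sp + /sp']] := all_cs i iu.
        rewrite /= -!(heightB _ be) => /eqP e1 /eqP e2.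
        by apply: face_of_sgn (up i) (up' i) _; rewrite -?wallsE // e1 e2.
      apply: face_of_trans (up' i); apply: face_of_nint (up i) _.
      by rewrite -wallsE.
    by split; apply: same.
  have qce : (cell q : {classic set (torus R n)}) \in ce by apply/ceP; exists q.
  rewrite big_mkcond (bigD1_seq (cell q)) //= asboolT; last by exists q; split.
  rewrite big1 ?addr0 => [|G /eqP nG]; last by case: asboolP => // /star1.
  rewrite /chi asboolT; last by exists v.
  rewrite (dim_cell be al_int); congr (_ ^+ (n - _)).
  apply/eqP; rewrite eqn_leq; apply/andP; split; apply: mxrankS.
    apply: wall_mx_sub => i iq; apply: mem_zero_span.
    have iu : i \in walls u by apply: fintype.subsetP iq; exact: faceV_walls_sub.
    have [//|[s ics]] := all_cs i iu.
    have := allP sq _ ics; rewrite /= -(heightB _ be) (faceV_walls ut iq) subrr.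
    by rewrite /sgn eqxx => /eqP ->.
  apply/zero_span_sub => a acs; have [i iu e] := cs0 a acs.
  rewrite e; apply: wall_mx_row; have := allP sq _ acs; rewrite /= sgn_None e.
  by rewrite -(heightB _ be) subr_eq0 => /eqP iE; rewrite wallsE iE -wallsE.
have iu : i \in walls u by apply: sub; rewrite mem_head.
have IHs s : \sum_(G <- ce | `[< star_of u ((al i, s) :: cs) G >]) (-1) ^+ toric_dim G =
    chi K ((al i, s) :: cs).
  apply: IH => [a|j jis|j ju].
  - by rewrite inE => /predU1P[[-> _]|/cs0//]; exists i.
  - by apply: sub; rewrite inE jis orbT.
  - have [|[s' js']] := all_cs j ju; last by right; exists s'; rewrite inE js' orbT.
    by rewrite inE => /predU1P[->|]; [right; exists s; rewrite mem_head|left].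
rewrite (chi_cut K cs (al i)) -!IHs !(big_mkcond (fun G => `[< _ >])) -!big_split /=.
apply: eq_bigr => G _.
have [[q [GE uq sq]]|nst] := pselect (star_of u cs G); last first.
  rewrite !asboolF ?addr0 //.
  - by move=> [q [GE uq /andP[_ sq]]]; apply: nst; exists q.
  - by move=> [q [GE uq /andP[_ sq]]]; apply: nst; exists q.
  - by move=> [q [GE uq /andP[_ sq]]]; apply: nst; exists q.
rewrite asboolT; last by exists q.
pose s0 := sgn (dot (al i) (q - u)).
(* The sign at a wall through [u] is constant on a cell, so the cell goes to exactly one of the
   three pieces. *)
have starE s : `[< star_of u ((al i, s) :: cs) G >] = (s == s0).
  apply/asboolP/eqP => [[q' [GE' uq' /andP[/eqP /= <- _]]]|->]; last first.
    by exists q; split => //; rewrite /= eqxx.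
  have [h1 h2] : cellV q q' by apply: star_cellV uq uq' _; rewrite -GE.
  rewrite /s0 /= -!(heightB _ be); apply: sgn_cell (h1 i) (h2 i).
  by rewrite -wallsE.
by rewrite !starE; case: s0 {starE} => [[]|] /=; rewrite ?addr0 ?add0r.
Qed.

Lemma star_sum u cs :
  (forall a, (a, None) \in cs -> exists2 i, i \in walls u & a = al i) ->
  \sum_(G <- ce | `[< star_of u cs G >]) (-1) ^+ toric_dim G = chi K cs.
Proof.
move=> cs0; apply: (star_sum_rec (is_ := enum (walls u))) => //.
  by move=> i; rewrite mem_enum.
by move=> i iu; left; rewrite mem_enum.
Qed.

(** A chosen point of the cell; 0 is the default for sets that are not cells. *)
Definition cell_rep (G : set (torus R n)) : 'rV[R]_n := xget 0 [set q | G = cell q].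

Lemma cell_repE G : G \in ce -> G = cell (cell_rep G).
Proof. by move=> /ceP; exact: (@xgetPex _ 0 [set q | G = cell q]). Qed.

Definition supp G : set (torus R n) := flat (cell_rep G) (walls (cell_rep G)).

Definition flat_cs J : seq ('rV[R]_n * option bool) := [seq (al i, None) | i <- enum J].

Lemma flat_csP u J : J \subset walls u ->
  forall a, (a, None) \in flat_cs J -> exists2 i, i \in walls u & a = al i.
Proof.
by move=> Ju a /mapP[i]; rewrite mem_enum => iJ [->]; exists i => //; exact: fintype.subsetP iJ.
Qed.

Lemma sat_flat_cs v J : sat v (flat_cs J) <-> orth J v.
Proof.
split=> [/allP sv i iJ|vJ].
  have /sv : (al i, None) \in flat_cs J by apply/mapP; exists i; rewrite ?mem_enum.
  by rewrite /= sgn_None => /eqP.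
by apply/allP => _ /mapP[i + ->]; rewrite mem_enum => iJ /=; rewrite sgn_None vJ.
Qed.

Lemma rank_flat_cs J : \rank (zero_span (flat_cs J)) = \rank (wall_mx J).
Proof.
apply/eqP; rewrite eqn_leq; apply/andP; split; apply: mxrankS.
  apply/zero_span_sub => a /mapP[i]; rewrite mem_enum => iJ [->].
  exact: wall_mx_row.
by apply: wall_mx_sub => i iJ; apply: mem_zero_span; apply/mapP; exists i; rewrite ?mem_enum.
Qed.

Lemma supp_sub G q u J : G \in ce -> G = cell q -> J \subset walls u ->
  supp G `<=` flat u J <-> flat u J (pi q).
Proof.
move=> Gce GE Ju; have GR := cell_repE Gce; split=> [sub|Fq].
  have Fr := sub _ (flat_refl al (cell_rep G) _).
  by apply: (cell_flat al_int Ju Fr); rewrite -GR GE; exact: cell_refl.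
apply: (supp_flat al_int Ju); apply: (cell_flat al_int Ju Fq).
by rewrite -GE {1}GR; exact: cell_refl.
Qed.

Lemma face_flat_orth u q J : J \subset walls u -> faceV u q -> flat u J (pi q) ->
  orth J (q - u).
Proof.
move=> Ju uq Fq i iJ; have := flat_walls al_int Ju Fq => /fintype.subsetP /(_ i iJ) iq.
by rewrite -(heightB _ be) (faceV_walls uq iq) subrr.
Qed.

Lemma orth_flat u q J : orth J (q - u) -> flat u J (pi q).
Proof. by exists q. Qed.

Lemma closure_star u G : G \in ce ->
  closure (cell u) `<=` closure G <-> exists2 q, G = cell q & faceV u q.
Proof.
move=> /cell_repE GR; split=> [|[q -> uq]]; last first.
  by apply/(closure_cell_sub be al_int); exists 0; [move=> i; rewrite mxE rpred0|rewrite addr0].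
rewrite {1}GR => /(closure_cell_sub be al_int)[k kl uk].
exists (cell_rep G - k); first by rewrite (cell_shift be al_int _ (latticeN kl)).
by apply: (faceV_shift be al_int u (cell_rep G - k) kl).1; rewrite subrK.
Qed.

Lemma star_flat u J cs G : J \subset walls u -> G \in ce ->
  star_of u (cs ++ flat_cs J) G <-> star_of u cs G /\ supp G `<=` flat u J.
Proof.
move=> Ju Gce; rewrite /star_of /sat; split.
  move=> [q [GE uq]]; rewrite all_cat => /andP[sq /sat_flat_cs qJ]; split.
    by exists q.
  by apply/(supp_sub Gce GE Ju); exact: orth_flat.
move=> [[q [GE uq sq]] sub]; exists q; split => //; rewrite all_cat sq /=.
by apply/sat_flat_cs/face_flat_orth => //; apply/(supp_sub Gce GE Ju).
Qed.

Lemma star_of_nil u G : G \in ce ->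
  star_of u [::] G <-> closure (cell u) `<=` closure G.
Proof.
move=> Gce; rewrite closure_star //.
by split=> [[q [GE uq _]]|[q GE uq]]; exists q.
Qed.

Lemma star_euler u J : J \subset walls u ->
  \sum_(G <- ce | `[< closure (cell u) `<=` closure G >] && `[< supp G `<=` flat u J >])
     (-1) ^+ toric_dim G = (-1) ^+ (n - \rank (wall_mx J)) :> K.
Proof.
move=> Ju; have := star_sum (flat_csP Ju).
rewrite /chi asboolT; last by exists 0; apply/sat_flat_cs; exact: orth0.
rewrite rank_flat_cs => <-; rewrite big_seq_cond [RHS]big_seq_cond.
apply: eq_bigl => G; case: (boolP (G \in ce)) => //= Gce.
rewrite -asbool_and; apply: asbool_equiv_eq.
by rewrite (star_flat [::] Ju Gce) star_of_nil.
Qed.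

(** Means that [l] is not constant along any flat of positive dimension; [v] may be negated to
    obtain the positive sign. *)
Definition generic (l : 'rV[R]_n) : Prop := forall J, (\rank (wall_mx J) < n)%N ->
  exists2 v, orth J v & 0 < dot l v.

(** It suffices that [l] does not vanish on one chosen nonzero vector for each of the finitely many
    [J]. *)
Lemma exists_generic : exists l, generic l.
Proof.
have ex J : exists v, (\rank (wall_mx J) < n)%N -> v != 0 /\ orth J v.
  have [rk|] := boolP (\rank (wall_mx J) < n)%N; last by exists 0.
  have : \rank (kermx (wall_mx J)^T) != 0%N by rewrite mxrank_ker mxrank_tr; lia.
  rewrite mxrank_eq0 => /rowV0Pn[v vk nz]; exists v => _; split => //.
  apply/orth_wall_mx; move/sub_kermxP/(congr1 trmx): vk.
  by rewrite trmx_mul trmxK linear0.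
have [f Hf] := choice ex.
pose vs := [seq f J | J <- enum {: {set 'I_m}} & (\rank (wall_mx J) < n)%N].
have [|l Hl] := @generic_form _ _ vs.
  by move=> v /mapP[J]; rewrite mem_filter => /andP[/Hf[nz _] _] ->.
exists l => J rk; have [nz fJ] := Hf J rk.
have : dot (f J) l != 0 by apply: Hl; apply: map_f; rewrite mem_filter rk mem_enum.
rewrite dotC; case: (ltgtP (dot l (f J)) 0) => // h _; last by exists (f J).
by exists (- f J); [exact: orthN|rewrite dotNr oppr_gt0].
Qed.

(** The normals span, so a left inverse [B] of their matrix bounds the coordinates of [u - q] by
    differences of heights, which are at most 1 on a closed cell. *)
Lemma compact_closed_cell q : compact [set u | faceV u q].
Proof.
have full : row_full (wall_mx [set: 'I_m]%SET).
  apply/negPn/negP => nf.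
  have : \rank (kermx (wall_mx [set: 'I_m]%SET)^T) != 0%N.
    rewrite mxrank_ker mxrank_tr; move: nf; rewrite /row_full.
    by have := rank_leq_col (wall_mx [set: 'I_m]%SET); lia.
  rewrite mxrank_eq0 => /rowV0Pn[v vk /eqP]; apply; apply: ess => i.
  have : orth [set: 'I_m]%SET v; last by apply; rewrite finset.inE.
  apply/orth_wall_mx; move/sub_kermxP/(congr1 trmx): vk.
  by rewrite trmx_mul trmxK linear0.
have /row_fullP[B BM] := full.
pose r j := \sum_(i < m) `|B j i|.
have cB : compact [set u : 'rV[R]_n |
    forall j, `[q 0 j - r j, q 0 j + r j]%classic (u 0 j)].
  exact: (@rV_compact R n (fun j => `[q 0 j - r j, q 0 j + r j]%classic)
    (fun j => @segment_compact R _ _)).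
have clA : closed [set u | faceV u q].
  rewrite (_ : [set u | faceV u q] = \bigcap_(i in [set: 'I_m])
      (height i @^-1` `[(fl (height i q))%:~R, (cl (height i q))%:~R])).
    apply: closed_bigI => i _; apply: closed_comp; last exact: interval_closed.
    by move=> u _; exact: continuous_height.
  apply/seteqP; split => u H i.
    by move=> _; rewrite /= in_itv /=; apply/andP; apply/face_ofE; exact: H.
  by have := H i I; rewrite /= in_itv /= => /andP h; apply/face_ofE.
apply: (subclosed_compact clA cB) => u uq j; rewrite /= in_itv /= -ler_distl.
have -> : u 0 j - q 0 j = (B *m (wall_mx [set: 'I_m]%SET *m (u - q)^T)) j 0.
  by rewrite mulmxA BM mul1mx !mxE.
rewrite mxE; apply: le_trans (ler_norm_sum _ _ _) _; apply: ler_sum => i _.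
rewrite normrM ler_piMr //.
have -> : (wall_mx [set: 'I_m]%SET *m (u - q)^T) i 0 = dot (al i) (u - q).
  have e : al i = row i (wall_mx [set: 'I_m]%SET) by rewrite rowK finset.inE.
  by rewrite e /dot -row_mul [RHS]mxE.
rewrite -(heightB _ be); apply: face_of_dist (uq i) _; exact: face_of_refl.
Qed.

Section Top.
Variable l : 'rV[R]_n.
Hypothesis l_gen : generic l.

Definition top_of q z : Prop := faceV z q /\ forall w, faceV w q -> dot l w <= dot l z.

Lemma exists_top q : exists z, top_of q z.
Proof.
have [|||z] := @EVT_max_rV R n (dot l) [set u | faceV u q].
- by exists q; exact: faceV_refl.
- exact: compact_closed_cell.
- by apply: continuous_subspaceT; exact: continuous_dot.
rewrite inE => zq zmax; exists z; split => // w wq.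
by apply: zmax; rewrite inE.
Qed.

(** If the walls at a maximum [z] did not span, [l] could be increased inside the cell of [z]. *)
Lemma top_vertex q z : faceV z q -> (forall w, faceV w q -> dot l w <= dot l z) ->
  \rank (wall_mx (walls z)) = n.
Proof.
move=> zq zmax; apply/eqP; rewrite eqn_leq rank_leq_col /= leqNgt.
apply/negP => /l_gen[v vz lv].
have [t t0 zt] := small_step z v.
have cz : cellV (z + t *: v) z.
  by apply: faceV_cellV => // i iz; rewrite heightD dotZr vz // mulr0 addr0.
have := zmax _ (faceV_trans cz.2 zq); rewrite dotDr dotZr.
by apply/negP; rewrite -ltNge ltrDl mulr_gt0.
Qed.

Lemma full_orth0 J v : \rank (wall_mx J) = n -> orth J v -> v = 0.
Proof.
move=> rk /orth_wall_mx v0.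
have /row_fullP[B BM] : row_full (wall_mx J) by rewrite /row_full rk.
move/(congr1 (mulmx B)): v0; rewrite mulmxA BM mul1mx mulmx0 => /(congr1 trmx).
by rewrite trmxK linear0.
Qed.

(** The midpoint of two maxima is a maximum, hence a vertex; at each of its walls the two ends have
    the same height. *)
Lemma top_unique q z1 z2 : top_of q z1 -> top_of q z2 -> z1 = z2.
Proof.
move=> [f1 m1] [f2 m2].
have e12 : dot l z1 = dot l z2 by apply/eqP; rewrite eq_le m1 // m2.
pose z := z1 + 2^-1 *: (z2 - z1).
have zq : faceV z q.
  by move=> i; rewrite height_segment; apply: face_of_convex; [lra|lra|exact: f1|exact: f2].
have zmax w : faceV w q -> dot l w <= dot l z.
  move=> /m1; rewrite /z dotDr dotZr dotBr e12 subrr mulr0 addr0 //.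
have rk := top_vertex zq zmax.
apply/eqP; rewrite -subr_eq0; apply/eqP; apply: full_orth0 rk _ => i iz.
rewrite -(heightB _ be); apply/eqP; rewrite subr_eq0; apply/eqP.
apply: face_of_midpoint (f1 i) (f2 i) _.
by rewrite -height_segment -wallsE.
Qed.

(** No point of [G], seen from [V], has a larger value of [l]. The formulation through [star_of]
    makes [star_sum] count the complement. *)
Definition top_cell (V G : set (torus R n)) : Prop :=
  closure V `<=` closure G /\ ~ star_of (cell_rep V) [:: (l, Some true)] G.

Lemma top_cellP V q : V \in ce -> (cell q : {classic set (torus R n)}) \in ce ->
  top_cell V (cell q) <-> exists2 k, lattice k & top_of q (cell_rep V + k).
Proof.
move=> Vce qce; have VR := cell_repE Vce; rewrite /top_cell {1}VR; set u := cell_rep V.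
split=> [[/(closure_cell_sub be al_int)[k kl uk] npos]|[k kl [uk umax]]].
  exists k => //; split => // w wq; rewrite leNgt; apply/negP => lt.
  have lim (t : R) : 0 < t -> t <= 1 ->
      dot l (w + t *: (q - w)) <= dot l (u + k).
    move=> t0 t1; rewrite leNgt; apply/negP => lt'; apply: npos.
    have qt := cellV_segment t0 t1 wq.
    exists (w + t *: (q - w) - k); split.
    - by rewrite (cell_shift be al_int _ (latticeN kl)); exact: cellV_cell.
    - apply: (faceV_shift be al_int u (w + t *: (q - w) - k) kl).1; rewrite subrK.
      exact: faceV_trans uk qt.2.
    - rewrite /= andbT sgn_pos (_ : _ - k - u = w + t *: (q - w) - (u + k)).
        by rewrite dotBr subr_gt0.
      by apply/matrixP => a b; rewrite !mxE; ring.
  (* A value larger than the one at [u + k] persists at [w + t *: (q - w)] for small [t], which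
     contradicts [lim]; this [t] keeps the loss below [D]. *)
  pose D := dot l w - dot l (u + k); pose E := dot l q - dot l w.
  have D0 : 0 < D by rewrite subr_gt0.
  pose t : R := Num.min 1 (D / (2 * (`|E| + 1))).
  have E0 : 0 < 2 * (`|E| + 1) by rewrite mulr_gt0 // ltr_wpDl.
  have t0 : 0 < t by rewrite lt_min ltr01 divr_gt0.
  have t1 : t <= 1 by rewrite ge_min lexx.
  have t2 : t * (2 * (`|E| + 1)) <= D by rewrite -ler_pdivlMr // ge_min lexx orbT.
  have h0 := lim t t0 t1; rewrite dotDr dotZr dotBr -/E in h0.
  have h1 : - (t * E) <= t * `|E|.
    by rewrite -mulrN ler_pM2l // (le_trans (ler_norm _)) // normrN.
  have h2 : 2 * (t * `|E|) + 2 * t <= D.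
    by apply: le_trans t2; rewrite le_eqVlt; apply/orP; left; apply/eqP; ring.
  have h3 : 0 <= t * `|E| by rewrite mulr_ge0 // ltW.
  move: D0 h2; rewrite /D => D0 h2; clear -h0 h1 h2 h3 D0 t0.
  move: (t * `|E|) (t * E) h0 h1 h2 h3 => X Y; lra.
split; first by apply/(closure_cell_sub be al_int); exists k.
move=> [q' [GE uq']]; rewrite /= andbT sgn_pos => lt.
have uq'k := (faceV_shift be al_int u q' kl).2 uq'.
have qq' : cellV q (q' + k).
  by apply: star_cellV uk uq'k _; rewrite (cell_shift be al_int).
have := umax _ qq'.1; rewrite leNgt => /negP; apply.
rewrite -subr_gt0 -dotBr (_ : q' + k - (u + k) = q' - u) //.
by apply/matrixP => a b; rewrite !mxE; ring.
Qed.

Lemma exists_top_cell G : G \in ce -> exists2 V : {classic set (torus R n)},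
  V \in ce & forall V', V' \in ce -> top_cell V' G <-> V' = V.
Proof.
move=> Gce; have GR := cell_repE Gce; set q := cell_rep G in GR.
have qce : (cell q : {classic set (torus R n)}) \in ce by rewrite -GR.
have [z zt] := exists_top q.
have zce : (cell z : {classic set (torus R n)}) \in ce by apply/ceP; exists z.
have rk := top_vertex zt.1 zt.2.
exists (cell z) => // V' V'ce; rewrite {1}GR (top_cellP V'ce qce); split.
  move=> [k kl /(top_unique zt) e]; rewrite (cell_repE V'ce) e.
  by rewrite (cell_shift be al_int).
move=> e; have := cell_repE V'ce; rewrite {1}e => /cell_inj[k kl zk].
exists k => //; suff -> : cell_rep V' + k = z by [].
apply/eqP; rewrite -subr_eq0; apply/eqP; apply: full_orth0 rk _ => i iz.
by rewrite -(heightB _ be) (faceV_walls zk.1 iz) subrr.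
Qed.

(** The star of [V] in the flat and its part meeting the open half-space where [l] is positive
    belong to cones of the same dimension, so their sums agree. The cells with top [V] are the
    difference. *)
Lemma top_sum V u0 J : V \in ce -> J \subset walls u0 -> (\rank (wall_mx J) < n)%N ->
  \sum_(G <- ce | `[< top_cell V G >] && `[< supp G `<=` flat u0 J >])
    (-1) ^+ toric_dim G = 0 :> K.
Proof.
move=> Vce Ju0 rk; have VR := cell_repE Vce; set u := cell_rep V in VR.
have [Fu|nFu] := pselect (flat u0 J (pi u)); last first.
  rewrite big_seq_cond big_pred0 // => G; apply/negP => /and3P[Gce /asboolP[VG _] /asboolP sub].
  move: VG; rewrite {1}VR => /(closure_star u Gce)[q GE uq].
  have /(supp_sub Gce GE Ju0) Fq := sub; apply: nFu.
  have Jq := flat_walls al_int Ju0 Fq; rewrite -(flat_rebase Fq).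
  apply: orth_flat => i iJ; rewrite -(heightB _ be).
  by rewrite (faceV_walls uq (fintype.subsetP Jq _ iJ)) subrr.
have Ju := flat_walls al_int Ju0 Fu; rewrite -(flat_rebase Fu).
have pos_cs : forall a, (a, None) \in (l, Some true) :: flat_cs J ->
    exists2 i, i \in walls u & a = al i.
  by move=> a; rewrite inE => /orP[/eqP[]//|]; exact: flat_csP.
have E1 := star_euler Ju; have E2 := star_sum pos_cs.
have chiE : chi K ((l, Some true) :: flat_cs J) = (-1) ^+ (n - \rank (wall_mx J)).
  have ex : exists v, sat v ((l, Some true) :: flat_cs J).
    have [v vJ lv] := l_gen rk; exists v; rewrite /= sgn_pos lv /=.
    exact/sat_flat_cs.
  by rewrite /chi asboolT //= rank_flat_cs.
rewrite chiE in E2.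
have split_sum : \sum_(G <- ce | `[< closure (cell u) `<=` closure G >] &&
     `[< supp G `<=` flat u J >]) (-1) ^+ toric_dim G =
   \sum_(G <- ce | `[< star_of u ((l, Some true) :: flat_cs J) G >]) (-1) ^+ toric_dim G +
   \sum_(G <- ce | `[< top_cell V G >] && `[< supp G `<=` flat u J >])
    (-1) ^+ toric_dim G :> K.
  rewrite big_mkcond [X in _ = X + _]big_mkcond [X in _ = _ + X]big_mkcond -big_split /=.
  rewrite big_seq [RHS]big_seq; apply: eq_bigr => G Gce.
  have -> : `[< star_of u ((l, Some true) :: flat_cs J) G >] =
      `[< star_of u [:: (l, Some true)] G >] && `[< supp G `<=` flat u J >].
    rewrite -asbool_and; apply: asbool_equiv_eq.
    exact: (star_flat [:: (l, Some true)] Ju Gce).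
  case: (boolP `[< supp G `<=` flat u J >]) => _; rewrite ?andbT ?andbF ?addr0 //.
  rewrite /top_cell -/u asbool_and asbool_neg {1}VR.
  case: (boolP `[< star_of u [:: (l, Some true)] G >]) => /= [/asboolP [q [GE uq _]]|_].
    rewrite andbF addr0 asboolT //; apply/(closure_star u Gce); by exists q.
  by rewrite andbT add0r.
by move: split_sum; rewrite E1 E2 => /eqP; rewrite addrC -subr_eq subrr => /eqP.
Qed.

End Top.

(** A flat that is a point is its own only cell. Otherwise the cells are grouped by their top, and
    every group sums to 0. *)
Lemma global_euler u J : J \subset walls u ->
  \sum_(G <- ce | `[< supp G `<=` flat u J >]) (-1) ^+ toric_dim G =
  (n - \rank (wall_mx J) == 0)%N%:R :> K.
Proof.
move=> Ju; have rkn := rank_leq_col (wall_mx J).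
have [rk|rk] := boolP (n - \rank (wall_mx J) == 0)%N.
  have rkE : \rank (wall_mx J) = n by lia.
  have E := star_euler Ju; rewrite rkE subnn expr0 in E.
  rewrite /= -[RHS]E.
  rewrite big_seq_cond [RHS]big_seq_cond; apply: eq_bigl => G.
  case: (boolP (G \in ce)) => //= Gce; apply/esym/andb_idl => /asboolP sub.
  apply/asboolP; have GR := cell_repE Gce.
  have /flat_pi[k kl ok] := (supp_sub Gce GR Ju).1 sub.
  have /eqP := full_orth0 rkE ok; rewrite subr_eq0 => /eqP e.
  by rewrite GR -e (cell_shift be al_int).
have {}rk : (\rank (wall_mx J) < n)%N by lia.
have [l lg] := exists_generic.
transitivity (\sum_(G <- ce | `[< supp G `<=` flat u J >])
   \sum_(V <- ce | `[< top_cell l V G >]) (-1) ^+ toric_dim G : K).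
  rewrite big_seq_cond [RHS]big_seq_cond; apply: eq_bigr => G /andP[Gce _].
  have [V Vce VP] := exists_top_cell lg Gce.
  rewrite big_mkcond (bigD1_seq V) //= asboolT; last exact/VP.
  rewrite big_seq_cond big1 ?addr0 // => V' /andP[V'ce /eqP ne].
  by case: asboolP => // /(VP _ V'ce).
rewrite (exchange_big_dep predT) //= big_seq big1 // => V Vce.
by under eq_bigl do rewrite andbC; exact: top_sum.
Qed.

End Star.

(** * Primitive normal vectors *)

(* The Smith normal form makes the normal vector primitive. *)
Lemma primitive_normal n (a : 'rV[rat]_n) : a != 0 ->
  exists (g : rat) (r k : 'I_n -> int),
    [/\ g != 0, forall i, a 0 i = g * (r i)%:~R & \sum_i r i * k i = 1].
Proof.
move=> a0.
pose D := \prod_(i < n) denq (a 0 i).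
have D0 : D != 0 by apply/prodf_neq0 => i _; exact: denq_neq0.
have DR : D%:~R != 0 :> rat by rewrite intr_eq0.
pose M : 'M[int]_(1, n) := \row_i (numq (a 0 i) * \prod_(j < n | j != i) denq (a 0 j)).
have aM i : a 0 i = (M 0 i)%:~R / D%:~R.
  have DE : D = denq (a 0 i) * \prod_(j < n | j != i) denq (a 0 j) by rewrite /D (bigD1 i).
  rewrite /M mxE DE !intrM invfM mulrACA divff ?mulr1 ?divq_num_den //.
  by rewrite intr_eq0; apply/prodf_neq0 => j _; exact: denq_neq0.
have [L Lu [Rm Ru [d _ ME]]] := int_Smith_normal_form M.
have /existsP[i0 ai0] : [exists i, a 0 i != 0].
  apply: contraNT a0 => /existsPn H; apply/eqP/matrixP => x i; rewrite ord1 [RHS]mxE.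
  by apply/eqP; rewrite -[_ == _]negbK; exact: H.
pose j0 : 'I_n := Ordinal (leq_ltn_trans (leq0n i0) (ltn_ord i0)).
(* [M] is a multiple of the first row of the unimodular matrix [Rm]; the first column of its inverse
   gives the Bezout coefficients [k]. *)
pose c := L 0 0 * d`_0.
have ME' i : M 0 i = c * Rm j0 i.
  rewrite ME mxE (bigD1 j0) //= big1 ?addr0 => [|j nj].
    by rewrite mxE big_ord1 mxE /c.
  rewrite mxE big_ord1 mxE /=; case: eqP => [e|_]; last by rewrite mulr0n mulr0 mul0r.
  by case/eqP: nj; apply/val_inj; rewrite /= -e.
have c0 : c != 0.
  by apply: contraNneq ai0 => ce; rewrite aM ME' ce mul0r mul0r.
exists (c%:~R / D%:~R), (fun i => Rm j0 i), (fun i => invmx Rm i j0); split.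
- by rewrite mulf_neq0 ?invr_eq0 ?intr_eq0.
- by move=> i; rewrite aM ME' rmorphM /= mulrAC.
- have := congr1 (fun X : 'M[int]_n => X j0 j0) (mulmxV Ru).
  by rewrite !mxE eqxx.
Qed.

(** For a primitive normal some lattice vector [kR] has value 1. A point of integral height [z] then
    reaches the hyperplane by subtracting [z *: kR], which does not change its image. Without
    primitivity the right side would describe several parallel hyperplanes. *)
Lemma toric_hyperplaneE (R : realType) n (a : 'rV[rat]_n) (b : R) : a != 0 ->
  exists (al : 'rV[R]_n) (be : R),
    (forall k, lattice k -> dot al k \is a Num.int) /\
    forall u, toric_hyperplane a b (torus_pi u) <-> dot al u - be \is a Num.int.
Proof.
move=> /primitive_normal[g [r [k [g0 ar rk]]]].
have gR : ratr g != 0 :> R by rewrite fmorph_eq0.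
pose al : 'rV[R]_n := \row_i (r i)%:~R; pose kR : 'rV[R]_n := \row_i (k i)%:~R.
have sumE (x : 'rV[R]_n) : \sum_(i < n) ratr (a 0 i) * x 0 i = ratr g * dot al x.
  rewrite dotE mulr_sumr; apply: eq_bigr => i _.
  by rewrite ar rmorphM /= ratr_int mxE mulrA.
have alk : dot al kR = 1.
  rewrite dotE -[RHS](mulr1z 1) -rk rmorph_sum /=.
  by apply: eq_bigr => i _; rewrite !mxE rmorphM.
have al_int x : lattice x -> dot al x \is a Num.int.
  move=> xl; rewrite dotE; apply: rpred_sum => i _; rewrite mxE.
  by apply: rpredM; [exact: intr_int|exact: xl].
exists al, (b / ratr g); split => // u; split.
  move=> [x xb /torus_piP xu]; rewrite /= sumE in xb.
  have -> : b / ratr g = dot al x by rewrite -xb mulrC mulKf.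
  by rewrite -dotBr -[u - x]opprB dotNr rpredN; exact: al_int.
move=> zint; pose z := dot al u - b / ratr g.
exists (u - z *: kR).
  rewrite /= sumE dotBr dotZr alk mulr1 /z subKr mulrC divfK //.
apply/torus_piP => i; rewrite addrAC subrr add0r !mxE rpredN.
by apply: rpredM; [exact: zint|exact: intr_int].
Qed.

Lemma finite_set_index (T : Type) (B : set T) : finite_set B ->
  exists2 s : seq {classic T}, uniq s & forall x, x \in s <-> B x.
Proof.
move=> /(@finite_seqP {classic T})[s Bs]; exists (undup s); first exact: undup_uniq.
by move=> x; rewrite mem_undup Bs.
Qed.

Theorem theorem3p22 (R : realType) (n : nat) (n_gt0 : (0 < n)%N)
    (A : set (set (torus R n))) (arrA : toric_arrangement A)
    (regA : regular_cell_complex R (toric_cells A) (@toric_dim R n)) :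
  ab_index (face_poset A) =
    (ab_a - ab_b) ^+ n.+1 +
    (1 / 2%:R) *:
      ab_rev (omega (ab_a * Hprime (ab_index (intersection_poset A)) * ab_b)).
Proof.
have [finA hypA] := arrA.
have [s us sA] := finite_set_index finA.
pose m := size s; pose H (i : 'I_m) : set (torus R n) := tnth (in_tuple s) i.
have H_inj : injective H.
  move=> i j; rewrite /H !(tnth_nth (setT : {classic set (torus R n)})) => /eqP.
  by rewrite nth_uniq // => /eqP /val_inj.
have AH X : A X <-> exists i, X = H i.
  split=> [/sA /(tnthP (in_tuple s))//|[i ->]].
  by apply/sA; exact: mem_tnth.
have norm i : exists ab : 'rV[R]_n * R,
    (forall k, lattice k -> dot ab.1 k \is a Num.int) /\
    forall u, H i (torus_pi u) <-> dot ab.1 u - ab.2 \is a Num.int.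
  have /hypA[a [b [a0 HE]]] : A (H i) by apply/AH; exists i.
  by have [al [be Hab]] := toric_hyperplaneE b a0; exists (al, be); rewrite HE.
have [ab Hab] := choice norm.
pose al i := (ab i).1; pose be i := (ab i).2.
have al_int i k : lattice k -> dot (al i) k \is a Num.int by exact: (Hab i).1.
have HE i u : H i (torus_pi u) <-> height al be i u \is a Num.int by exact: (Hab i).2.
have [finC _ _ _ _] := regA.
have [ce ce_uniq ceP] := finite_set_index finC.
have cellsP := toric_cellsP al_int AH HE.
have flatsP := toric_flatsP al_int AH H_inj HE.
have ess := essential al_int AH HE regA.
have injc := torus_pi_inj_closed_cell al_int AH HE regA.
have ceP' e : e \in ce <-> exists q, e = cell al be q by rewrite ceP.
(* A flat is the union of the cells it contains, so all flats occur among the finitely many unions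
   of subfamilies of [ce]. *)
pose unions : seq {classic set (torus R n)} :=
  [seq \bigcup_(G in [set G | G \in mask mm ce]) (G : set (torus R n)) |
     mm <- map val (enum {: (size ce).-tuple bool})].
pose fl : seq {classic set (torus R n)} := undup [seq x <- unions | `[< toric_flats A x >]].
have flP x : x \in fl <-> toric_flats A x.
  rewrite mem_undup mem_filter; split=> [/andP[/asboolP]//|xf].
  rewrite asboolT //=; apply/mapP.
  exists [seq `[< (G : set (torus R n)) `<=` x >] | G <- ce].
    apply/mapP; exists [tuple of [seq `[< (G : set (torus R n)) `<=` x >] | G <- in_tuple ce]] => //.
    by rewrite mem_enum.
  rewrite -filter_mask; apply/seteqP; split => [p xp|p [G /=]]; last first.
    by rewrite mem_filter => /andP[/asboolP Gx _] /Gx.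
  have [u e] := torus_pi_surj p; rewrite -e in xp *.
  have /flatsP[w [J [Jw xE]]] := xf.
  exists (cell al be u); last exact: cell_refl.
  rewrite /= mem_filter; apply/andP; split; last by apply/ceP'; exists u.
  by apply/asboolP; rewrite xE; apply: (cell_flat al_int Jw); rewrite -xE.
pose z (G : {classic set (torus R n)}) : {classic set (torus R n)} := supp al be G.
have repE G : G \in ce -> G = cell al be (cell_rep al be G) by exact: cell_repE.
have zdim G : G \in ce -> toric_dim (z G) = toric_dim G.
  by move=> Gce; rewrite {2}(repE G Gce) /z /supp dim_supp.
have Tflat : flat al 0 finset.set0 = setT :> set (torus R n).
  apply/seteqP; split => // p _; have [u <-] := torus_pi_surj p.
  by exists u => // i; rewrite finset.inE.
have dimT : toric_dim (@setT (torus R n)) = n.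
  rewrite -Tflat (dim_flat (be := be) al_int) ?finset.sub0set //.
  rewrite (_ : wall_mx al finset.set0 = 0) ?mxrank0 ?subn0 //.
  by apply/row_matrixP => i; rewrite rowK finset.inE row0.
apply: (@toric_assembly R n A n_gt0 ce fl z) => //.
- exact: undup_uniq.
- by apply/flP/flatsP; exists 0, finset.set0; rewrite finset.sub0set Tflat.
- move=> x y /flP/flatsP[u [J [Ju ->]]] /flP/flatsP[u' [J' [Ju' ->]]].
  exact: (flat_dim_lt al_int Ju Ju').
- move=> G Gce; apply/flP/flatsP.
  by exists (cell_rep al be G), (walls al be (cell_rep al be G)).
- move=> F G Fce Gce; rewrite (repE F Fce) (repE G Gce).
  exact: (cell_dim_lt al_int).
- move=> F G w Fce Gce /flP/flatsP[u [J [Ju ->]]] FG sub.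
  have FR := repE F Fce; move: FG; rewrite {1}FR.
  move=> /(closure_star al_int ceP' _ Gce)[q GE Fq].
  have /(supp_sub al_int ceP' Gce GE Ju) Fl := sub.
  apply/(supp_sub al_int ceP' Fce FR Ju); rewrite -(flat_rebase Fl).
  have Jq := flat_walls al_int Ju Fl.
  apply: orth_flat => i iJ; rewrite -(heightB _ be).
  by rewrite (faceV_walls Fq (fintype.subsetP Jq _ iJ)) subrr.
- move=> F y Fce /flP/flatsP[u0 [J [Ju0 yE]]] /asboolP zFy.
  have FR := repE F Fce; set u := cell_rep al be F in FR.
  have Fu : flat al u0 J (torus_pi u).
    by apply/(supp_sub al_int ceP' Fce FR Ju0); rewrite -yE.
  have Ju := flat_walls al_int Ju0 Fu.
  have yu : y = flat al u J by rewrite yE (flat_rebase Fu).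
  rewrite yu (dim_flat (be := be) al_int Ju).
  rewrite -(star_euler al_int injc _ ce_uniq ceP' Ju) -FR.
  by apply: eq_sum_seq => [//|G Gce _]; rewrite zdim.
- move=> x /flP/flatsP[u [J [Ju ->]]].
  rewrite (dim_flat (be := be) al_int Ju).
  rewrite -(global_euler al_int ess injc _ ce_uniq ceP' Ju).
  by apply: eq_sum_seq => [//|G Gce _]; rewrite zdim.
Qed.
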